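(* Let $\mathcal X=[a,\infty)\subset\mathbb R$ and $\mathcal F=\{f:0\le f(x)\le(Mg_0(x))^{1/(1-\gamma)}\ \forall x\in\mathcal X,\ f\text{ is non-increasing on }\mathcal X\}$, where $M>0$, $\gamma\in(0,1)$, and $g_0$ is a non-increasing positive probability density on $\mathcal X$ with $g_0(a)<\infty$. Let $g_0$ be the sampling distribution. Suppose $\|\phi_j\|_{2+\delta}<\infty$ for $j=0,\ldots,l$ and some $\delta>0$, and that there exists $L_0\in\mathcal L$ such that $\mathbb E_{g_0}[\phi_j(X)L_0(X)]<\mu_j$ for $j=1,\ldots,m$ and $\mathbb E_{g_0}[\phi_j(X)L_0(X)]=\mu_j$ for $j=m+1,\ldots,l$, with moreover $(\mu_{m+1},\ldots,\mu_l)$ an interior point of $\{(\mathbb E_{g_0}[\phi_{m+1}(X)L(X)],\ldots,\mathbb E_{g_0}[\phi_l(X)L(X)]):L\in\mathcal L\}$. Then the problem $(\mathcal P_n)$ is equivalent to the linear program $(\mathcal P_n')$ (i.e. $(\mathcal P_n)$ is finite-dimensionally reducible) with the discrete shape constraint $$L(X_{(i+1)})g_0(X_{(i+1)})\le L(X_{(i)})g_0(X_{(i)}),\ i=1,\ldots,n-1,\qquad 0\le L(X_i)g_0(X_i)\le(Mg_0(X_i))^{1/(1-\gamma)},\ i=1,\ldots,n,$$ where $X_{(1)}\le\cdots\le X_{(n)}$ are the order statistics of $X_1,\ldots,X_n$. Additionally, $|val(\mathcal P_n)-val(\mathcal P)|\overset{\text{a.s.*}}{\to}0$ and $\sqrt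 n\,(val(\mathcal P_n)-val(\mathcal P))=O_{\mathbb P^*}(1)$.
   Context: Setting. $\phi_0,\ldots,\phi_l:\mathcal X\to\mathbb R$ are known functions, $0\le m\le l$, $\mu_1,\ldots,\mu_l\in\mathbb R$, and one of $\phi_1,\ldots,\phi_l$ is the indicator $I(x\in\mathcal X)$ (total mass constraint). $X,X_1,X_2,\ldots$ are i.i.d. with density $g_0$, $\mathbb E_{g_0}$ is expectation under $g_0$, $\|h\|_p=(\mathbb E_{g_0}|h(X)|^p)^{1/p}$, and $\mathcal L=\{f/g_0:f\in\mathcal F\}$. Since $g_0$ is a density, the $X_i$ are almost surely distinct; the equivalence is understood on that event. Problem $(\mathcal P)$: $\sup_{L\in\mathcal L}\mathbb E_{g_0}[\phi_0(X)L(X)]$ subject to $\mathbb E_{g_0}[\phi_j(X)L(X)]\le\mu_j$ for $j=1,\ldots,m$ and $\mathbb E_{g_0}[\phi_j(X)L(X)]=\mu_j$ for $j=m+1,\ldots,l$. Problem $(\mathcal P_n)$ (the IW-SAA problem): $\sup_{L\in\mathcal L}\frac1n\sum_{i=1}^n\phi_0(X_i)L(X_i)$ subject to $\frac1n\sum_{i=1}^n\phi_j(X_i)L(X_i)\le\mu_j$ for $j=1,\ldots,m$ and $\frac1n\sum_{i=1}^n\phi_j(X_i)L(X_i)=\mu_j$ for $j=m+1,\ldots,l$. Problem $(\mathcal P_n')$: the same objective and moment constraints as $(\mathcal P_n)$, but with the real numbers $L(X_1),\ldots,L(X_n)$ as decision variables and with $L\in\mathcal L$ replaced by the stated discrete shape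 constraint. ''Equivalent'' / ''finite-dimensionally reducible'' means: the values at $X_1,\ldots,X_n$ of any $L\in\mathcal L$ satisfy the discrete shape constraint, and conversely any real numbers $L(X_1),\ldots,L(X_n)$ satisfying it are the values at $X_1,\ldots,X_n$ of some $L\in\mathcal L$; in particular $val(\mathcal P_n)=val(\mathcal P_n')$. $val(\cdot)$ is the optimal value in $[-\infty,\infty]$ ($\sup\emptyset=-\infty$). If $l=m$ the interior point condition is vacuous. Outer convergence. On $(\Omega,\mathcal G,\mathbb P)$, $\mathbb P^*(B)=\inf\{\mathbb P(A):A\supset B,A\in\mathcal G\}$. $T^*$ is the minimal measurable majorant of a map $T:\Omega\to[-\infty,\infty]$ (measurable, $T^*\ge T$, and $T^*\le U$ a.s. for every measurable $U\ge T$ a.s.). $Z_n\overset{\text{a.s.*}}{\to}Z$ means $|Z_n-Z|^*\to0$ a.s. $Z_n=O_{\mathbb P^*}(1)$ means: for every $\varepsilon>0$ there is $K>0$ with $\limsup_n\mathbb P^*(|Z_n|\ge K)\le\varepsilon$. *)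

(* Defs.v *)
From HB Require Import structures.
From mathcomp Require Import all_boot all_order all_algebra.
From mathcomp Require Import all_classical all_reals all_analysis measurable_realfun.

Set Implicit Arguments.
Unset Strict Implicit.
Unset Printing Implicit Defensive.

Import Order.TTheory GRing.Theory Num.Theory.
Import numFieldNormedType.Exports.

Local Open Scope classical_set_scope.
Local Open Scope ring_scope.

(* Functions on [a, oo) are represented by functions R -> R whose values to the
   left of a are irrelevant: they are never tested or integrated below. *)

Definition nonincreasing_on (R : realType) (a : R) (f : R -> R) : Prop :=
  forall x y, a <= x -> x <= y -> f y <= f x.

Definition prob_density_on (R : realType) (a : R) (g0 : R -> R) : Prop :=
  (forall x, a <= x -> 0 < g0 x) /\
  (\int[lebesgue_measure]_(x in `[a, +oo[) (g0 x)%:E = 1)%E.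

(* E_{g0}[h(X)] *)
Definition expect_g0 (R : realType) (a : R) (g0 h : R -> R) : R :=
  \int[lebesgue_measure]_(x in `[a, +oo[) (h x * g0 x).

(* ||h||_p with respect to g0, possibly +oo *)
Definition norm_g0 (R : realType) (a : R) (g0 : R -> R) (p : R) (h : R -> R)
    : \bar R :=
  ((\int[lebesgue_measure]_(x in `[a, +oo[) (`|h x| `^ p * g0 x)%:E)
     `^ p^-1)%E.

Definition shape_class (R : realType) (a M gamma : R) (g0 : R -> R)
    : set (R -> R) :=
  [set f | (forall x, a <= x -> 0 <= f x <= (M * g0 x) `^ (1 / (1 - gamma))) /\
           nonincreasing_on a f].

Definition ratio_class (R : realType) (a M gamma : R) (g0 : R -> R)
    : set (R -> R) :=
  [set (fun x => f x / g0 x) | f in shape_class a M gamma g0].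

(* [e j] stands for the (true or empirical) mean of phi_j L. *)
Definition moment_constraints (R : realType) (l m : nat) (mu e : nat -> R)
    : Prop :=
  (forall j, (1 <= j <= m)%N -> e j <= mu j) /\
  (forall j, (m < j <= l)%N -> e j = mu j).

Definition val_P (R : realType) (a M gamma : R) (g0 : R -> R) (l m : nat)
    (phi : nat -> R -> R) (mu : nat -> R) : \bar R :=
  let e L j := expect_g0 a g0 (fun x => phi j x * L x) in
  ereal_sup [set (e L 0%N)%:E | L in
    [set L | ratio_class a M gamma g0 L /\ moment_constraints l m mu (e L)]].

(* In the sample problems, x i and y i stand for X_{i+1} and L(X_{i+1}). *)
Definition sample_mean (R : realType) (n : nat) (x y : 'I_n -> R)
    (h : R -> R) : R :=
  n%:R^-1 * \sum_(i < n) h (x i) * y i.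

Definition val_Pn (R : realType) (a M gamma : R) (g0 : R -> R) (l m : nat)
    (phi : nat -> R -> R) (mu : nat -> R) (n : nat) (x : 'I_n -> R) : \bar R :=
  let e (L : R -> R) j := sample_mean x (L \o x) (phi j) in
  ereal_sup [set (e L 0%N)%:E | L in
    [set L | ratio_class a M gamma g0 L /\ moment_constraints l m mu (e L)]].

(* x (order_index x i) is the i-th order statistic, counting from 0. *)
Definition order_index (R : realType) (n : nat) (x : 'I_n -> R) (i : 'I_n)
    : 'I_n :=
  tnth (sort_tuple (fun j k => x j <= x k) (ord_tuple n)) i.

Definition discrete_shape (R : realType) (M gamma : R) (g0 : R -> R)
    (n : nat) (x y : 'I_n -> R) : Prop :=
  (forall i j : 'I_n, j = i.+1 :> nat ->
     y (order_index x j) * g0 (x (order_index x j)) <=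
     y (order_index x i) * g0 (x (order_index x i))) /\
  (forall i, 0 <= y i * g0 (x i) <= (M * g0 (x i)) `^ (1 / (1 - gamma))).

Definition val_Pn' (R : realType) (M gamma : R) (g0 : R -> R) (l m : nat)
    (phi : nat -> R -> R) (mu : nat -> R) (n : nat) (x : 'I_n -> R) : \bar R :=
  let e (y : 'I_n -> R) j := sample_mean x y (phi j) in
  ereal_sup [set (e y 0%N)%:E | y in
    [set y | discrete_shape M gamma g0 x y /\ moment_constraints l m mu (e y)]].

Definition finite_dim_reducible (R : realType) (a M gamma : R) (g0 : R -> R)
    (n : nat) (x : 'I_n -> R) : Prop :=
  (forall L, ratio_class a M gamma g0 L ->
     discrete_shape M gamma g0 x (L \o x)) /\
  (forall y, discrete_shape M gamma g0 x y ->
     exists2 L, ratio_class a M gamma g0 L & forall i, L (x i) = y i).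

Definition has_density_on (d : measure_display) (T : measurableType d)
    (R : realType) (P : probability T R) (a : R) (g0 : R -> R)
    (X : {RV P >-> R}) : Prop :=
  (forall w, a <= X w) /\
  (forall A : set R, measurable A ->
    (P (X @^-1` A) =
     \int[lebesgue_measure]_(x in A `&` `[a, +oo[) (g0 x)%:E)%E).

Definition mutually_independent (d : measure_display) (T : measurableType d)
    (R : realType) (P : probability T R) (X : nat -> {RV P >-> R}) : Prop :=
  forall (s : seq nat) (A : nat -> set R), uniq s ->
    (forall i, measurable (A i)) ->
    (P (\bigcap_(i in [set` s]) (X i @^-1` A i)) =
     \prod_(i <- s) P (X i @^-1` A i))%E.

Definition outer_prob (d : measure_display) (T : measurableType d)
    (R : realType) (P : probability T R) (B : set T) : \bar R :=
  ereal_inf [set P A | A in [set A | measurable A /\ B `<=` A]].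

(* U is a version of the minimal measurable majorant of Z. *)
Definition min_measurable_majorant (d : measure_display)
    (T : measurableType d) (R : realType) (P : probability T R)
    (Z U : T -> \bar R) : Prop :=
  [/\ measurable_fun [set: T] U,
      (forall w, (Z w <= U w)%E) &
      forall V : T -> \bar R, measurable_fun [set: T] V ->
        (\forall w \ae P, (Z w <= V w)%E) ->
        (\forall w \ae P, (U w <= V w)%E)].

(* Minimal measurable majorants are unique up to null sets, so quantifying
   existentially over their versions loses nothing. *)
Definition cvg_as_outer (d : measure_display) (T : measurableType d)
    (R : realType) (P : probability T R)
    (Z : nat -> T -> \bar R) (Zlim : T -> \bar R) : Prop :=
  exists U : nat -> T -> \bar R,
    (forall n, min_measurable_majorant P
                 (fun w => `|Z n w - Zlim w|%E) (U n)) /\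
    (\forall w \ae P, (fun n => U n w) @ \oo --> 0%E).

Definition bounded_in_outer_prob (d : measure_display) (T : measurableType d)
    (R : realType) (P : probability T R) (Z : nat -> T -> \bar R) : Prop :=
  forall eps : R, 0 < eps -> exists2 K : R, 0 < K &
    (limn_esup (fun n => outer_prob P [set w | (K%:E <= `|Z n w|)%E])
       <= eps%:E)%E.

(* Main.v *)
Require Import Defs.
From HB Require Import structures.
From mathcomp Require Import all_boot all_order all_algebra.
From mathcomp Require Import all_classical all_reals all_analysis measurable_realfun.
From mathcomp Require Import ring lra zify.
Import Order.TTheory GRing.Theory Num.Theory.
Import numFieldNormedType.Exports.
Set Implicit Arguments.
Unset Strict Implicit.
Unset Printing Implicit Defensive.
Local Open Scope classical_set_scope.
Local Open Scope ring_scope.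

(* Write [L = f / g0].  Both [f ^ gamma] and [g0 ^ (gamma / (1 - gamma))] are
   non-increasing and bounded, and the envelope of [f] makes the oscillation of
   [L] at most a constant times that of their sum, so the class has uniformly
   bounded variation.  Hence the deviation of [phi L] between the sample and
   the population is controlled by those of [phi 1_{x >= r}] over a grid of
   quantiles of the law weighted by [1 + phi ^ 2].  Truncation of [phi], fourth
   moments and dyadic chaining give a measurable bound with expectation
   [O(n ^ (-1/2))].  As [phi+ L >= 0] and [phi- L >= 0], the sums over the
   sample are monotone in [n], and convergence along [n = k ^ 4] yields almost
   sure convergence.

   Once all moments deviate by at most [d], mixing an almost feasible [L] with
   a combination of fixed anchors with weight [O(d)] restores feasibility: the
   weights of the anchors solve a diagonally dominant linear system, since their
   equality moments nearly form a cross-polytope around [mu].  Applied in both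
   directions, this bounds the difference of the optimal values by [O(d)].

   The discrete problem is equivalent to the original one because values at
   distinct sample points extend to the step function
   [t |-> max {y_i g0(x_i) | x_i >= t}]. *)

(** * Bounded random variables and independence *)

(** The measurability of a supremum over the class is never addressed: deviations are bounded
    pathwise, for all [L] at once, by a variable built from finitely many empirical means. In it,
    the maximum over the [2 ^ k] blocks of level [k] is replaced by a sum of fourth powers. A block
    has second moment [O(2 ^ - k)], so summed variances would not decay in [k] and would cost a
    logarithm; fourth moments give [2 ^ k] times [2 ^ (- 2 k)], plus a term proportional to the
    squared truncation level [tau ^ 2]. With [4 ^ K <= n < 4 ^ (K + 1)] and
    [tau = 2 ^ (K / (1 + delta))], the part of [phi] above [tau] has mean [O(2 ^ - K)], while
    [tau ^ 2 / 4 ^ K] is still geometrically small in [K]; this is where [delta > 0] enters. In the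
    weight [1 + phi ^ 2], the square controls second moments of blocks and the sum dominates [phi]
    itself; for [phi = 0] the same grid shows that sample points are distinct. The fourth powers in
    [n = k ^ 4] turn the rate [n ^ (- 1 / 2)] into the summable [k ^ (- 2)]. *)

Section bounded_random_variables.
Context d (T : measurableType d) (R : realType) (P : probability T R).

Definition bounded_measurable (f : T -> R) :=
  measurable_fun [set: T] f /\ exists b, forall w, `|f w| <= b.

Lemma bmeas_integrable f : bounded_measurable f -> P.-integrable [set: T] (EFin \o f).
Proof.
move=> [mf [b fb]]; apply: measurable_bounded_integrable => //.
  by rewrite (le_lt_trans (probability_le1 _ _)) ?ltry.
by exists b; split; [exact: num_real|move=> r br w _; exact: (le_trans (fb w) (ltW br))].
Qed.

Lemma bmeas_cst c : bounded_measurable (fun=> c).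
Proof. by split=> //; exists `|c|. Qed.

Lemma bmeasD f g : bounded_measurable f -> bounded_measurable g ->
  bounded_measurable (fun w => f w + g w).
Proof.
move=> [mf [b fb]] [mg [c gc]]; split; first exact: measurable_funD.
by exists (b + c) => w; rewrite (le_trans (ler_normD _ _))// lerD.
Qed.

Lemma bmeasM f g : bounded_measurable f -> bounded_measurable g ->
  bounded_measurable (fun w => f w * g w).
Proof.
move=> [mf [b fb]] [mg [c gc]]; split; first exact: measurable_funM.
by exists (b * c) => w; rewrite normrM ler_pM.
Qed.

Lemma bmeasX f n : bounded_measurable f -> bounded_measurable (fun w => f w ^+ n).
Proof.
move=> bf; elim: n => [|n IH]; first exact: bmeas_cst.
rewrite (_ : (fun w => _) = (fun w => f w * f w ^+ n)); last first.
  by apply/funext => w; rewrite exprS.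
exact: bmeasM.
Qed.

Lemma bmeas_sum n (f : nat -> T -> R) : (forall i, bounded_measurable (f i)) ->
  bounded_measurable (fun w => \sum_(i < n) f i w).
Proof.
move=> bf; elim: n => [|n IH].
  by under eq_fun do rewrite big_ord0; exact: bmeas_cst.
by under eq_fun do rewrite big_ord_recr; exact: bmeasD.
Qed.

Lemma bmeas_indic A : measurable A -> bounded_measurable (\1_A).
Proof.
move=> mA; split; first exact: measurable_indic.
by exists 1 => w; rewrite indicE ger0_norm ?ler0n// lern1 leq_b1.
Qed.

Local Notation E f := (\int[P]_w f w).

Lemma bmeas_ED f g : bounded_measurable f -> bounded_measurable g ->
  E (fun w => f w + g w) = E f + E g.
Proof. by move=> bf bg; rewrite RintegralD//; exact: bmeas_integrable. Qed.

Lemma bmeas_EZ f c : bounded_measurable f -> E (fun w => c * f w) = c * E f.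
Proof. by move=> bf; rewrite RintegralZl//; exact: bmeas_integrable. Qed.

Lemma bmeas_EB f g : bounded_measurable f -> bounded_measurable g ->
  E (fun w => f w - g w) = E f - E g.
Proof. by move=> bf bg; rewrite RintegralB//; exact: bmeas_integrable. Qed.

Lemma bmeas_E_sum n (f : nat -> T -> R) : (forall i, bounded_measurable (f i)) ->
  E (fun w => \sum_(i < n) f i w) = \sum_(i < n) E (f i).
Proof.
move=> bf; elim: n => [|n IH].
  rewrite big_ord0; under eq_Rintegral do rewrite big_ord0.
  by rewrite Rintegral_cst// mul0r.
rewrite big_ord_recr -IH /=.
under eq_Rintegral do rewrite big_ord_recr /=.
by rewrite bmeas_ED//; exact: bmeas_sum.
Qed.

Lemma bmeas_E_le f g : bounded_measurable f -> bounded_measurable g ->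
  (forall w, f w <= g w) -> E f <= E g.
Proof. by move=> bf bg fg; apply: le_Rintegral => //; exact: bmeas_integrable. Qed.

Lemma E_cst c : E (fun=> c) = c.
Proof.
have := @Rintegral_cst _ _ _ P _ (@measurableT _ T) c.
by rewrite [X in fine X]probability_setT /= mulr1.
Qed.

Lemma bmeas_E_norm f b : bounded_measurable f -> (forall w, `|f w| <= b) ->
  `|E f| <= b.
Proof.
move=> bf fb; rewrite ler_norml; apply/andP; split.
- rewrite -[leLHS]E_cst; apply: bmeas_E_le => //; first exact: bmeas_cst.
  by move=> w; have := fb w; rewrite ler_norml => /andP[].
- rewrite -[leRHS]E_cst; apply: bmeas_E_le => //; first exact: bmeas_cst.
  by move=> w; have := fb w; rewrite ler_norml => /andP[].
Qed.

Lemma E_indic A : measurable A -> E (\1_A) = fine (P A).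
Proof. by move=> mA; rewrite /Rintegral integral_indic// setIT. Qed.

End bounded_random_variables.

(** The sum rounds [u] down to a multiple of [e]. The induction removes the lowest level: if
    [e <= u], the other levels are those of [u - e]; otherwise no level is reached. *)
Lemma staircase_approx (R : realType) (e u : R) (N : nat) : 0 < e -> 0 <= u ->
  u <= N%:R * e ->
  `|u - \sum_(j < N) e * (j.+1%:R * e <= u)%R%:R| <= e.
Proof.
move=> e0; elim: N u => [|N IH] u u0 uN.
  rewrite big_ord0 subr0 ger0_norm//; rewrite mul0r in uN.
  by rewrite (le_trans uN)// ltW.
rewrite big_ord_recl /= mul1r; case: (leP e u) => eu; rewrite ?mulr1 ?mulr0.
- rewrite opprD addrA.
  rewrite (eq_bigr (fun j : 'I_N => e * (j.+1%:R * e <= u - e)%R%:R)); last first.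
    move=> j _; congr (_ * _%:R); congr nat_of_bool.
    by rewrite /bump /= add1n lerBrDr -[in LHS]natr1 mulrDl mul1r.
  by apply: IH; rewrite ?subr_ge0// lerBlDr; move: uN; rewrite -natr1 mulrDl mul1r.
- rewrite big1 ?addr0 ?subr0; first by rewrite ger0_norm// ltW.
  move=> j _; rewrite /bump /= leNgt (lt_le_trans eu) ?mulr0//.
  by apply: ler_peMl; [exact: ltW|rewrite ler1n].
Qed.

(** * Independence: from events to bounded functions and to powers of sums *)

Section independence.
Context d (T : measurableType d) (R : realType) (P : probability T R).
Local Notation E f := (\int[P]_w f w).

(** [u] is a uniform limit of combinations of indicators, and orthogonality to the events of [Y]
    survives uniform limits because [Z] is bounded. *)
Lemma orthogonal_comp (Y : {RV P >-> R}) (Z : T -> R) (u : R -> R) b :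
  bounded_measurable Z -> measurable_fun [set: R] u -> (forall x, `|u x| <= b) ->
  (forall C, measurable C -> E (fun w => Z w * \1_(Y @^-1` C) w) = 0) ->
  E (fun w => Z w * u (Y w)) = 0.
Proof.
move=> bZ mu ub Z0.
have mY : measurable_fun [set: T] Y by [].
have bu : bounded_measurable (fun w => u (Y w)).
  by split; [exact: (measurableT_comp mu mY)|exists b => w].
have [_ [c Zc]] := bZ.
apply/eqP; rewrite -normr_le0; apply/ler_addgt0Pl => eps eps0; rewrite addr0.
have c0 : 0 <= c by exact: le_trans (normr_ge0 _) (Zc point).
(* The approximation error [c * e] stays below [eps]; the [1] guards against [c = 0]. *)
pose e := eps / (c + 1).
have e0 : 0 < e by rewrite divr_gt0// ltr_wpDl.
have b0 : 0 <= b by exact: le_trans (normr_ge0 _) (ub point).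
(* Shifted by [b], the values of [u] lie in [[0, 2 b]], which [N] steps of height [e] cover. *)
pose N := (Num.truncn (2 * b / e)).+1.
have Nb : 2 * b <= N%:R * e.
  by rewrite -ler_pdivrMr// ltW// truncnS_gt.
pose C j := [set x : R | j.+1%:R * e <= u x + b].
have mC j : measurable (C j).
  rewrite -[C j]setTI; apply: measurable_fun_ler => //.
  exact: measurable_funD.
have mYC j : measurable (Y @^-1` C j) by rewrite -[_ @^-1` _]setTI; exact: mY.
pose s w := - b + \sum_(j < N) e * \1_(Y @^-1` C j) w.
have bs : bounded_measurable s.
  apply: bmeasD; first exact: bmeas_cst.
  apply: (bmeas_sum _ (f := fun j w => e * \1_(Y @^-1` C j) w)) => j.
  by apply: bmeasM; [exact: bmeas_cst|exact: bmeas_indic].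
have us w : `|u (Y w) - s w| <= e.
  have /andP[u1 u2] : - b <= u (Y w) <= b by rewrite -ler_norml.
  have := @staircase_approx R e (u (Y w) + b) N e0.
  have -> : u (Y w) - s w = u (Y w) + b - \sum_(j < N) e * (j.+1%:R * e <= u (Y w) + b)%R%:R.
    rewrite /s opprD opprK addrA; congr (_ - _); apply: eq_bigr => j _.
    by rewrite indicE; congr (_ * _%:R); congr nat_of_bool; apply/idP/idP; rewrite inE.
  apply; first by rewrite -lerBlDr sub0r.
  by rewrite (le_trans _ Nb)// mulr2n mulrDl mul1r lerD2r.
have Zs0 : E (fun w => Z w * s w) = 0.
  have -> : (fun w => Z w * s w) = (fun w => - b * (Z w * \1_(Y @^-1` setT) w) +
      \sum_(j < N) e * (Z w * \1_(Y @^-1` C j) w)).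
    apply/funext => w; rewrite /s mulrDr preimage_setT indicT mulr1 mulrC.
    by congr (_ + _); rewrite mulr_sumr; apply: eq_bigr => j _; rewrite mulrCA.
  have bZC j : bounded_measurable (fun w => Z w * \1_(Y @^-1` C j) w).
    by apply: bmeasM => //; exact: bmeas_indic.
  have bZT : bounded_measurable (fun w => Z w * \1_(Y @^-1` setT) w).
    by apply: bmeasM => //; apply: bmeas_indic; rewrite preimage_setT.
  have beC j : bounded_measurable (fun w => e * (Z w * \1_(Y @^-1` C j) w)).
    by apply: bmeasM => //; exact: bmeas_cst.
  rewrite bmeas_ED; last 2 first.
  - by apply: bmeasM => //; exact: bmeas_cst.
  - exact: (bmeas_sum _ (f := fun j w => e * (Z w * \1_(Y @^-1` C j) w))).
  rewrite bmeas_EZ// Z0// mulr0 add0r.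
  rewrite (@bmeas_E_sum _ _ _ P N (fun j w => e * (Z w * \1_(Y @^-1` C j) w)))//.
  by rewrite big1// => j _; rewrite bmeas_EZ// Z0// mulr0.
have -> : E (fun w => Z w * u (Y w)) = E (fun w => Z w * (u (Y w) - s w)).
  under [RHS]eq_Rintegral do rewrite mulrBr.
  by rewrite bmeas_EB ?Zs0 ?subr0//; exact: bmeasM.
have -> : eps = e * (c + 1) by rewrite /e divfK// gt_eqF// ltr_wpDl.
apply: (@le_trans _ _ (c * e)).
  apply: bmeas_E_norm => [|w]; last by rewrite normrM ler_pM.
  apply: bmeasM => //; rewrite (_ : (fun w => _) = (fun w => u (Y w) + (-1) * s w)).
    by apply: bmeasD => //; apply: bmeasM => //; exact: bmeas_cst.
  by apply/funext => w; rewrite mulN1r.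
by rewrite mulrC ler_pM2l// lerDl.
Qed.

End independence.

Section future_independence.
Context d (T : measurableType d) (R : realType) (P : probability T R).
Variable X : nat -> {RV P >-> R}.
Hypothesis indX : mutually_independent X.
Local Notation E f := (\int[P]_w f w).
Local Notation ev s A := (\bigcap_(i in [set` (s : seq nat)]) (X i @^-1` (A : nat -> set R) i)).

(** Only the means of [Y] over finite intersections of events of [X i], [n <= i], are prescribed.
    This is closed under sums and under multiplication by a bounded function of [X n], which
    suffices for moments and avoids generated sigma-algebras. *)
Definition future_independent n (Y : T -> R) := bounded_measurable Y /\
  forall (s : seq nat) (A : nat -> set R), uniq s -> (forall i, i \in s -> (n <= i)%N) ->
    (forall i, measurable (A i)) ->
    E (fun w => Y w * \1_(ev s A) w) = E Y * fine (P (ev s A)).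

Lemma measurable_preimage_RV (Y : {RV P >-> R}) C : measurable C -> measurable (Y @^-1` C).
Proof. by move=> mC; rewrite -[_ @^-1` _]setTI; exact: (@measurable_funPT _ _ _ _ Y). Qed.

Lemma measurable_event s A : (forall i, measurable (A i)) -> measurable (ev s A).
Proof.
move=> mA; apply: fin_bigcap_measurable; first exact: finite_seq.
by move=> i _; exact: measurable_preimage_RV.
Qed.

Lemma future_independent_le n m Y : (n <= m)%N ->
  future_independent n Y -> future_independent m Y.
Proof.
move=> nm [bY iY]; split => // s A us sm mA.
by apply: iY => // i /sm; exact: leq_trans.
Qed.

Lemma future_independent_cst n c : future_independent n (fun=> c).
Proof.
split; first exact: bmeas_cst.
move=> s A us sn mA; have mE := measurable_event s mA.
by rewrite E_cst bmeas_EZ ?E_indic//; exact: bmeas_indic.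
Qed.

Lemma future_independentD n Y Z : future_independent n Y -> future_independent n Z ->
  future_independent n (fun w => Y w + Z w).
Proof.
move=> [bY iY] [bZ iZ]; split; first exact: bmeasD.
move=> s A us sn mA; have mE := measurable_event s mA.
have bE := bmeas_indic R mE.
under eq_Rintegral do rewrite mulrDl.
by rewrite !bmeas_ED ?iY ?iZ ?mulrDl//; exact: bmeasM.
Qed.

Lemma future_independentZ n Y c : future_independent n Y ->
  future_independent n (fun w => c * Y w).
Proof.
move=> [bY iY]; split; first by apply: bmeasM => //; exact: bmeas_cst.
move=> s A us sn mA; have mE := measurable_event s mA.
have bE := bmeas_indic R mE.
under eq_Rintegral do rewrite -mulrA.
by rewrite !bmeas_EZ ?iY ?mulrA//; exact: bmeasM.
Qed.

Lemma event_cons n s A C : n \notin s ->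
  ev (n :: s) (fun i => if i == n then C else A i) = ev s A `&` (X n @^-1` C).
Proof.
move=> ns; apply/seteqP; split => w.
- move=> H; split.
    move=> i si; have := H i; rewrite /= in_cons; case: eqP => [ein|_].
      by move: ns; rewrite -ein; move: si => /= ->.
    by apply; rewrite orFb.
  by have := H n; rewrite /= in_cons eqxx; exact.
- move=> [H1 H2] i /=; rewrite in_cons; case: eqP => [-> //|_] /= si.
  exact: H1.
Qed.

(** Adding an event of [X n] to later events gives again events of index at least [n], so the
    assumption on [Y] and mutual independence yield the product formula for indicators of [X n];
    [orthogonal_comp] extends it to [u]. *)
Lemma future_independentM n Y (u : R -> R) b : future_independent n Y ->
  measurable_fun [set: R] u -> (forall x, `|u x| <= b) ->
  future_independent n.+1 (fun w => Y w * u (X n w)) /\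
  E (fun w => Y w * u (X n w)) = E Y * E (fun w => u (X n w)).
Proof.
move=> [bY iY] mu ub.
have bu : bounded_measurable (fun w => u (X n w)).
  split; last by exists b.
  exact: (measurableT_comp mu (@measurable_funPT _ _ _ _ (X n))).
have key s A : uniq s -> (forall i, i \in s -> (n < i)%N) -> (forall i, measurable (A i)) ->
    E (fun w => Y w * u (X n w) * \1_(ev s A) w) =
    E Y * E (fun w => u (X n w)) * fine (P (ev s A)).
  move=> us sn mA; have mE := measurable_event s mA.
  have bE := bmeas_indic R mE.
  have bYE := bmeasM bY bE.
  (* Subtracting this mean turns the product formula into orthogonality to every event of [X n]. *)
  pose c := E Y * fine (P (ev s A)).
  have ns : n \notin s by apply/negP => /sn; rewrite ltnn.
  have := @orthogonal_comp _ _ _ P (X n) (fun w => Y w * \1_(ev s A) w + (- c)) u b.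
  have bZ : bounded_measurable (fun w => Y w * \1_(ev s A) w + (- c)).
    by apply: bmeasD => //; exact: bmeas_cst.
  move=> /(_ bZ mu ub) H.
  have : E (fun w => (Y w * \1_(ev s A) w + - c) * u (X n w)) = 0.
    apply: H => C mC; have mXC := measurable_preimage_RV (X n) mC.
    have bC := bmeas_indic R mXC.
    under eq_Rintegral do rewrite mulrDl.
    rewrite bmeas_ED; last 2 first.
    - exact: bmeasM.
    - by apply: bmeasM => //; exact: bmeas_cst.
    rewrite bmeas_EZ// E_indic//.
    have -> : E (fun w => Y w * \1_(ev s A) w * \1_(X n @^-1` C) w) =
        E (fun w => Y w * \1_(ev (n :: s) (fun i => if i == n then C else A i)) w).
      by apply: eq_Rintegral => w _; rewrite event_cons// indicI mulrA.
    have mA' i : measurable (if i == n then C else A i) by case: ifP.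
    have us' : uniq (n :: s) by rewrite /= ns.
    rewrite iY//; last first.
      by move=> i; rewrite in_cons => /orP[/eqP-> //|/sn/ltnW].
    rewrite (indX us' mA') big_cons eqxx (eq_big_seq (fun i => P (X i @^-1` A i))); last first.
      by move=> i si; case: eqP => // ein; move: ns; rewrite -ein si.
    rewrite -(indX us mA) fineM ?fin_num_measure// /c; ring.
  under eq_Rintegral do rewrite mulrDl.
  rewrite bmeas_ED; last 2 first.
  - exact: bmeasM.
  - by apply: bmeasM => //; exact: bmeas_cst.
  rewrite bmeas_EZ// mulNr => /eqP; rewrite subr_eq0 => /eqP.
  under eq_Rintegral do rewrite mulrAC.
  by move=> ->; rewrite /c mulrAC.
split; first split; first exact: bmeasM.
- move=> s A us sn mA; rewrite key//.
  have := key [::] (fun=> setT) erefl (fun _ => ltac:(done)) (fun=> measurableT).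
  rewrite set_nil bigcap_set0 probability_setT mulr1.
  by under eq_Rintegral do rewrite indicT mulr1; move=> ->.
- have := key [::] (fun=> setT) erefl (fun _ => ltac:(done)) (fun=> measurableT).
  rewrite set_nil bigcap_set0 probability_setT mulr1.
  by under eq_Rintegral do rewrite indicT mulr1; move=> ->.
Qed.

End future_independence.

(** * Moments of sums of centred independent variables *)

Section fourth_moment.
Context d (T : measurableType d) (R : realType) (P : probability T R).
Variable X : nat -> {RV P >-> R}.
Hypothesis indX : mutually_independent X.
Local Notation E f := (\int[P]_w f w).
Variables (u : R -> R) (b v2 v4 : R).
Hypotheses (mu : measurable_fun [set: R] u) (ub : forall x, `|u x| <= b).
Hypotheses (u1 : forall i, E (fun w => u (X i w)) = 0)
  (u2 : forall i, E (fun w => u (X i w) ^+ 2) = v2)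
  (u4 : forall i, E (fun w => u (X i w) ^+ 4) = v4).

Let S n w := \sum_(i < n) u (X i w).

Let mux k : measurable_fun [set: R] (fun x => u x ^+ k).
Proof. exact: measurable_funX. Qed.

Let ubx k x : `|u x ^+ k| <= b ^+ k.
Proof. by rewrite normrX lerXn2r// nnegrE// (le_trans (normr_ge0 _) (ub x)). Qed.

(** The binomial formula writes a power of the next sum as a combination of products of a power of
    the previous sum and a bounded function of [X n], the only products covered by
    [future_independentM]. *)
Lemma future_independent_sumX n k : future_independent X n (fun w => S n w ^+ k).
Proof.
elim: n k => [|n IH] k.
  rewrite (_ : (fun w => _) = (fun=> 0 ^+ k)); first exact: future_independent_cst.
  by apply/funext => w; rewrite /S big_ord0.
rewrite (_ : (fun w => _) = (fun w => \sum_(i < k.+1)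
    'C(k, i)%:R * (S n w ^+ (k - i) * u (X n w) ^+ i))); last first.
  apply/funext => w; rewrite /S big_ord_recr /= exprDn.
  by apply: eq_bigr => i _; rewrite mulr_natl.
elim: k.+1 => [|m IHm].
  under eq_fun do rewrite big_ord0; exact: future_independent_cst.
under eq_fun do rewrite big_ord_recr.
apply: future_independentD => //; apply: future_independentZ.
by have [] := future_independentM indX (IH (k - m)%N) (mux m) (ubx m).
Qed.

(** In the expansion of the next sum, terms containing a centred factor to the first power vanish.
    The fourth moment grows by [v4 + 6 * n * v2 ^ 2], and
    [3 * (n + 1) ^ 2 - 3 * n ^ 2 = 6 * n + 3]. *)
Lemma moments_iid_sum n : [/\ E (S n) = 0, E (fun w => S n w ^+ 2) = n%:R * v2 &
  E (fun w => S n w ^+ 4) <= n%:R * v4 + 3 * n%:R ^+ 2 * v2 ^+ 2].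
Proof.
have v20 : 0 <= v2 by rewrite -(u2 0); apply: Rintegral_ge0 => w _; exact: sqr_ge0.
elim: n => [|n [IH1 IH2 IH4]].
  have S0 w : S 0 w = 0 by rewrite /S big_ord0.
  split.
  - by under eq_Rintegral do rewrite S0; rewrite E_cst.
  - by under eq_Rintegral do rewrite S0; rewrite E_cst expr0n mul0r.
  - by under eq_Rintegral do rewrite S0; rewrite E_cst !expr0n/= !(mulr0, mul0r, addr0).
have [bx1 bx2 bx3 bx4] : [/\ bounded_measurable (fun w => u (X n w) ^+ 1),
    bounded_measurable (fun w => u (X n w) ^+ 2), bounded_measurable (fun w => u (X n w) ^+ 3) &
    bounded_measurable (fun w => u (X n w) ^+ 4)].
  by split; (split; [exact: (measurableT_comp (mux _) (@measurable_funPT _ _ _ _ (X n)))|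
    eexists => w; exact: ubx]).
have bS k : bounded_measurable (fun w => S n w ^+ k) by case: (future_independent_sumX n k).
have EM k i : E (fun w => S n w ^+ k * u (X n w) ^+ i) =
    E (fun w => S n w ^+ k) * E (fun w => u (X n w) ^+ i).
  by have [_] := future_independentM indX (future_independent_sumX n k) (mux i) (ubx i).
have bSu k i : bounded_measurable (fun w => u (X n w) ^+ i) ->
  bounded_measurable (fun w => S n w ^+ k * u (X n w) ^+ i) by move=> ?; exact: bmeasM.
have ES1 : E (fun w => S n w ^+ 1) = 0 by under eq_Rintegral do rewrite expr1.
have Eu1 : E (fun w => u (X n w) ^+ 1) = 0 by under eq_Rintegral do rewrite expr1.
have SS w : S n.+1 w = S n w + u (X n w) by rewrite /S big_ord_recr.
split.
- under eq_Rintegral do rewrite SS -[S n _]expr1 -[u _]expr1.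
  by rewrite bmeas_ED// ES1 Eu1 addr0.
- have -> : E (fun w => S n.+1 w ^+ 2) =
     E (fun w => (S n w ^+ 2 + 2 * (S n w ^+ 1 * u (X n w) ^+ 1)) + u (X n w) ^+ 2).
    by apply: eq_Rintegral => w _; rewrite SS; ring.
  rewrite bmeas_ED//; last first.
    by apply: bmeasD => //; apply: bmeasM; [exact: bmeas_cst|exact: bSu].
  rewrite bmeas_ED//; last by apply: bmeasM; [exact: bmeas_cst|exact: bSu].
  rewrite bmeas_EZ; last exact: bSu.
  rewrite EM Eu1 mulr0 mulr0 addr0 IH2 u2 -natr1; ring.
- have -> : E (fun w => S n.+1 w ^+ 4) =
     E (fun w => (S n w ^+ 4 + u (X n w) ^+ 4) + (4 * (S n w ^+ 3 * u (X n w) ^+ 1) +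
       (6 * (S n w ^+ 2 * u (X n w) ^+ 2) + 4 * (S n w ^+ 1 * u (X n w) ^+ 3)))).
    by apply: eq_Rintegral => w _; rewrite SS; ring.
  have b31 := bmeasM (bmeas_cst T (4 : R)) (bSu 3 1 bx1).
  have b22 := bmeasM (bmeas_cst T (6 : R)) (bSu 2 2 bx2).
  have b13 := bmeasM (bmeas_cst T (4 : R)) (bSu 1 3 bx3).
  rewrite bmeas_ED; [|exact: bmeasD|by apply: bmeasD => //; exact: bmeasD].
  rewrite bmeas_ED// bmeas_ED//; last exact: bmeasD.
  rewrite bmeas_ED// !bmeas_EZ; [|exact: bSu..].
  rewrite !EM Eu1 ES1 IH2 u2 u4 mulr0 mul0r !mulr0 add0r addr0.
  rewrite -natr1; move: IH4; set N := n%:R.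
  have : 0 <= v2 ^+ 2 by exact: sqr_ge0.
  nra.
Qed.

End fourth_moment.

(** * Dyadic chaining and functions of bounded variation *)

(** An even index of one level belongs to the previous level; an odd one is joined by a single
    increment to its right neighbour, which is even. So each level is charged once, and level [0] is
    anchored at the right end, where [G] vanishes. *)
Lemma dyadic_chaining (R : realType) (K : nat) (G m : nat -> R) :
  G (2 ^ K)%N = 0 ->
  (forall k j, (k <= K)%N -> (j < 2 ^ k)%N ->
     `|G (j.+1 * 2 ^ (K - k))%N - G (j * 2 ^ (K - k))%N| <= m k) ->
  forall i, (i <= 2 ^ K)%N -> `|G i| <= \sum_(k < K.+1) m k.
Proof.
move=> GK Gm.
have H k : (k <= K)%N -> forall j, (j <= 2 ^ k)%N ->
    `|G (j * 2 ^ (K - k))%N| <= \sum_(i < k.+1) m i.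
  elim: k => [_|k IH kK] j.
    have /= := Gm 0 0 (leq0n _) erefl; rewrite big_ord1 subn0 mul1n mul0n GK sub0r normrN.
    by case: j => [|[|//]] G0 _; rewrite ?mul0n ?mul1n ?GK ?normr0//; exact: le_trans (normr_ge0 _) G0.
  have mk0 : 0 <= m k.+1.
    by apply: le_trans (normr_ge0 _) (Gm k.+1 0%N kK _); rewrite expn_gt0.
  have half i : (i.*2 * 2 ^ (K - k.+1) = i * 2 ^ (K - k))%N.
    by rewrite -muln2 -mulnA -expnS subnSK.
  move=> jk; rewrite big_ord_recr /=; have := odd_double_half j.
  case: (odd j) => /= je; last first.
    rewrite -je add0n half; apply: le_trans (IH (ltnW kK) _ _) _; last by rewrite lerDl.
    by rewrite -leq_double -[j./2.*2]add0n je -[(2 ^ k).*2]mul2n -expnS.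
  set i := j./2 in je *; have ik : (i < 2 ^ k)%N.
    by rewrite -ltn_double -[(2 ^ k).*2]mul2n -expnS (leq_trans _ jk)// -je.
  have jl : (j < 2 ^ k.+1)%N.
    rewrite ltn_neqAle jk andbT -je; apply/eqP => /(congr1 odd).
    by rewrite oddD odd_double oddX.
  have := Gm _ _ kK jl; rewrite (_ : j.+1 = i.+1.*2) ?half; last by rewrite doubleS -je.
  have := IH (ltnW kK) i.+1 ik.
  set u := G _; set v := G _ => h1 h2.
  by rewrite (_ : v = u - (u - v)) ?(le_trans (ler_normB _ _)) ?lerD//; ring.
by move=> i iK; have := H K (leqnn K) i; rewrite subnn muln1; exact.
Qed.

Section bounded_variation.
Variables (R : realType) (a : R).

(** The domain accommodates both the empirical mean, defined on all functions, and the expectation,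
    additive on integrable ones, so that step approximations are proved once for both. *)
Definition positive_linear (Dom : set (R -> R)) (J : (R -> R) -> R) :=
  [/\ forall f g, Dom f -> Dom g ->
        Dom (fun x => f x + g x) /\ J (fun x => f x + g x) = J f + J g,
      forall c f, Dom f -> Dom (fun x => c * f x) /\ J (fun x => c * f x) = c * J f &
      forall f g, Dom f -> Dom g -> (forall x, a <= x -> f x <= g x) -> J f <= J g].

Lemma positive_linear_sum Dom J n (f : nat -> R -> R) : Dom (fun=> 0) ->
  positive_linear Dom J -> (forall i, Dom (f i)) ->
  Dom (fun x => \sum_(i < n) f i x) /\
  J (fun x => \sum_(i < n) f i x) = \sum_(i < n) J (f i).
Proof.
move=> D0 [JD JZ _] Df; elim: n => [|n [IH1 IH2]].
  under eq_fun do rewrite big_ord0; split; rewrite ?big_ord0//.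
  by have := proj2 (JZ 0 _ D0); rewrite mul0r [RHS]mul0r.
under eq_fun do rewrite big_ord_recr; have [? ->] := JD _ _ IH1 (Df n).
by rewrite big_ord_recr IH2.
Qed.

(* [W] plays the role of (minus) a monotone primitive of the variation of [L]. *)
Definition variation_bound (B : R) (L W : R -> R) :=
  (forall x, a <= x -> `|L x| <= B) /\
  (forall x y, a <= x -> x <= y -> `|L x - L y| <= W x - W y) /\
  (forall x, a <= x -> 0 <= W x <= B).

Variables (N : nat) (r : nat -> R).
Hypotheses (r0 : r 0 = a) (r_nd : forall i j, (i <= j)%N -> (j <= N)%N -> r i <= r j).

(* The tail beyond the last grid point is empty, so that [tail i \ tail i.+1]
   are the cells of the grid, the last one being unbounded. *)
Definition tail (i : nat) (x : R) : R := ((i <= N)%N && (r i <= x))%R%:R.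

Lemma tail_ge0 i x : 0 <= tail i x. Proof. by rewrite ler0n. Qed.

Lemma tail_noninc i x : tail i.+1 x <= tail i x.
Proof.
rewrite /tail ler_nat; case: (ltnP i N) => iN //=; rewrite (ltnW iN) /=.
case: (leP (r i.+1) x) => //= ri; rewrite (le_trans (r_nd (leqnSn i) iN))//.
Qed.

Lemma tail_index x : a <= x -> exists2 i, (i <= N)%N &
  forall j, tail j x = (j <= i)%N%:R.
Proof.
move=> ax; pose p i := (i <= N)%N && (r i <= x).
have p0 : exists i, p i by exists 0%N; rewrite /p r0 ax.
have pN i : p i -> (i <= N)%N by case/andP.
case: (ex_maxnP p0 pN) => i /andP[iN rix] imax; exists i => // j.
congr (_%:R); congr nat_of_bool; apply/idP/idP; first exact: imax.
by move=> ji; rewrite (leq_trans ji iN) (le_trans (r_nd ji iN)).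
Qed.

Variables (B : R) (L W : R -> R).
Hypothesis LW : variation_bound B L W.

(** The coefficients, in the basis of tails, of the step function equal to [L (r i)] on cell [i].
    The companion [cell_osc] bounds the oscillation of [L] on a cell; on the last, unbounded one,
    [W] is bounded below by [0]. *)
Definition step_coef i := if i is j.+1 then L (r i) - L (r j) else L (r 0).
Definition cell_osc i := W (r i) - (if (i < N)%N then W (r i.+1) else 0).

Let ar i : (i <= N)%N -> a <= r i. Proof. by move=> iN; rewrite -r0 r_nd. Qed.

Lemma cell_osc_ge0 i : (i <= N)%N -> 0 <= cell_osc i.
Proof.
case: LW => _ [LW2 LW3] iN; rewrite /cell_osc; case: ifPn => [ilN|_].
  by apply: le_trans (normr_ge0 _) (LW2 _ _ (ar iN) (r_nd (leqnSn i) ilN)).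
by rewrite subr0; case/andP: (LW3 _ (ar iN)).
Qed.

Lemma sum_cell_osc : \sum_(i < N.+1) cell_osc i <= B.
Proof.
suff -> : \sum_(i < N.+1) cell_osc i = W (r 0).
  by case: LW => _ [_ LW3]; case/andP: (LW3 _ (ar (leq0n N))).
have H k : (k <= N)%N -> \sum_(i < k) cell_osc i = W (r 0) - W (r k).
  elim: k => [|k IH] kN; first by rewrite big_ord0 subrr.
  by rewrite big_ord_recr /= IH 1?ltnW// /cell_osc kN; ring.
by rewrite big_ord_recr /= H// /cell_osc ltnn subr0 subrK.
Qed.

(** One [B] pays for the value at [a], the other for the increments, which telescope through [W]. *)
Lemma sum_step_coef : \sum_(i < N.+1) `|step_coef i| <= 2 * B.
Proof.
case: LW => LW1 [LW2 LW3].
have H k : (k <= N)%N -> \sum_(i < k.+1) `|step_coef i| <= B + (W (r 0) - W (r k)).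
  elim: k => [|k IH] kN; first by rewrite big_ord1 subrr addr0 LW1// ar.
  rewrite big_ord_recr /= distrC.
  have := LW2 _ _ (ar (ltnW kN)) (r_nd (leqnSn k) kN).
  by have := IH (ltnW kN); lra.
apply: le_trans (H _ (leqnn N)) _.
have /andP[] := LW3 _ (ar (leqnn N)); have /andP[] := LW3 _ (ar (leq0n N)).
lra.
Qed.

Lemma sum_prefix (F : nat -> R) i : (i <= N)%N ->
  \sum_(j < N.+1) F j * (j <= i)%N%:R = \sum_(j < i.+1) F j.
Proof.
move=> iN; rewrite (big_ord_widen N.+1 F)// [RHS]big_mkcond /=.
by apply: eq_bigr => j _; rewrite ltnS; case: leqP; rewrite (mulr1, mulr0).
Qed.

Lemma step_approx x : a <= x ->
  `|L x - \sum_(i < N.+1) step_coef i * tail i x| <=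
  \sum_(i < N.+1) cell_osc i * (tail i x - tail i.+1 x).
Proof.
case: LW => LW1 [LW2 LW3] ax; have [i iN ti] := tail_index ax.
have rix : r i <= x.
  by have := ti i; rewrite leqnn /tail iN /=; case: (r i <= x)%R => // /eqP; rewrite eqr_nat.
under eq_bigr do rewrite ti.
rewrite sum_prefix//.
have -> : \sum_(j < i.+1) step_coef j = L (r i).
  elim: i iN {ti rix} => [|i IH] iN; first by rewrite big_ord1.
  by rewrite big_ord_recr /= IH 1?ltnW//; ring.
have iN1 : (i < N.+1)%N by [].
rewrite (bigD1 (Ordinal iN1))//= big1 ?addr0; last first.
  move=> j; rewrite -val_eqE /= => ji; rewrite !ti ltn_neqAle ji /=.
  by rewrite subrr mulr0.
rewrite !ti leqnn ltnn subr0 mulr1 distrC.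
apply: le_trans (LW2 _ _ (ar iN) rix) _; rewrite /cell_osc lerD2l lerN2.
case: ifPn => [ilN|_]; last by have /andP[] := LW3 _ ax.
have xr : x <= r i.+1.
  have := ti i.+1; rewrite ltnn /tail ilN /=; case: (leP (r i.+1) x) => [rx /eqP|/ltW//].
  by rewrite eqr_nat.
by rewrite -subr_ge0 (le_trans (normr_ge0 _) (LW2 _ _ ax xr)).
Qed.

(** Since [phi >= 0], the pointwise bound of [step_approx] may be multiplied by [phi] and passed
    through the positive functional. *)
Lemma functional_step_approx Dom J (phi : R -> R) : positive_linear Dom J ->
  Dom (fun=> 0) -> (forall x, 0 <= phi x) -> Dom (fun x => phi x * L x) ->
  (forall i, Dom (fun x => phi x * tail i x)) ->
  `|J (fun x => phi x * L x) - \sum_(i < N.+1) step_coef i * J (fun x => phi x * tail i x)| <=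
  \sum_(i < N.+1) cell_osc i * (J (fun x => phi x * tail i x) - J (fun x => phi x * tail i.+1 x)).
Proof.
move=> HJ D0 phi0 DL Dt; have [JD JZ Jle] := HJ.
pose f1 i x := step_coef i * (phi x * tail i x).
pose f2 i x := cell_osc i * (phi x * tail i x + (-1) * (phi x * tail i.+1 x)).
have Df1 i : Dom (f1 i) by have [] := JZ (step_coef i) _ (Dt i).
have D2 i : Dom (fun x => phi x * tail i x + (-1) * (phi x * tail i.+1 x)).
  by have [] := JD _ _ (Dt i) (proj1 (JZ (-1) _ (Dt i.+1))).
have Df2 i : Dom (f2 i) by have [] := JZ (cell_osc i) _ (D2 i).
have [Ds1 Js1] := positive_linear_sum N.+1 D0 HJ Df1.
have [Ds2 Js2] := positive_linear_sum N.+1 D0 HJ Df2.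
have -> : \sum_(i < N.+1) step_coef i * J (fun x => phi x * tail i x) =
    J (fun x => \sum_(i < N.+1) f1 i x).
  by rewrite Js1; apply: eq_bigr => i _; rewrite (proj2 (JZ _ _ (Dt i))).
have -> : \sum_(i < N.+1) cell_osc i *
    (J (fun x => phi x * tail i x) - J (fun x => phi x * tail i.+1 x)) =
    J (fun x => \sum_(i < N.+1) f2 i x).
  rewrite Js2; apply: eq_bigr => i _; rewrite (proj2 (JZ _ _ (D2 i))).
  rewrite (proj2 (JD _ _ (Dt i) (proj1 (JZ (-1) _ (Dt i.+1))))).
  by rewrite (proj2 (JZ _ _ (Dt i.+1))) mulN1r.
have pw x : a <= x -> `|phi x * L x - \sum_(i < N.+1) f1 i x| <= \sum_(i < N.+1) f2 i x.
  move=> ax; have := ler_wpM2l (phi0 x) (step_approx ax).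
  rewrite -{1}(ger0_norm (phi0 x)) -normrM mulrBr !mulr_sumr.
  rewrite (eq_bigr (fun i : 'I_N.+1 => f1 i x)); last by move=> i _; rewrite /f1; ring.
  by rewrite [leRHS](eq_bigr (fun i : 'I_N.+1 => f2 i x))// => i _; rewrite /f2; ring.
rewrite ler_distl; apply/andP; split.
- rewrite lerBlDr -(proj2 (JD _ _ DL Ds2)).
  apply: Jle => //; first exact: (proj1 (JD _ _ DL Ds2)).
  by move=> x ax; have := pw _ ax; rewrite ler_distl => /andP[+ _]; rewrite lerBlDr.
- rewrite -(proj2 (JD _ _ Ds1 Ds2)); apply: Jle => //; first exact: (proj1 (JD _ _ Ds1 Ds2)).
  by move=> x ax; have := pw _ ax; rewrite ler_distl => /andP[].
Qed.

(** Replacing [L] by its step function costs [B * q] under [J2] and [B * (2 * m + q)] under [J1],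
    whose cells have mass at most [2 * m + q]; comparing the two step sums costs [2 * B * m]. *)
Lemma functional_deviation Dom1 Dom2 J1 J2 (phi : R -> R) (m q : R) :
  positive_linear Dom1 J1 -> positive_linear Dom2 J2 ->
  Dom1 (fun=> 0) -> Dom2 (fun=> 0) -> (forall x, 0 <= phi x) ->
  Dom1 (fun x => phi x * L x) -> Dom2 (fun x => phi x * L x) ->
  (forall i, Dom1 (fun x => phi x * tail i x)) ->
  (forall i, Dom2 (fun x => phi x * tail i x)) ->
  (forall i, (i <= N.+1)%N ->
    `|J1 (fun x => phi x * tail i x) - J2 (fun x => phi x * tail i x)| <= m) ->
  (forall i, (i <= N)%N ->
    J2 (fun x => phi x * tail i x) - J2 (fun x => phi x * tail i.+1 x) <= q) ->
  `|J1 (fun x => phi x * L x) - J2 (fun x => phi x * L x)| <= B * (4 * m + 2 * q).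
Proof.
move=> H1 H2 D01 D02 phi0 DL1 DL2 Dt1 Dt2 Hm Hq.
have := functional_step_approx H1 D01 phi0 DL1 Dt1.
have := functional_step_approx H2 D02 phi0 DL2 Dt2.
set g1 := fun i => J1 (fun x => phi x * tail i x).
set g2 := fun i => J2 (fun x => phi x * tail i x).
rewrite -/(g1 _) -/(g2 _) => h2 h1.
have m0 : 0 <= m by apply: le_trans (normr_ge0 _) (Hm 0%N _).
have B0 : 0 <= B by case: LW => LW1 _; apply: le_trans (normr_ge0 _) (LW1 _ (lexx a)).
have hs : `|\sum_(i < N.+1) step_coef i * g1 i - \sum_(i < N.+1) step_coef i * g2 i| <= 2 * B * m.
  rewrite -sumrB (le_trans (ler_norm_sum _ _ _))//.
  apply: le_trans (ler_wpM2r m0 sum_step_coef); rewrite mulr_suml.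
  by apply: ler_sum => i _; rewrite -mulrBr normrM ler_wpM2l// Hm// ltnW.
have hq2 : \sum_(i < N.+1) cell_osc i * (g2 i - g2 i.+1) <= \sum_(i < N.+1) cell_osc i * q.
  apply: ler_sum => i _; rewrite ler_wpM2l ?cell_osc_ge0 ?leq_ord//.
  by apply: Hq; exact: leq_ord.
have hq1 : \sum_(i < N.+1) cell_osc i * (g1 i - g1 i.+1) <=
    \sum_(i < N.+1) cell_osc i * (2 * m + q).
  apply: ler_sum => i _; rewrite ler_wpM2l ?cell_osc_ge0 ?leq_ord//.
  have := Hm i (ltnW (ltn_ord i)); have := Hm i.+1 (ltn_ord i).
  have := Hq i (leq_ord i).
  rewrite -/(g1 i) -/(g1 i.+1) -/(g2 i) -/(g2 i.+1) !ler_norml.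
  by move=> q1 /andP[? ?] /andP[? ?]; lra.
have q0 : 0 <= q.
  have [JD JZ Jle] := H2.
  apply: le_trans (Hq 0%N _) => //; rewrite subr_ge0; apply: Jle => // x _.
  by rewrite ler_wpM2l// tail_noninc.
have := sum_cell_osc; rewrite -!mulr_suml in hq1 hq2 *; set s := \sum_(i < N.+1) cell_osc i in hq1 hq2 *
  => sB; have sq : s * q <= B * q by rewrite ler_wpM2r.
have sm : s * m <= B * m by rewrite ler_wpM2r.
have tri (x1 x2 y1 y2 e1 e2 e3 : R) : `|x2 - y2| <= e2 -> `|x1 - y1| <= e1 ->
    `|y1 - y2| <= e3 -> `|x1 - x2| <= e1 + e3 + e2.
  by rewrite !ler_norml => /andP[? ?] /andP[? ?] /andP[? ?]; apply/andP; split; lra.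
apply: le_trans (tri _ _ _ _ _ _ _ h2 h1 hs) _.
apply: (@le_trans _ _ (s * (2 * m + q) + 2 * B * m + s * q)).
  by rewrite lerD// lerD2r.
clear - sq sm; rewrite mulrDr [s * (2 * m)]mulrCA !mulrDr [B * (4 * m)]mulrCA [B * (2 * q)]mulrCA.
rewrite -[2 * B * m]mulrA; lra.
Qed.

End bounded_variation.

(** * Fourth moments of centred empirical means *)

Section integrable_random_variables.
Context d (T : measurableType d) (R : realType) (P : probability T R).
Local Notation E f := (\int[P]_w f w).

Definition integ (f : T -> R) := P.-integrable [set: T] (EFin \o f).

Lemma integ_cst c : integ (fun=> c).
Proof. exact: (bmeas_integrable P (bmeas_cst T c)). Qed.

Lemma integD f g : integ f -> integ g ->
  integ (fun w => f w + g w) /\ E (fun w => f w + g w) = E f + E g.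
Proof.
move=> If Ig; split; last by rewrite RintegralD.
by rewrite /integ (_ : EFin \o _ = (EFin \o f) \+ (EFin \o g))//; exact: integrableD.
Qed.

Lemma integZ c f : integ f -> integ (fun w => c * f w) /\ E (fun w => c * f w) = c * E f.
Proof.
move=> If; split; last by rewrite RintegralZl.
rewrite /integ (_ : EFin \o _ = fun x => (c%:E * (EFin \o f) x)%E)//.
exact: integrableZl.
Qed.

Lemma integ_sum_seq (I : Type) (s : seq I) (f : I -> T -> R) : (forall i, integ (f i)) ->
  integ (fun w => \sum_(i <- s) f i w) /\
  E (fun w => \sum_(i <- s) f i w) = \sum_(i <- s) E (f i).
Proof.
move=> If; elim: s => [|i s [IH1 IH2]].
  have -> : (fun w => \sum_(i <- [::]) f i w) = (fun=> 0).
    by apply/funext => w; rewrite big_nil.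
  by rewrite big_nil; split; [exact: integ_cst|rewrite E_cst].
have -> : (fun w => \sum_(i <- i :: s) f i w) = (fun w => f i w + \sum_(i <- s) f i w).
  by apply/funext => w; rewrite big_cons.
by have [H1 H2] := integD (If i) IH1; rewrite big_cons /= -IH2 -H2.
Qed.

Lemma integ_sum n (f : nat -> T -> R) : (forall i, integ (f i)) ->
  integ (fun w => \sum_(i < n) f i w) /\
  E (fun w => \sum_(i < n) f i w) = \sum_(i < n) E (f i).
Proof. by move=> If; exact: (integ_sum_seq _ (fun i : 'I_n => If i)). Qed.

Lemma integ_le f g : integ f -> integ g -> (forall w, f w <= g w) -> E f <= E g.
Proof. by move=> If Ig fg; apply: le_Rintegral. Qed.

Lemma integ_dominated (f g : T -> R) : measurable_fun [set: T] f -> integ g ->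
  (forall w, `|f w| <= g w) -> integ f.
Proof.
move=> mf Ig fg; apply: (le_integrable measurableT _ _ Ig); first exact/measurable_EFinP.
by move=> w _ /=; rewrite lee_fin (le_trans (fg w))// ler_norm.
Qed.

Lemma integral_EFin f : integ f -> (\int[P]_w (f w)%:E = (E f)%:E)%E.
Proof. by move=> If; rewrite /Rintegral fineK//; exact: integrable_fin_num. Qed.

End integrable_random_variables.

Section iid.
Context d (T : measurableType d) (R : realType) (P : probability T R).
Variable X : nat -> {RV P >-> R}.
Hypothesis indX : mutually_independent X.
Hypothesis idX : forall i A, measurable A -> P (X i @^-1` A) = P (X 0%N @^-1` A).
Local Notation E f := (\int[P]_w f w).

Lemma integral_ident i (u : R -> \bar R) : measurable_fun [set: R] u ->
  (\int[P]_w u (X i w) = \int[P]_w u (X 0%N w))%E.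
Proof.
move=> mu.
have ge0 (v : R -> \bar R) : measurable_fun [set: R] v -> (forall x, 0 <= v x)%E ->
    (\int[P]_w v (X i w) = \int[P]_w v (X 0%N w))%E.
  move=> mv v0; rewrite -(ge0_integral_distribution (X i) mv v0).
  rewrite -(ge0_integral_distribution (X 0%N) mv v0).
  by apply: eq_measure_integral => A mA _; exact: idX.
rewrite integralE [RHS]integralE.
have := ge0 _ (measurable_funepos mu) (fun x => funepos_ge0 _ x).
have := ge0 _ (measurable_funeneg mu) (fun x => funeneg_ge0 _ x).
move=> gen gep; congr (_ - _)%E.
  by rewrite (eq_integral (fun w => (u^\+)%E (X i w)))
     1?[RHS](eq_integral (fun w => (u^\+)%E (X 0%N w)))// => w _; rewrite !funeposE.
by rewrite (eq_integral (fun w => (u^\-)%E (X i w)))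
   1?[RHS](eq_integral (fun w => (u^\-)%E (X 0%N w)))// => w _; rewrite !funenegE.
Qed.

Lemma E_ident i (u : R -> R) : measurable_fun [set: R] u ->
  E (fun w => u (X i w)) = E (fun w => u (X 0%N w)).
Proof.
by move=> mu; congr fine; apply: (integral_ident i (u := EFin \o u)); exact/measurable_EFinP.
Qed.

Lemma integ_ident i (u : R -> R) : measurable_fun [set: R] u ->
  integ P (fun w => u (X 0%N w)) -> integ P (fun w => u (X i w)).
Proof.
move=> mu /integrableP[_ I0]; apply/integrableP; split.
  by apply/measurable_EFinP; exact: (measurableT_comp mu (@measurable_funPT _ _ _ _ (X i))).
move: I0; rewrite /= => /(le_lt_trans _); apply.
rewrite (integral_ident i (u := fun x => `|(u x)%:E|%E))//.
by apply: measurableT_comp => //; exact/measurable_EFinP.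
Qed.

Definition emp_mean n (h : R -> R) w := n%:R^-1 * \sum_(i < n) h (X i w).
Definition emp_dev n (h : R -> R) w := emp_mean n h w - E (fun w => h (X 0%N w)).

(** Since [psi] and its mean lie in [[0, tau]], the centred variable is at most [tau] in absolute
    value. Its variance is at most [q] and its fourth moment at most [tau ^ 2 * q]. *)
Lemma emp_dev4 n (psi : R -> R) tau q : (0 < n)%N ->
  measurable_fun [set: R] psi -> (forall x, 0 <= psi x <= tau) ->
  E (fun w => psi (X 0%N w) ^+ 2) <= q ->
  bounded_measurable (fun w => emp_dev n psi w ^+ 4) /\
  E (fun w => emp_dev n psi w ^+ 4) <= tau ^+ 2 * q / n%:R ^+ 3 + 3 * q ^+ 2 / n%:R ^+ 2.
Proof.
move=> n0 mpsi psiB psi2.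
have mX i : measurable_fun [set: T] (X i) by [].
pose c := E (fun w => psi (X 0%N w)).
pose u x := psi x + (- c).
have bpsi i : bounded_measurable (fun w => psi (X i w)).
  split; first exact: (measurableT_comp mpsi (mX i)).
  by exists tau => w; have /andP[p0 pt] := psiB (X i w); rewrite ger0_norm.
have c0t : 0 <= c <= tau.
  apply/andP; split; first by apply: Rintegral_ge0 => w _; case/andP: (psiB (X 0%N w)).
  rewrite -[leRHS](E_cst P); apply: bmeas_E_le => //; first exact: bmeas_cst.
  by move=> w; case/andP: (psiB (X 0%N w)).
have mu : measurable_fun [set: R] u by exact: measurable_funD.
have ub x : `|u x| <= tau.
  rewrite /u ler_norml; have := psiB x; move: c0t => /andP[? ?] /andP[? ?]; apply/andP; split; lra.
have bu i k : bounded_measurable (fun w => u (X i w) ^+ k).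
  apply: bmeasX; split; first exact: (measurableT_comp mu (mX i)).
  by exists tau => w.
have u1 i : E (fun w => u (X i w)) = 0.
  rewrite (E_ident i mu) bmeas_ED//; last exact: bmeas_cst.
  by rewrite E_cst subrr.
have mux k : measurable_fun [set: R] (fun x => u x ^+ k) by exact: measurable_funX.
have [_ _] := moments_iid_sum indX mu ub u1 (fun i => E_ident i (mux 2%N))
   (fun i => E_ident i (mux 4%N)) n.
set v2 := E (fun w => u (X 0%N w) ^+ 2); set v4 := E (fun w => u (X 0%N w) ^+ 4) => S4.
have v20 : 0 <= v2 by apply: Rintegral_ge0 => w _; exact: sqr_ge0.
have v2q : v2 <= q.
  apply: le_trans psi2.
  have -> : v2 = E (fun w => (psi (X 0%N w) ^+ 2 + (- 2 * c) * psi (X 0%N w)) + c ^+ 2).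
    by apply: eq_Rintegral => w _; rewrite /u; ring.
  have b2 := bmeasX 2 (bpsi 0%N).
  have b1 := bmeasM (bmeas_cst T (- 2 * c)) (bpsi 0%N).
  rewrite bmeas_ED; [|exact: bmeasD|exact: bmeas_cst].
  rewrite bmeas_ED// bmeas_EZ// E_cst -/c; have := sqr_ge0 c; nra.
have q0 : 0 <= q by exact: le_trans v2q.
have v4q : v4 <= tau ^+ 2 * q.
  apply: (@le_trans _ _ (tau ^+ 2 * v2)); last by rewrite ler_wpM2l// sqr_ge0.
  rewrite /v2 -bmeas_EZ//; apply: bmeas_E_le => //.
    by apply: bmeasM => //; exact: bmeas_cst.
  move=> w; rewrite -[4%N]/(2 + 2)%N exprD ler_wpM2r ?sqr_ge0//.
  by rewrite -real_normK ?num_real// lerXn2r// nnegrE (le_trans (normr_ge0 _) (ub 0)).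
have n1 : n%:R != 0 :> R by rewrite pnatr_eq0 -lt0n.
have devE w : emp_dev n psi w ^+ 4 = n%:R^-1 ^+ 4 * (\sum_(i < n) u (X i w)) ^+ 4.
  have -> : \sum_(i < n) u (X i w) = \sum_(i < n) psi (X i w) - n%:R * c.
    by rewrite big_split /= sumr_const card_ord mulNrn mulr_natl.
  by rewrite /emp_dev /emp_mean -exprMn mulrBr mulrA mulVf// mul1r.
have bS : bounded_measurable (fun w => (\sum_(i < n) u (X i w)) ^+ 4).
  apply: bmeasX; apply: (bmeas_sum _ (f := fun i w => u (X i w))) => i.
  by have := bu i 1%N; under eq_fun do rewrite expr1.
have -> : (fun w => emp_dev n psi w ^+ 4) =
    (fun w => n%:R^-1 ^+ 4 * (\sum_(i < n) u (X i w)) ^+ 4) by apply/funext.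
split; first by apply: bmeasM => //; exact: bmeas_cst.
rewrite bmeas_EZ//.
apply: (@le_trans _ _ (n%:R^-1 ^+ 4 * (n%:R * (tau ^+ 2 * q) + 3 * n%:R ^+ 2 * q ^+ 2))).
  rewrite ler_wpM2l// (le_trans S4)// lerD//; first by rewrite ler_wpM2l.
  by rewrite ler_wpM2l// ?mulr_ge0// lerXn2r// nnegrE.
by rewrite le_eqVlt; apply/orP; left; apply/eqP; field.
Qed.

End iid.

(** * The uniform deviation bound *)

(** Used on a maximum: finitely many deviations are all at most [s] plus the sum of their fourth
    powers over [s ^ 3], which is measurable and has a computable expectation. *)
Lemma le_add_pow4 (R : realType) (x s : R) : 0 <= x -> 0 < s -> x <= s + x ^+ 4 / s ^+ 3.
Proof.
move=> x0 s0; have s30 : 0 < s ^+ 3 by rewrite exprn_gt0.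
case: (leP x s) => xs; first by rewrite (le_trans xs)// lerDl divr_ge0// ?exprn_ge0// ltW.
apply: (@le_trans _ _ (x ^+ 4 / s ^+ 3)); last by rewrite lerDr ltW.
by rewrite ler_pdivlMr// [leRHS]exprS ler_wpM2l// lerXn2r ?nnegrE// ltW.
Qed.

Lemma pow_le1_powR (R : realType) (x p : R) k : 0 <= x -> k%:R <= p -> x ^+ k <= 1 + x `^ p.
Proof.
move=> x0 kp; case: (leP x 1) => x1.
  by rewrite (le_trans (exprn_ile1 _ x0 x1))// lerDl powR_ge0.
apply: (@le_trans _ _ (x `^ p)); last by rewrite lerDr.
by rewrite -powR_mulrn// ler_powR// ltW.
Qed.

Section uniform_deviation.
Context d (T : measurableType d) (R : realType) (P : probability T R).
Variable X : nat -> {RV P >-> R}.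
Hypothesis indX : mutually_independent X.
Hypothesis idX : forall i A, measurable A -> P (X i @^-1` A) = P (X 0%N @^-1` A).
Variable a : R.
Hypothesis aX : forall i w, a <= X i w.
Local Notation E f := (\int[P]_w f w).
Local Notation dev := (emp_dev X).

Lemma positive_linear_emp n w :
  positive_linear a setT (fun h => emp_mean X n h w).
Proof.
rewrite /emp_mean; split.
- by move=> f g _ _; split=> //; rewrite big_split mulrDr.
- by move=> c f _; split=> //; rewrite -mulr_sumr mulrCA.
- move=> f g _ _ fg; rewrite ler_wpM2l// ?invr_ge0 ?ler0n//.
  by apply: ler_sum => i _; exact: fg.
Qed.

Lemma positive_linear_E :
  positive_linear a [set h | integ P (fun w => h (X 0%N w))] (fun h => E (fun w => h (X 0%N w))).
Proof.
split=> [f g|c f|f g] /=; first exact: integD.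
- exact: integZ.
- by move=> If Ig fg; apply: integ_le => // w; exact: fg.
Qed.

Lemma emp_devD n f g w : integ P (fun w => f (X 0%N w)) -> integ P (fun w => g (X 0%N w)) ->
  dev n (fun x => f x + g x) w = dev n f w + dev n g w.
Proof.
move=> If Ig; rewrite /emp_dev (proj2 (integD If Ig)).
have [H _ _] := positive_linear_emp n w.
by rewrite (proj2 (H f g I I)); ring.
Qed.

Lemma emp_devZ n c f w : integ P (fun w => f (X 0%N w)) ->
  dev n (fun x => c * f x) w = c * dev n f w.
Proof.
move=> If; rewrite /emp_dev (proj2 (integZ c If)).
have [_ H _] := positive_linear_emp n w.
by rewrite (proj2 (H c f I)); ring.
Qed.

Variables (phi : R -> R) (delta : R).
Hypotheses (mphi : measurable_fun [set: R] phi) (phi0 : forall x, 0 <= phi x).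
Hypotheses (delta0 : 0 < delta) (phip : integ P (fun w => phi (X 0%N w) `^ (2 + delta))).

Let mX i : measurable_fun [set: T] (X i). Proof. by []. Qed.

Let p2 : 2%:R <= 2 + delta. Proof. by rewrite lerDl ltW. Qed.
Let p1 : 1%:R <= 2 + delta. Proof. by rewrite (le_trans _ p2)// ler_nat. Qed.

Lemma integ_phi1 : integ P (fun w => phi (X 0%N w)).
Proof.
have [I1 _] := integD (integ_cst P 1) phip.
apply: integ_dominated I1 _; first exact: (measurableT_comp mphi (mX 0)).
by move=> w; rewrite ger0_norm// -[leLHS]expr1 pow_le1_powR// p1.
Qed.

Lemma integ_phi2 : integ P (fun w => phi (X 0%N w) ^+ 2).
Proof.
have [I1 _] := integD (integ_cst P 1) phip.
apply: integ_dominated I1 _.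
  by apply: measurable_funX; exact: (measurableT_comp mphi (mX 0)).
by move=> w; rewrite ger0_norm ?sqr_ge0// pow_le1_powR// p2.
Qed.

Lemma measurable_tail N (r : nat -> R) i : measurable_fun [set: R] (tail N r i).
Proof.
rewrite (_ : tail N r i = \1_(if (i <= N)%N then `[r i, +oo[%classic else set0)); last first.
  apply/funext => x; rewrite /tail indicE; case: (i <= N)%N => /=; last by rewrite in_set0.
  by congr (_%:R); congr nat_of_bool; apply/idP/idP; rewrite inE /= in_itv /= andbT.
by apply: measurable_indic; case: ifP.
Qed.

Lemma tail_le1 N (r : nat -> R) i x : tail N r i x <= 1.
Proof. by rewrite /tail; case: (_ && _). Qed.

Let integ_bounded_mul (h t : R -> R) : measurable_fun [set: R] h ->
  measurable_fun [set: R] t -> integ P (fun w => h (X 0%N w)) -> (forall x, 0 <= h x) ->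
  (forall x, `|t x| <= 1) ->
  integ P (fun w => h (X 0%N w) * t (X 0%N w)).
Proof.
move=> mh mt Ih h0 t1; apply: integ_dominated Ih _.
  by apply: measurable_funM; [exact: (measurableT_comp mh (mX 0))|exact: (measurableT_comp mt (mX 0))].
by move=> w; rewrite normrM (ger0_norm (h0 _)) ler_piMr.
Qed.

(** The part of [phi] removed by truncation; it enters only through its first moment, without
    chaining. *)
Definition excess tau x := phi x - Num.min (phi x) tau.

Lemma excess_ge0 tau x : 0 <= excess tau x.
Proof. by rewrite subr_ge0 ge_min lexx. Qed.

Section fixed_sample_size.
Variables (n K : nat) (tau Q : R) (s : nat -> R) (r : nat -> R).
Hypotheses (n0 : (0 < n)%N) (tau0 : 0 <= tau) (s0 : forall k, 0 < s k).
(** Grid points are numbered from [0] to [2 ^ K - 1], so there are [2 ^ K] cells and the tail of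
    index [2 ^ K] is empty: this is the vanishing end required by the chaining. *)
Let N := (2 ^ K).-1.
Hypotheses (r0 : r 0 = a) (r_nd : forall i j, (i <= j)%N -> (j <= N)%N -> r i <= r j).
Hypothesis rQ : forall i j, (i <= j)%N -> (j <= 2 ^ K)%N ->
  E (fun w => (1 + phi (X 0%N w) ^+ 2) * (tail N r i (X 0%N w) - tail N r j (X 0%N w)))
    <= Q * (j - i)%N%:R / (2 ^ K)%:R.

Local Notation t := (tail N r).
Let N1 : N.+1 = (2 ^ K)%N. Proof. by rewrite prednK// expn_gt0. Qed.

Let ft x := Num.min (phi x) tau.
Let ft0 x : 0 <= ft x. Proof. by rewrite le_min phi0. Qed.
Let ft_tau x : ft x <= tau. Proof. by rewrite ge_min lexx orbT. Qed.
Let ft_phi x : ft x <= phi x. Proof. by rewrite ge_min lexx. Qed.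
Let mft : measurable_fun [set: R] ft. Proof. exact: measurable_minr. Qed.
Let mex : measurable_fun [set: R] (excess tau). Proof. exact: measurable_funB. Qed.
Let ex_phi x : excess tau x <= phi x. Proof. by rewrite /excess lerBlDr lerDl ft0. Qed.

Let t_noninc i j x : (i <= j)%N -> t j x <= t i x.
Proof.
move=> /subnK <-; elim: (j - i)%N => [|k IH]; first by rewrite add0n.
by rewrite addSn (le_trans (tail_noninc r_nd _ _))// .
Qed.

Let integ_ft : integ P (fun w => ft (X 0%N w)).
Proof.
apply: integ_dominated integ_phi1 _; first exact: (measurableT_comp mft (mX 0)).
by move=> w; rewrite ger0_norm.
Qed.

Let integ_ex : integ P (fun w => excess tau (X 0%N w)).
Proof.
apply: integ_dominated integ_phi1 _; first exact: (measurableT_comp mex (mX 0)).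
by move=> w; rewrite ger0_norm// excess_ge0.
Qed.

Let t1 i x : `|t i x| <= 1. Proof. by rewrite ger0_norm ?tail_ge0// tail_le1. Qed.

(** The difference of tails is the indicator of the [j]-th of the [2 ^ k] groups of [2 ^ (K - k)]
    consecutive cells. *)
Definition block k j x := ft x * (t (j * 2 ^ (K - k))%N x - t (j.+1 * 2 ^ (K - k))%N x).

(** Bounds every block deviation of level [k] simultaneously, by [le_add_pow4] with threshold
    [s k]. *)
Let level k w := s k + \sum_(j < 2 ^ k) (s k ^+ 3)^-1 * dev n (block k j) w ^+ 4.

Let mblock k j : measurable_fun [set: R] (block k j).
Proof.
by apply: measurable_funM => //; apply: measurable_funB; exact: measurable_tail.
Qed.

Let diff01 i j x : (i <= j)%N -> 0 <= t i x - t j x <= 1.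
Proof.
move=> ij; rewrite subr_ge0 t_noninc//=.
by rewrite lerBlDr (le_trans (tail_le1 _ _ _ _))// lerDl tail_ge0.
Qed.

Let jj k j : (j * 2 ^ (K - k) <= j.+1 * 2 ^ (K - k))%N.
Proof. by rewrite leq_mul2r leqnSn orbT. Qed.

(** The squared truncation is at most [1 + phi ^ 2], and a group of [2 ^ (K - k)] cells carries at
    most [Q / 2 ^ k] of the law weighted by it. *)
Let level_moment k j : (k <= K)%N -> (j < 2 ^ k)%N ->
  bounded_measurable (fun w => dev n (block k j) w ^+ 4) /\
  E (fun w => dev n (block k j) w ^+ 4) <=
  tau ^+ 2 * (Q / (2 ^ k)%:R) / n%:R ^+ 3 + 3 * (Q / (2 ^ k)%:R) ^+ 2 / n%:R ^+ 2.
Proof.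
move=> kK jk; apply: emp_dev4 => //.
- move=> x; have /andP[d0 d1] := diff01 x (jj k j).
  by rewrite mulr_ge0//= (le_trans _ (ft_tau x))// ler_piMr.
- have j1K : (j.+1 * 2 ^ (K - k) <= 2 ^ K)%N.
    by rewrite -{2}(subnKC kK) expnD leq_mul2r jk orbT.
  have := rQ (jj k j) j1K.
  rewrite -mulnBl subSnn mul1n.
  have -> : Q * (2 ^ (K - k))%:R / (2 ^ K)%:R = Q / (2 ^ k)%:R :> R.
    rewrite -{2}(subnKC kK) expnD natrM.
    have h1 : (2 ^ k)%:R != 0 :> R by rewrite pnatr_eq0 expn_eq0.
    have h2 : (2 ^ (K - k))%:R != 0 :> R by rewrite pnatr_eq0 expn_eq0.
    by field; rewrite h1 h2.
  apply: le_trans; apply: integ_le.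
  + apply: (bmeas_integrable P); apply: bmeasX; split.
      exact: (measurableT_comp (mblock k j) (mX 0)).
    exists tau => w; have /andP[d0 d1] := diff01 (X 0%N w) (jj k j).
    by rewrite /block ger0_norm ?mulr_ge0// (le_trans _ (ft_tau (X 0%N w)))// ler_piMr.
  + have [I1 _] := integD (integ_cst P 1) integ_phi2.
    apply: (integ_bounded_mul (h := fun x => 1 + phi x ^+ 2)
      (t := fun x => t (j * 2 ^ (K - k))%N x - t (j.+1 * 2 ^ (K - k))%N x)) => //.
    * by apply: measurable_funD => //; exact: measurable_funX.
    * by apply: measurable_funB; exact: measurable_tail.
    * by move=> x; rewrite addr_ge0// sqr_ge0.
    * by move=> x; have /andP[d0 d1] := diff01 x (jj k j); rewrite ger0_norm.
  + move=> w; rewrite /block exprMn; set x := X 0%N w.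
    have /andP[d0 d1] := diff01 x (jj k j); set dd := _ - _ in d0 d1 *.
    have h1 : ft x ^+ 2 <= 1 + phi x ^+ 2.
      by rewrite (@le_trans _ _ (phi x ^+ 2))// ?lerDr// lerXn2r// nnegrE.
    apply: ler_pM => //; rewrite ?sqr_ge0//.
    by rewrite expr2 ler_piMl.
Qed.

Let G i w := dev n (fun x => phi x * t i x) w.
Let H i w := dev n (fun x => ft x * t i x) w.

Let devH k j w : H (j.+1 * 2 ^ (K - k))%N w - H (j * 2 ^ (K - k))%N w = - dev n (block k j) w.
Proof.
have If i : integ P (fun w => ft (X 0%N w) * t i (X 0%N w)).
  by apply: integ_bounded_mul => //; exact: measurable_tail.
have -> : block k j = fun x => ft x * t (j * 2 ^ (K - k))%N x + (-1) * (ft x * t (j.+1 * 2 ^ (K - k))%N x).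
  by apply/funext => x; rewrite /block; ring.
by rewrite emp_devD ?emp_devZ//; [rewrite /H; ring|have [] := integZ (-1) (If (j.+1 * 2 ^ (K - k))%N)].
Qed.

Let H_le i w : (i <= 2 ^ K)%N -> `|H i w| <= \sum_(k < K.+1) level k w.
Proof.
apply: (dyadic_chaining (G := fun i => H i w) (m := fun k => level k w)).
  rewrite -N1 /H /emp_dev /emp_mean big1 ?mulr0 ?sub0r; last first.
    by move=> i' _; rewrite /tail ltnn mulr0.
  by under eq_Rintegral do rewrite /tail ltnn mulr0; rewrite E_cst oppr0.
move=> k j kK jk; rewrite devH normrN.
apply: le_trans (le_add_pow4 (normr_ge0 _) (s0 k)) _; rewrite lerD2l.
rewrite (bigD1 (Ordinal jk))//= -[`|_| ^+ 4]normrX ger0_norm ?exprn_even_ge0// mulrC lerDl.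
apply: sumr_ge0 => j' _; rewrite mulr_ge0// ?exprn_even_ge0//.
by rewrite invr_ge0 exprn_ge0// ltW.
Qed.

(** The bound [4 * m + 2 * q] of [functional_deviation]: [m] is the chained bound for the truncated
    part plus both means of the excess, and [q] is the mass of a cell. It does not involve [L]. *)
Definition deviation_bound w := 4 * (\sum_(k < K.+1) level k w +
  (emp_mean X n (excess tau) w + E (fun w => excess tau (X 0%N w)))) + 2 * (Q / (2 ^ K)%:R).

(** Tails lie between [0] and [1], so the deviation of the excess on any tail is at most the sum of
    its sample mean and its expectation. *)
Let G_le i w : (i <= N.+1)%N -> `|G i w| <= \sum_(k < K.+1) level k w +
  (emp_mean X n (excess tau) w + E (fun w => excess tau (X 0%N w))).
Proof.
rewrite N1 => iN.
have It i' : integ P (fun w => ft (X 0%N w) * t i' (X 0%N w)).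
  by apply: integ_bounded_mul => //; exact: measurable_tail.
have Ie i' : integ P (fun w => excess tau (X 0%N w) * t i' (X 0%N w)).
  apply: integ_bounded_mul => //; [exact: measurable_tail|exact: excess_ge0].
have -> : G i w = H i w + dev n (fun x => excess tau x * t i x) w.
  rewrite -emp_devD//; congr (dev n _ w); apply/funext => x; rewrite /excess -/(ft x); ring.
apply: le_trans (ler_normD _ _) _; rewrite lerD ?H_le//.
apply: le_trans (ler_normB _ _) _; apply: lerD.
- have [_ _ mono] := positive_linear_emp n w.
  rewrite ger0_norm; last first.
    rewrite mulr_ge0 ?invr_ge0// sumr_ge0// => i' _.
    by rewrite mulr_ge0 ?excess_ge0 ?tail_ge0.
  by apply: mono => // x _; rewrite ler_piMr ?excess_ge0 ?tail_le1.
- rewrite ger0_norm; last first.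
    by apply: Rintegral_ge0 => w' _; rewrite mulr_ge0 ?excess_ge0 ?tail_ge0.
  apply: integ_le => // w'; by rewrite ler_piMr ?excess_ge0 ?tail_le1.
Qed.

Lemma uniform_deviation_bound w B (L W : R -> R) : variation_bound a B L W ->
  integ P (fun w => phi (X 0%N w) * L (X 0%N w)) ->
  `|dev n (fun x => phi x * L x) w| <= B * deviation_bound w.
Proof.
move=> LW IL.
have Ip i' : integ P (fun w => phi (X 0%N w) * t i' (X 0%N w)).
  by apply: (integ_bounded_mul mphi _ integ_phi1) => //; exact: measurable_tail.
apply: (functional_deviation r0 r_nd LW (positive_linear_emp n w) positive_linear_E) => //=.
- exact: integ_cst.
- by move=> i iN; exact: G_le.
move=> i iN; have := rQ (leqnSn i) (ltac:(by rewrite -N1)); rewrite subSnn mulr1.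
apply: le_trans.
have -> : E (fun w => phi (X 0%N w) * t i (X 0%N w)) - E (fun w => phi (X 0%N w) * t i.+1 (X 0%N w))
  = E (fun w => phi (X 0%N w) * t i (X 0%N w) + -1 * (phi (X 0%N w) * t i.+1 (X 0%N w))).
  have [I2 E2] := integZ (-1) (Ip i.+1).
  by have [_ ->] := integD (Ip i) I2; rewrite E2 mulN1r.
apply: integ_le.
- by have [I2 _] := integZ (-1) (Ip i.+1); have [] := integD (Ip i) I2.
- have [I1 _] := integD (integ_cst P 1) integ_phi2.
  apply: (integ_bounded_mul (h := fun x => 1 + phi x ^+ 2)
      (t := fun x => t i x - t i.+1 x)) => //.
  * by apply: measurable_funD => //; exact: measurable_funX.
  * by apply: measurable_funB; exact: measurable_tail.
  * by move=> x; rewrite addr_ge0// sqr_ge0.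
  * by move=> x; have /andP[d0 d1] := diff01 x (leqnSn i); rewrite ger0_norm.
(* The grid controls [1 + phi ^ 2], which dominates [phi]. *)
- move=> w'; rewrite mulN1r -mulrBr; have /andP[d0 d1] := diff01 (X 0%N w') (leqnSn i).
  by rewrite ler_wpM2r//; have := sqr_ge0 (phi (X 0%N w') - 1); have := phi0 (X 0%N w'); nra.
Qed.

(** Summing over the [2 ^ k] blocks cancels the factor [2 ^ - k] of the truncation term, but leaves
    one such factor in the squared second-moment term. *)
Lemma deviation_bound_integ : 0 <= Q -> [/\ integ P deviation_bound,
  forall w, 0 <= deviation_bound w &
  E deviation_bound <= 4 * (\sum_(k < K.+1) (s k + (s k ^+ 3)^-1 *
     (tau ^+ 2 * Q / n%:R ^+ 3 + 3 * Q ^+ 2 / (2 ^ k)%:R / n%:R ^+ 2)) +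
     2 * E (fun w => excess tau (X 0%N w))) + 2 * (Q / (2 ^ K)%:R)].
Proof.
move=> Q0.
have s30 k : 0 <= (s k ^+ 3)^-1 by rewrite invr_ge0 exprn_ge0// ltW.
(* The value [0] outside the dyadic range makes integrability hold for all indices, as [integ_sum]
   demands. *)
pose term k j w := if (k <= K)%N && (j < 2 ^ k)%N then (s k ^+ 3)^-1 * dev n (block k j) w ^+ 4 else 0.
have Iterm k j : integ P (term k j).
  rewrite /term; case: (boolP ((k <= K)%N && (j < 2 ^ k)%N)) => [/andP[kK jk]|_]; last exact: integ_cst.
  have [b4 _] := level_moment kK jk.
  by have [] := integZ (s k ^+ 3)^-1 (bmeas_integrable P b4).
pose lev k w := s k + \sum_(j < 2 ^ k) term k j w.
have Ilev k : integ P (lev k) /\ E (lev k) = s k + \sum_(j < 2 ^ k) E (term k j).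
  have [I1 E1] := integ_sum (2 ^ k) (Iterm k).
  by have [? ->] := integD (integ_cst P (s k)) I1; rewrite E_cst E1.
have levE k w : (k <= K)%N -> level k w = lev k w.
  by move=> kK; congr (_ + _); apply: eq_bigr => j _; rewrite /term kK ltn_ord.
have [Is Es] := integ_sum K.+1 (fun k => proj1 (Ilev k)).
have [Iem Eem] : integ P (emp_mean X n (excess tau)) /\
    E (emp_mean X n (excess tau)) = E (fun w => excess tau (X 0%N w)).
  have [I1 E1] := integ_sum n (fun i => integ_ident idX i mex integ_ex).
  have [I2 E2] := integZ n%:R^-1 I1; split => //.
  rewrite E2 E1 (eq_bigr (fun=> E (fun w => excess tau (X 0%N w)))); last first.
    by move=> i _; exact: E_ident.
  by rewrite sumr_const card_ord -[X in _ * X]mulr_natl mulKf// pnatr_eq0 -lt0n.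
have [I3 E3] := integD Iem (integ_cst P (E (fun w => excess tau (X 0%N w)))).
have [I4 E4] := integD Is I3.
have [I5 E5] := integZ 4 I4.
have [I6 E6] := integD I5 (integ_cst P (2 * (Q / (2 ^ K)%:R))).
have dE : deviation_bound = fun w => 4 * (\sum_(k < K.+1) lev k w +
  (emp_mean X n (excess tau) w + E (fun w => excess tau (X 0%N w)))) + 2 * (Q / (2 ^ K)%:R).
  apply/funext => w; rewrite /deviation_bound.
  by rewrite (eq_bigr (fun k : 'I_K.+1 => lev k w))// => k _; rewrite levE// -ltnS.
rewrite dE; split => //.
- move=> w; apply: addr_ge0; last by rewrite mulr_ge0// divr_ge0.
  apply: mulr_ge0 => //; apply: addr_ge0; last apply: addr_ge0.
  + apply: sumr_ge0 => k _; apply: addr_ge0; first exact: ltW.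
    apply: sumr_ge0 => j _; rewrite /term; case: ifP => // _.
    by rewrite mulr_ge0// exprn_even_ge0.
  + rewrite /emp_mean mulr_ge0 ?invr_ge0 ?ler0n// sumr_ge0// => i _; exact: excess_ge0.
  + by apply: Rintegral_ge0 => w' _; exact: excess_ge0.
- rewrite E6 E5 E4 E3 Es Eem !E_cst lerD2r ler_wpM2l// lerD//; last by rewrite mulr2n mulrDl mul1r.
  apply: ler_sum => k _; rewrite (proj2 (Ilev k)) lerD2l.
  have kK : (k <= K)%N by rewrite -ltnS.
  apply: (@le_trans _ _ (\sum_(j < 2 ^ k) (s k ^+ 3)^-1 *
      (tau ^+ 2 * (Q / (2 ^ k)%:R) / n%:R ^+ 3 + 3 * (Q / (2 ^ k)%:R) ^+ 2 / n%:R ^+ 2))).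
    apply: ler_sum => j _; rewrite /term kK ltn_ord /=.
    have [b4 E4j] := level_moment kK (ltn_ord j).
    have [_ ->] := integZ (s k ^+ 3)^-1 (bmeas_integrable P b4).
    by rewrite ler_wpM2l.
  rewrite sumr_const card_ord -[leLHS]mulr_natl mulrCA ler_wpM2l// le_eqVlt; apply/orP; left.
  have h1 : (2 ^ k)%:R != 0 :> R by rewrite pnatr_eq0 expn_eq0.
  have h2 : n%:R != 0 :> R by rewrite pnatr_eq0 -lt0n.
  by apply/eqP; field; rewrite h1 h2.
Qed.

End fixed_sample_size.
End uniform_deviation.

(** * Choice of the parameters and the root-n rate *)

Lemma geometric_sum_le (R : realType) (x : R) m : 0 <= x < 1 ->
  \sum_(k < m) x ^+ k <= (1 - x)^-1.
Proof.
move=> /andP[x0 x1]; have x1' : 0 < 1 - x by rewrite subr_gt0.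
rewrite -[leRHS]mulr1 ler_pdivlMl//.
have -> : (1 - x) * \sum_(k < m) x ^+ k = 1 - x ^+ m.
  have := subrX1 x m; move=> h; apply: oppr_inj; rewrite opprB h; ring.
by rewrite lerBlDr lerDl exprn_ge0.
Qed.

Section rate.
Context d (T : measurableType d) (R : realType) (P : probability T R).
Variable X : nat -> {RV P >-> R}.
Hypothesis indX : mutually_independent X.
Hypothesis idX : forall i A, measurable A -> P (X i @^-1` A) = P (X 0%N @^-1` A).
Variable a : R.
Hypothesis aX : forall i w, a <= X i w.
Local Notation E f := (\int[P]_w f w).
Local Notation dev := (emp_dev X).
Variables (phi : R -> R) (delta : R).
Hypotheses (mphi : measurable_fun [set: R] phi) (phi0 : forall x, 0 <= phi x).
Hypotheses (delta0 : 0 < delta) (phip : integ P (fun w => phi (X 0%N w) `^ (2 + delta))).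

(** With [tau] the truncation level, the excess vanishes where [phi <= tau] and elsewhere is at most
    [phi ^ (2 + delta) / tau ^ (1 + delta)]; the level is chosen so that
    [tau ^ (1 + delta) = 2 ^ K]. *)
Lemma E_excess_le K :
  E (fun w => excess phi ((2 `^ (1 + delta)^-1) ^+ K) (X 0%N w)) <=
  E (fun w => phi (X 0%N w) `^ (2 + delta)) / 2 ^+ K.
Proof.
set tau := _ ^+ K.
have mX : measurable_fun [set: T] (X 0%N) by [].
have d1 : 0 < 1 + delta by rewrite addr_gt0.
have tau0 : 0 < tau by rewrite exprn_gt0// powR_gt0.
have tau2 : tau `^ (1 + delta) = 2 ^+ K.
  by rewrite /tau -powR_mulrn ?powR_ge0// powRAC -(powRrM 2) mulVf ?gt_eqF// powRr1// powR_mulrn.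
have pw x : excess phi tau x <= (2 ^+ K)^-1 * phi x `^ (2 + delta).
  rewrite ler_pdivlMl ?exprn_gt0//.
  have e0 := excess_ge0 phi tau x.
  case: (leP (phi x) tau) => px.
    by rewrite /excess min_l// subrr mulr0 powR_ge0.
  have ep : excess phi tau x <= phi x by rewrite /excess (min_r (ltW px)) gerBl ltW.
  have p0 : 0 < phi x by exact: lt_trans px.
  rewrite (_ : 2 + delta = 1 + delta + 1); last by ring.
  rewrite powRD ?(gt_eqF p0) ?implybT// powRr1// -tau2 ler_pM// ?powR_ge0//.
  by apply: ge0_ler_powR; rewrite ?nnegrE ?ltW.
have [I2 E2] := integZ (2 ^+ K)^-1 phip.
rewrite mulrC -E2; apply: integ_le => //.
apply: integ_dominated I2 _.
  have mex : measurable_fun [set: R] (excess phi tau).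
    by apply: measurable_funB => //; exact: measurable_minr.
  exact: (measurableT_comp mex mX).
by move=> w; rewrite ger0_norm ?excess_ge0.
Qed.

(* [tail (2 ^ K).-1 r i - tail (2 ^ K).-1 r j] is the indicator of the union of
   the cells number [i] to [j - 1] of the grid [r]. *)
Definition quantile_grid (Q : R) (K : nat) (r : nat -> R) :=
  [/\ r 0 = a, forall i j, (i <= j)%N -> (j <= (2 ^ K).-1)%N -> r i <= r j &
   forall i j, (i <= j)%N -> (j <= 2 ^ K)%N ->
    E (fun w => (1 + phi (X 0%N w) ^+ 2) *
       (tail (2 ^ K).-1 r i (X 0%N w) - tail (2 ^ K).-1 r j (X 0%N w)))
    <= Q * (j - i)%N%:R / (2 ^ K)%:R].

(** The parameters make every level contribute [2 ^ - K] times a term of a convergent geometric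
    series, and [2 ^ - K] is of order [n ^ (- 1 / 2)]. *)
Lemma uniform_deviation_rate (Q : R) : 0 <= Q ->
  (forall K, exists r, quantile_grid Q K r) ->
  exists (D : nat -> T -> R) (C : R), forall n, (0 < n)%N ->
    [/\ integ P (D n), forall w, 0 <= D n w, E (D n) <= C / Num.sqrt n%:R &
     forall w B (L W : R -> R), variation_bound a B L W ->
       integ P (fun w => phi (X 0%N w) * L (X 0%N w)) ->
       `|dev n (fun x => phi x * L x) w| <= B * D n w].
Proof.
move=> Q0 grid.
pose b : R := 2 `^ (1 + delta)^-1.
have d1 : 0 < 1 + delta by rewrite addr_gt0.
have b0 : 0 < b by rewrite powR_gt0.
have b2 : b < 2.
  have l2 : 0 < ln 2 :> R by rewrite ln_gt0// ltr1n.
  rewrite /b /powR gt_eqF// -[ltRHS]lnK ?posrE// ltr_expR gtr_pMl//.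
  by rewrite invf_lt1// ltrDl.
(* A common ratio for the two decays available: [2 ^ - k] from the blocks, and [b ^ 2 / 4 < 1] from
   the truncation level against [4 ^ K]. *)
pose theta := Num.max (2^-1) (b ^+ 2 / 4).
have th1 : theta < 1.
  rewrite gt_max invf_lt1// ltr1n /= ltr_pdivrMr// mul1r.
  by rewrite (_ : 4 = 2 ^+ 2) ?ltrXn2r ?nnegrE ?ltW// -natrX.
have th0 : 0 < theta by rewrite lt_max invr_gt0 ltr0n.
(* The thresholds must decay like [rho ^ k] with [rho < 1], yet [theta / rho ^ 3 < 1] because their
   cubes are divided by. Here [rho = 1 - (1 - theta) / 3], whose cube exceeds [theta]. *)
pose rho := (2 + theta) / 3.
have rho0 : 0 < rho by rewrite divr_gt0// addr_gt0.
have rho1 : rho < 1 by rewrite ltr_pdivrMr// mul1r; move: th1; lra.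
have rho3 : theta < rho ^+ 3.
  have e0 : 0 < 1 - theta by rewrite subr_gt0.
  have -> : rho ^+ 3 = theta + (1 - theta) ^+ 2 / 3 * (1 - (1 - theta) / 9).
    by rewrite /rho; field.
  rewrite ltrDl mulr_gt0 ?divr_gt0 ?exprn_gt0//.
  by move: th0; lra.
pose x := theta / rho ^+ 3.
have rho30 : 0 < rho ^+ 3 by rewrite exprn_gt0.
have x01 : 0 <= x < 1 by rewrite divr_ge0 ?ltW//= ltr_pdivrMr// mul1r.
pose Mp := E (fun w => phi (X 0%N w) `^ (2 + delta)).
pose C0 := 4 * ((1 - rho)^-1 + (Q + 3 * Q ^+ 2) * (1 - x)^-1 + 2 * Mp) + 2 * Q.
pose K n := trunc_log 4 n.
have HK n : (0 < n)%N -> (4 ^ K n <= n < 4 ^ (K n).+1)%N by move=> n0; exact: trunc_log_bounds.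
pose s n k := rho ^+ k / 2 ^+ K n.
have s0 n k : 0 < s n k by rewrite divr_gt0 ?exprn_gt0.
have [r Hr] := choice grid.
exists (fun n => deviation_bound X phi n (K n) (b ^+ K n) Q (s n) (r (K n))), (2 * C0).
move=> n n0; have [r1 r2 r3] := Hr (K n); have tau0 : 0 <= b ^+ K n by rewrite exprn_ge0// ltW.
have [I1 D0 ED] := deviation_bound_integ indX idX mphi phi0 delta0 phip n0 tau0 (s0 n) r2 r3 Q0.
split => //; last by move=> w B L W LW IL; exact: (uniform_deviation_bound aX mphi phi0 delta0 phip n tau0 (s0 n) r1 r2 r3 w LW IL).
apply: le_trans ED _.
have nR : 0 < n%:R :> R by rewrite ltr0n.
have pK : 0 < 2 ^+ K n :> R by rewrite exprn_gt0.
have nA : (2 ^+ K n) ^+ 2 <= n%:R :> R.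
  have /andP[h _] := HK n n0; rewrite -exprM mulnC exprM -natrX -natrX ler_nat.
  exact: h.
(* From [n < 4 ^ (K + 1)]; this is the factor [2] in the constant [2 * C0]. *)
have sqn : (2 ^+ K n)^-1 <= 2 / Num.sqrt n%:R :> R.
  rewrite ler_pdivlMr ?sqrtr_gt0// ler_pdivrMl// -exprSr.
  rewrite -[leRHS]ger0_norm ?exprn_ge0// -sqrtr_sqr ler_sqrt ?exprn_gt0//.
  have /andP[_ h] := HK n n0; rewrite -exprM mulnC exprM -natrX -natrX ler_nat.
  exact: ltnW h.
have Mp0 : 0 <= Mp by apply: Rintegral_ge0 => w _; exact: powR_ge0.
have Q3 : 0 <= Q + 3 * Q ^+ 2 by rewrite addr_ge0// mulr_ge0// sqr_ge0.
have x1 : 0 <= (1 - x)^-1 by case/andP: x01 => _ x1; rewrite invr_ge0 subr_ge0 ltW.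
have C00 : 0 <= C0.
  rewrite addr_ge0// mulr_ge0// addr_ge0// ?mulr_ge0//.
  by rewrite addr_ge0// ?mulr_ge0// invr_ge0 subr_ge0 ltW.
apply: (@le_trans _ _ ((2 ^+ K n)^-1 * C0)); last first.
  by rewrite mulrAC ler_wpM2r.
set A : R := 2 ^+ K n in pK nA sqn *.
have Ei := E_excess_le (K n); rewrite -/Mp -/A -/b in Ei.
have term k : (k <= K n)%N -> s n k + (s n k ^+ 3)^-1 *
    ((b ^+ K n) ^+ 2 * Q / n%:R ^+ 3 + 3 * Q ^+ 2 / (2 ^ k)%:R / n%:R ^+ 2) <=
    A^-1 * (rho ^+ k + (Q + 3 * Q ^+ 2) * x ^+ k).
  move=> kK; rewrite /s -/A.
  have rk : 0 < rho ^+ k by rewrite exprn_gt0.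
  have xk : x ^+ k = theta ^+ k / (rho ^+ k) ^+ 3 by rewrite expr_div_n exprAC.
  (* The truncation gains [theta ^ K], which is at most [theta ^ k] on every level [k <= K]. *)
  have t1 : (b ^+ K n) ^+ 2 <= theta ^+ k * A ^+ 2.
    have -> : (b ^+ K n) ^+ 2 = (b ^+ 2 / 4) ^+ K n * A ^+ 2.
      rewrite /A -[(2 ^+ K n) ^+ 2]exprAC -exprMn -natrX -[(b ^+ K n) ^+ 2]exprAC.
      by rewrite (_ : (2 ^ 2)%N = 4%N)// divfK.
    rewrite ler_wpM2r ?sqr_ge0//.
    apply: (@le_trans _ _ (theta ^+ K n)).
      have h : b ^+ 2 / 4 <= theta by rewrite le_max lexx orbT.
      by rewrite lerXn2r// nnegrE ?divr_ge0 ?sqr_ge0// ltW.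
    by apply: ler_wiXn2l => //; exact: ltW.
  have t2 : ((2 ^ k)%:R)^-1 <= theta ^+ k.
    have h : 2^-1 <= theta by rewrite le_max lexx.
    by rewrite natrX -exprVn lerXn2r// nnegrE ?invr_ge0// ltW.
  have n2 : (n%:R ^+ 2)^-1 <= (A ^+ 4)^-1.
    by rewrite lef_pV2 ?posrE ?exprn_gt0// -[4%N]/(2 * 2)%N exprM lerXn2r ?nnegrE// ?sqr_ge0// ltW.
  have n3 : (n%:R ^+ 3)^-1 <= (A ^+ 6)^-1.
    by rewrite lef_pV2 ?posrE ?exprn_gt0// -[6%N]/(2 * 3)%N exprM lerXn2r ?nnegrE// ?sqr_ge0// ltW.
  have -> : A^-1 * (rho ^+ k + (Q + 3 * Q ^+ 2) * x ^+ k) = rho ^+ k / A +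
     ((rho ^+ k / A) ^+ 3)^-1 * (theta ^+ k * A ^+ 2 * Q / A ^+ 6 + 3 * Q ^+ 2 * theta ^+ k / A ^+ 4).
    by rewrite xk; field; rewrite !gt_eqF.
  rewrite lerD2l; apply: ler_wpM2l.
    by rewrite invr_ge0 exprn_ge0// divr_ge0// ltW.
  have th k' : 0 <= theta ^+ k' by rewrite exprn_ge0// ltW.
  apply: lerD.
    apply: ler_pM; rewrite ?invr_ge0 ?exprn_ge0//.
      by apply: mulr_ge0 => //; exact: sqr_ge0.
    by rewrite ler_wpM2r.
  apply: ler_pM; rewrite ?invr_ge0 ?exprn_ge0//.
    by apply: mulr_ge0; [rewrite mulr_ge0// sqr_ge0|rewrite invr_ge0].
  by rewrite ler_wpM2l// mulr_ge0// sqr_ge0.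
rewrite natrX -/A.
have sums : \sum_(k < (K n).+1) (s n k + (s n k ^+ 3)^-1 *
    ((b ^+ K n) ^+ 2 * Q / n%:R ^+ 3 + 3 * Q ^+ 2 / (2 ^ k)%:R / n%:R ^+ 2)) <=
    A^-1 * ((1 - rho)^-1 + (Q + 3 * Q ^+ 2) * (1 - x)^-1).
  apply: (@le_trans _ _ (\sum_(k < (K n).+1) A^-1 * (rho ^+ k + (Q + 3 * Q ^+ 2) * x ^+ k))).
    by apply: ler_sum => k _; apply: term; rewrite -ltnS.
  rewrite -mulr_sumr; apply: ler_wpM2l; first by rewrite invr_ge0 ltW.
  rewrite big_split -mulr_sumr; apply: lerD; first by rewrite geometric_sum_le// ltW.
  by apply: ler_wpM2l => //; exact: geometric_sum_le.
have -> : A^-1 * C0 = 4 * (A^-1 * ((1 - rho)^-1 + (Q + 3 * Q ^+ 2) * (1 - x)^-1) + 2 * (Mp / A)) + 2 * (Q / A).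
  by rewrite /C0; ring.
by rewrite lerD2r; apply: ler_wpM2l => //; apply: lerD => //; exact: ler_wpM2l.
Qed.
End rate.

(** * Sampling from a density *)

Section density_integral.
Local Open Scope ereal_scope.
Context d (T : measurableType d) (R : realType).
Variables (m nu : {measure set T -> \bar R}) (g : T -> \bar R).
Hypothesis gfin : forall x, g x \is a fin_num.
Hypotheses (mg : measurable_fun [set: T] g) (g0 : forall x, 0 <= g x).
Hypothesis nuE : forall A, measurable A -> nu A = \int[m]_(x in A) g x.

Import HBNNSimple.

Let integral_density_nnsfun (h : {nnsfun T >-> R}) :
  \int[nu]_x (h x)%:E = \int[m]_x ((h x)%:E * g x).
Proof.
have indic E : measurable E -> \int[nu]_x (\1_E x)%:E = \int[m]_x ((\1_E x)%:E * g x).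
  move=> mE; rewrite integral_indic// setIT nuE// integral_mkcond.
  by apply: eq_integral => x _; rewrite epatch_indic muleC.
have mh r : measurable (h @^-1` [set r]) by [].
under eq_integral do rewrite fimfunE -fsumEFin//.
rewrite ge0_integral_fsum//; last 2 first.
  - by move=> r; exact/measurable_EFinP/measurableT_comp.
  - by move=> r x _; rewrite nnfun_muleindic_ge0.
under [RHS]eq_integral.
  move=> x _; rewrite fimfunE -fsumEFin// ge0_mule_fsuml; last first.
    by move=> r; exact: nnfun_muleindic_ge0.
  over.
rewrite ge0_integral_fsum//; last 2 first.
  - by move=> r; apply: emeasurable_funM => //; exact/measurable_EFinP/measurableT_comp.
  - by move=> r x _; rewrite mule_ge0// nnfun_muleindic_ge0.
apply: eq_fsbigr => r; rewrite inE => -[t _ <-].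
rewrite integralZl_indic_nnsfun// indic//.
under [RHS]eq_integral do rewrite EFinM -muleA.
rewrite ge0_integralZl//.
- by apply: emeasurable_funM => //; exact/measurable_EFinP.
- by move=> x _; rewrite mule_ge0// lee_fin.
- by rewrite lee_fin.
Qed.

(** Holds on indicators by [nuE], on simple functions by linearity, and in general by monotone
    convergence on both sides. *)
Lemma ge0_integral_density (f : T -> \bar R) : measurable_fun [set: T] f ->
  (forall x, 0 <= f x) -> \int[nu]_x f x = \int[m]_x (f x * g x).
Proof.
move=> mf f0; pose f_ := nnsfun_approx measurableT mf.
have fcvg x : (f_ n x)%:E @[n --> \oo] --> f x.
  by apply: (cvg_nnsfun_approx measurableT mf) => // y _; exact: f0.
have fnd x : {homo (fun n => (f_ n x)%:E) : a b / (a <= b)%N >-> a <= b}.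
  by move=> a b ab; rewrite lee_fin; exact/lefP/nd_nnsfun_approx.
transitivity (limn (fun n => \int[nu]_x (f_ n x)%:E)).
  rewrite -monotone_convergence//=.
  - by apply: eq_integral => x _; apply/esym/cvg_lim => //; exact: fcvg.
  - by move=> n; apply/measurable_EFinP.
  - by move=> n x _; rewrite lee_fin.
transitivity (limn (fun n => \int[m]_x ((f_ n x)%:E * g x))); last first.
  rewrite -monotone_convergence//=.
  - apply: eq_integral => x _; apply/cvg_lim => //; exact: cvgeZr.
  - by move=> n; apply: emeasurable_funM => //; exact/measurable_EFinP.
  - by move=> n x _; rewrite mule_ge0// lee_fin.
  - by move=> x _ a b ab; rewrite lee_wpmul2r//; exact: fnd.
by congr (limn _); apply/funext => n; rewrite integral_density_nnsfun.
Qed.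
End density_integral.

Lemma ge0_integral_comp_density d d' (Omega : measurableType d) (T : measurableType d')
    (R : realType) (P : {measure set Omega -> \bar R}) (m : {measure set T -> \bar R})
    (Y : Omega -> T) (mY : measurable_fun [set: Omega] Y) (g : T -> \bar R) :
  (forall x, g x \is a fin_num) -> measurable_fun [set: T] g -> (forall x, 0 <= g x)%E ->
  (forall A, measurable A -> P (Y @^-1` A) = \int[m]_(x in A) g x)%E ->
  forall f : T -> \bar R, measurable_fun [set: T] f -> (forall x, 0 <= f x)%E ->
  (\int[P]_w (f \o Y) w = \int[m]_x (f x * g x))%E.
Proof.
move=> gfin mg g0 PY f mf f0.
pose mixin := isMeasurableFun.Build _ _ _ _ _ mY.
pose Y' : {mfun _ >-> _} := HB.pack Y mixin.
rewrite -(@ge0_integral_density _ _ _ m (pushforward P Y') g)//.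
by rewrite [RHS](ge0_integral_pushforward mY)// => x _; exact: f0.
Qed.

Section sampling_density.
Context d (T : measurableType d) (R : realType) (P : probability T R).
Variables (a : R) (g0 : R -> R) (Y : {RV P >-> R}).
Hypotheses (g0_density : prob_density_on a g0) (g0_noninc : nonincreasing_on a g0).
Hypothesis Yg0 : has_density_on a g0 Y.
Local Notation E f := (\int[P]_w f w).
Local Notation D := (`[a, +oo[%classic : set R).
Local Notation leb := (@lebesgue_measure R).

Let aD x : D x = (a <= x) :> Prop. Proof. by rewrite /= in_itv /= andbT. Qed.
Let mY : measurable_fun [set: T] Y. Proof. by []. Qed.

Let g0_ge0 x : a <= x -> 0 <= g0 x.
Proof. by move=> ax; apply: ltW; apply: (proj1 g0_density). Qed.

(** Extending [f] to the left of [a] by the constant [f a] gives a function monotone on the whole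
    line. *)
Lemma nonincreasing_on_measurable (f : R -> R) : nonincreasing_on a f -> measurable_fun D f.
Proof.
move=> fa; apply: (@eq_measurable_fun _ _ _ _ D (fun x => f (Num.max a x))).
  by move=> x; rewrite inE aD => ax; rewrite max_r.
apply: nonincreasing_measurable => // x y xy; apply: fa; first by rewrite le_max lexx.
by rewrite ge_max !le_max lexx /= xy orbT.
Qed.

Lemma measurable_density : measurable_fun D g0.
Proof. exact: nonincreasing_on_measurable. Qed.

Lemma ge0_E_density (u : R -> R) : measurable_fun D u -> (forall x, a <= x -> 0 <= u x) ->
  (\int[P]_w (u (Y w))%:E = \int[leb]_(x in D) (u x * g0 x)%:E)%E.
Proof.
(* Values to the left of [a] are arbitrary, so both functions are first set to [0] there. *)
move=> mu u0; pose u' := u \_ D; pose g := g0 \_ D.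
have mu' : measurable_fun [set: R] u' by apply/(measurable_restrictT u).
have mg : measurable_fun [set: R] g.
  by apply/(measurable_restrictT g0) => //; exact: measurable_density.
have u'0 x : 0 <= u' x.
  by rewrite /u' patchE; case: ifPn => //; rewrite inE aD; exact: u0.
have gge0 x : 0 <= g x.
  by rewrite /g patchE; case: ifPn => //; rewrite inE aD; exact: g0_ge0.
transitivity (\int[P]_w ((EFin \o u') \o Y) w)%E.
  apply: eq_integral => w _ /=; rewrite /u' patchE mem_set// aD.
  exact: (proj1 Yg0).
have mu'E : measurable_fun [set: R] (EFin \o u') by exact/measurable_EFinP.
have u'E x : (0 <= (EFin \o u') x)%E by rewrite lee_fin.
have mgE : measurable_fun [set: R] (EFin \o g) by exact/measurable_EFinP.
have gE x : (0 <= (EFin \o g) x)%E by rewrite lee_fin.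
have nuE A : measurable A -> (P (Y @^-1` A) = \int[leb]_(x in A) (EFin \o g) x)%E.
  move=> mA; rewrite [LHS](proj2 Yg0)// integral_mkcondr; apply: eq_integral => x _.
  by rewrite /= /g !patchE; case: ifP.
have -> : (\int[P]_w ((EFin \o u') \o Y) w = \int[leb]_x ((EFin \o u') x * (EFin \o g) x))%E.
  exact: (@ge0_integral_comp_density _ _ T (measurableTypeR R) R P leb Y mY (EFin \o g)).
rewrite [RHS]integral_mkcond; apply: eq_integral => x _ /=.
rewrite -EFinM [RHS]patchE /u' /g !patchE; case: ifPn => // _; by rewrite mul0r.
Qed.

(** Positive and negative parts are compared separately, so no integrability of [u] is required. *)
Lemma expect_g0E (u : R -> R) : measurable_fun D u ->
  expect_g0 a g0 u = E (fun w => u (Y w)).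
Proof.
move=> mu; rewrite /expect_g0 /Rintegral; congr fine.
rewrite integralE [RHS]integralE.
have mup : measurable_fun D (fun x => Num.max (u x) 0) by exact: measurable_maxr.
have mun : measurable_fun D (fun x => Num.max (- u x) 0).
  by apply: measurable_maxr => //; exact: measurable_funN.
congr (_ - _)%E.
- under [RHS]eq_integral do rewrite funeposE /= -EFin_max.
  rewrite (ge0_E_density mup); last by move=> x _; rewrite le_max lexx orbT.
  apply: eq_integral => x; rewrite inE aD => /g0_ge0 gx.
  by rewrite funeposE /= -EFin_max -{1}[0](mul0r (g0 x)) maxr_pMl.
- under [RHS]eq_integral do rewrite funenegE /= -EFin_max.
  rewrite (ge0_E_density mun); last by move=> x _; rewrite le_max lexx orbT.
  apply: eq_integral => x; rewrite inE aD => /g0_ge0 gx.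
  by rewrite funenegE /= -EFin_max -mulNr -{1}[0](mul0r (g0 x)) maxr_pMl.
Qed.

Lemma integ_norm_g0 p (h : R -> R) : 0 < p -> measurable_fun D h ->
  (norm_g0 a g0 p h < +oo)%E -> integ P (fun w => `|h (Y w)| `^ p).
Proof.
move=> p0 mh hp.
have mhp : measurable_fun D (fun x => `|h x| `^ p).
  by apply: (measurableT_comp (measurable_powR p)); exact: measurableT_comp.
apply/integrableP; split.
  apply/measurable_EFinP.
  rewrite (_ : (fun w => _) = (fun x => `|(h \_ D) x| `^ p) \o Y); last first.
    apply/funext => w /=; rewrite patchE mem_set// aD; exact: (proj1 Yg0).
  apply: measurableT_comp => //.
  have mh' : measurable_fun [set: R] (h \_ D) by apply/(measurable_restrictT h).
  apply: (measurableT_comp (measurable_powR p)).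
  exact: measurableT_comp.
under eq_integral do rewrite /= ger0_norm ?powR_ge0//.
rewrite (ge0_E_density mhp); last by move=> x _; exact: powR_ge0.
move: hp; rewrite /norm_g0; set I := integral _ _ _ => hp.
rewrite ltey; apply/eqP => Iy; move: hp; rewrite Iy poweRyr ?ltxx//.
by rewrite invr_eq0 gt_eqF.
Qed.

End sampling_density.

(** * Quantiles of the weighted law *)

Section quantiles.
Context d (T : measurableType d) (R : realType) (P : probability T R).
Variables (a : R) (g0 : R -> R) (X : nat -> {RV P >-> R}).
Hypotheses (g0_density : prob_density_on a g0) (g0_noninc : nonincreasing_on a g0).
Hypothesis Xg0 : has_density_on a g0 (X 0%N).
Local Notation E f := (\int[P]_w f w).
Local Notation D := (`[a, +oo[%classic : set R).
Local Notation leb := (@lebesgue_measure R).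
Local Notation Y := (X 0%N).
Variable phi : R -> R.
Hypotheses (mphi : measurable_fun [set: R] phi) (phi2 : integ P (fun w => phi (Y w) ^+ 2)).

Let psi x := (1 + phi x ^+ 2) * g0 x.
Let Q := E (fun w => 1 + phi (Y w) ^+ 2).
(** The mass on [[a, b]] of the sampling law weighted by [1 + phi ^ 2]. As a Lebesgue integral with
    variable endpoint it is continuous, so every level below the total mass [Q] is attained
    exactly. *)
Let F b := parameterized_integral leb a b psi.

Let aD x : D x = (a <= x) :> Prop. Proof. by rewrite /= in_itv /= andbT. Qed.

Let m1phi : measurable_fun [set: R] (fun x => 1 + phi x ^+ 2).
Proof. by apply: measurable_funD => //; exact: measurable_funX. Qed.

Let mpsi : measurable_fun D psi.
Proof.
apply: measurable_funM; first exact: measurable_funTS.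
exact: (measurable_density g0_noninc).
Qed.

Let one_phi_ge0 x : 0 <= 1 + phi x ^+ 2. Proof. by rewrite addr_ge0// sqr_ge0. Qed.

Let psi0 x : a <= x -> 0 <= psi x.
Proof. by move=> ax; rewrite mulr_ge0//; apply/ltW/(proj1 g0_density). Qed.

Let integ1phi : integ P (fun w => 1 + phi (Y w) ^+ 2).
Proof. by have [] := integD (integ_cst P 1) phi2. Qed.

Let EpsiD : (\int[leb]_(x in D) (psi x)%:E = Q%:E)%E.
Proof.
rewrite -(ge0_E_density g0_density g0_noninc Xg0 (u := fun x => 1 + phi x ^+ 2))//.
  exact: integral_EFin.
exact: measurable_funTS.
Qed.

Let integrable_psi : leb.-integrable D (EFin \o psi).
Proof.
apply/integrableP; split; first exact/measurable_EFinP.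
under eq_integral => x; first rewrite inE aD => ax.
  rewrite /= ger0_norm; last exact: psi0.
  over.
by rewrite EpsiD ltry.
Qed.

Let Q1 : 1 <= Q.
Proof.
rewrite -[leLHS](E_cst P); apply: integ_le => //; first exact: integ_cst.
by move=> w; rewrite lerDl sqr_ge0.
Qed.

Let mge b : measurable_fun [set: R] (fun x => (b <= x)%R%:R : R).
Proof.
rewrite (_ : (fun x => _) = \1_(`[b, +oo[%classic)); first exact: measurable_indic.
apply/funext => x; rewrite indicE; congr (_%:R); congr nat_of_bool.
by apply/idP/idP; rewrite inE /= in_itv /= andbT.
Qed.

Let integ_tail b : integ P (fun w => (1 + phi (Y w) ^+ 2) * (b <= Y w)%R%:R).
Proof.
apply: integ_dominated integ1phi _.
  exact: (measurableT_comp (measurable_funM m1phi (mge b)) (@measurable_funPT _ _ _ _ Y)).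
by move=> w; rewrite ger0_norm ?mulr_ge0//; case: (b <= _); rewrite ?mulr1 ?mulr0.
Qed.

Let tailE b : a <= b -> E (fun w => (1 + phi (Y w) ^+ 2) * (b <= Y w)%R%:R) = Q - F b.
Proof.
move=> ab.
have mu : measurable_fun D (fun x => (1 + phi x ^+ 2) * (b <= x)%R%:R).
  by apply: measurable_funTS; exact: measurable_funM.
rewrite -(expect_g0E g0_density g0_noninc Xg0 mu) /expect_g0.
have -> : Q = \int[leb]_(x in D) psi x by rewrite /Rintegral EpsiD.
rewrite /F /parameterized_integral Rintegral_itvB ?bnd_simp//.
rewrite Rintegral_itv_obnd_cbnd; last first.
  by apply: integrableS integrable_psi => //; apply: subset_itvr; rewrite bnd_simp.
have -> : `[b, +oo[%classic = D `&` `[b, +oo[%classic.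
  apply/seteqP; split => x /=; rewrite !in_itv /= !andbT; last by case.
  by move=> bx; split => //; exact: le_trans bx.
rewrite Rintegral_mkcondr; apply: eq_Rintegral => x _; rewrite patchE /psi.
case: (boolP (b <= x)) => bx; last first.
  by rewrite memNset ?mulr0 ?mul0r//= in_itv /= andbT; exact/negP.
by rewrite mem_set ?mulr1//= in_itv /= andbT.
Qed.

Let F_cont b : {within `[a, b], continuous F}.
Proof.
case: (leP a b) => ab.
  apply: parameterized_integral_continuous => //.
  by apply: integrableS integrable_psi => //; exact: subset_itvl.
rewrite set_itv_ge ?bnd_simp -?ltNge//; exact: continuous_subspace0.
Qed.

Let F_le b c : a <= b -> b <= c -> F b <= F c.
Proof.
move=> ab bc; have ac := le_trans ab bc.
have := tailE ab; have := tailE ac.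
suff : E (fun w => (1 + phi (Y w) ^+ 2) * (c <= Y w)%R%:R) <=
       E (fun w => (1 + phi (Y w) ^+ 2) * (b <= Y w)%R%:R) by lra.
apply: integ_le => // w; rewrite ler_wpM2l// ler_nat.
by case: (leP c (Y w)) => // cY; rewrite (le_trans bc cY).
Qed.

(** The intervals [[a, a + n]] exhaust the half-line, so their masses increase to [Q]. *)
Let F_exceeds v : v < Q -> exists2 b, a <= b & v < F b.
Proof.
move=> vQ; pose A n := `[a, a + n%:R]%classic : set R.
have AD n : A n `<=` D by apply: subset_itvl; rewrite bnd_simp.
have ndA : nondecreasing_seq A.
  move=> n m nm; rewrite subsetEset; apply: subset_itvl; rewrite bnd_simp.
  by rewrite lerD2l ler_nat.
have bA : \bigcup_n A n = D.
  apply/seteqP; split=> [x [n _] /AD//|x]; rewrite aD => ax.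
  exists (Num.truncn (x - a)).+1 => //; rewrite /A /= in_itv /= ax /= -lerBlDl.
  by rewrite ltW// truncnS_gt.
have : (\int[leb]_(x in A n) (psi x)%:E @[n --> \oo] --> Q%:E)%E.
  rewrite -EpsiD -bA; apply: ge0_nondecreasing_set_cvg_integral => //.
  - by move=> n; exact: measurable_itv.
  - by move=> n; apply/measurable_EFinP; exact: measurable_funS mpsi.
  - by move=> n x /AD; rewrite aD lee_fin => /psi0.
move=> /fine_cvg /cvgr_gt.
move=> /(_ _ vQ) [n _ /(_ n (leqnn n)) /= vn].
by exists (a + n%:R) => //; rewrite lerDl.
Qed.

Let F_a : F a = 0.
Proof. by rewrite /F /parameterized_integral set_itv1 Rintegral_set1. Qed.

Let F_onto v : 0 <= v -> v < Q -> exists2 b, a <= b & F b = v.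
Proof.
move=> v0 /F_exceeds[b ab vb].
have [|c cab Fc] := @IVT R F a b v ab (@F_cont b).
  by rewrite F_a ge_min v0 le_max (ltW vb) orbT.
by exists c => //; move: cab; rewrite in_itv => /andP[].
Qed.

Lemma quantile_gridP : exists Q, 0 <= Q /\ forall K, exists r, quantile_grid X a phi Q K r.
Proof.
have Q0 : 0 < Q by exact: lt_le_trans Q1.
exists Q; split => [|K]; first exact: ltW.
have pK : 0 < (2 ^ K)%:R :> R by rewrite ltr0n expn_gt0.
have N1 : (2 ^ K).-1.+1 = (2 ^ K)%N by rewrite prednK// expn_gt0.
pose lev i : R := Q * i%:R / (2 ^ K)%:R.
(* The point of index [0] is forced to be [a]; beyond the last cell [a] is only a default. *)
have /choice[r Hr] : forall i, exists x, [/\ a <= x, (i == 0%N -> x = a) & ((i < 2 ^ K)%N -> F x = lev i)].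
  move=> i; case: (posnP i) => [->|i0].
    by exists a; split => // _; rewrite F_a /lev mulr0 mul0r.
  case: (ltnP i (2 ^ K)) => iK; last by exists a; split.
  have [|b ab Fb] := @F_onto (lev i) (ltac:(by rewrite divr_ge0// mulr_ge0// ltW)).
    by rewrite /lev ltr_pdivrMr// ltr_pM2l// ltr_nat.
  by exists b; split => // /eqP i00; rewrite i00 in i0.
have rF i : (i <= (2 ^ K).-1)%N -> F (r i) = lev i.
  by move=> iK; have [_ _ h] := Hr i; rewrite h// -N1 ltnS.
have tE i : (i <= 2 ^ K)%N ->
    integ P (fun w => (1 + phi (Y w) ^+ 2) * tail (2 ^ K).-1 r i (Y w)) /\
    E (fun w => (1 + phi (Y w) ^+ 2) * tail (2 ^ K).-1 r i (Y w)) = Q - lev i.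
  move=> iK; case: (leqP i (2 ^ K).-1) => iN.
    rewrite /tail iN /=; split; first exact: integ_tail.
    by rewrite tailE ?rF//; have [] := Hr i.
  (* At this index the tail is empty and the level is the full mass [Q]. *)
  have -> : i = (2 ^ K)%N by apply/eqP; rewrite eqn_leq iK -N1.
  rewrite /tail leqNgt -N1 ltnSn /= N1.
  have z : (fun w => (1 + phi (Y w) ^+ 2) * (0 : R)) = cst 0 by apply/funext => w; rewrite mulr0.
  rewrite z; split; first exact: integ_cst.
  by rewrite E_cst /lev mulfK ?subrr// gt_eqF.
exists r; split.
- by have [_ h _] := Hr 0%N; exact: h.
- move=> i j; rewrite leq_eqVlt => /predU1P[->//|ij] jN.
  (* A reversed pair of grid points would reverse the levels, which strictly increase because
     [Q > 0]. *)
  rewrite leNgt; apply/negP => rji; have [aj _ _] := Hr j.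
  have := F_le aj (ltW rji); rewrite !rF//; last by rewrite (leq_trans (ltnW ij)).
  by rewrite /lev ler_pM2r ?invr_gt0// ler_pM2l// ler_nat leqNgt ij.
- move=> i j ij jK; have [Ii Ei] := tE i (leq_trans ij jK); have [Ij Ej] := tE j jK.
  under eq_Rintegral do rewrite mulrBr.
  rewrite RintegralB//; rewrite [X in X - _]Ei [X in _ - X]Ej natrB// /lev.
  by rewrite le_eqVlt; apply/orP; left; apply/eqP; ring.
Qed.
End quantiles.

(** * Minimal measurable majorants *)

(** [contract] is an increasing bijection onto [[-1, 1]], so preimages of half-lines are half-lines,
    empty, or everything. *)
Lemma measurable_contract (R : realType) : measurable_fun [set: \bar R] (@contract R).
Proof.
apply: (measurability (@RGenCInfty.G R)) => [|/= _ [_] [r] -> <-].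
  exact: RGenCInfty.measurableE.
rewrite setTI.
case: (ltP 1 r) => r1.
  rewrite (_ : _ @^-1` _ = set0)//; apply/seteqP; split => // x /=; rewrite in_itv /= andbT => rx.
  have := contract_le1 x; rewrite ler_norml => /andP[_ x1].
  by have := lt_le_trans r1 (le_trans rx x1); rewrite ltxx.
case: (ltP r (-1)) => rN1.
  rewrite (_ : _ @^-1` _ = setT)//; apply/seteqP; split => // x _ /=; rewrite in_itv /= andbT.
  by have := contract_le1 x; rewrite ler_norml => /andP[x1 _]; rewrite ltW// (lt_le_trans rN1).
rewrite (_ : _ @^-1` _ = [set` `[expand r, +oo[%O]); first exact: emeasurable_itv.
apply/seteqP; split => x /=; rewrite !in_itv /= !andbT -[in X in (X <= contract _)](@expandK _ r) ?inE ?ler_norml ?rN1//=;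
  by rewrite le_contract.
Qed.

Section minimal_majorant.
Context d (T : measurableType d) (R : realType) (P : probability T R).
Local Notation E f := (\int[P]_w f w).

Let bcontract (V : T -> \bar R) : measurable_fun [set: T] V ->
  bounded_measurable (fun w => contract (V w)).
Proof.
move=> mV; split; last by exists 1 => w; exact: contract_le1.
exact: (measurableT_comp (@measurable_contract R) mV).
Qed.

(* The majorant is the infimum of a sequence of measurable majorants minimising
   the expectation of [contract]. *)
Lemma min_measurable_majorant_exists (Z : T -> \bar R) :
  exists U, min_measurable_majorant P Z U.
Proof.
pose maj := [set V : T -> \bar R | measurable_fun [set: T] V /\ forall w, (Z w <= V w)%E].
pose c (V : T -> \bar R) := E (fun w => contract (V w)).
have majy : maj (cst +oo%E) by split => // w; rewrite leey.
pose S := c @` maj.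
have S0 : S !=set0 by exists (c (cst +oo%E)); exists (cst +oo%E).
have lbS : has_lbound S.
  exists (-1) => _ [V [mV _] <-]; have bV := bcontract mV.
  have := bmeas_E_norm P bV (fun w => contract_le1 (V w)).
  by rewrite ler_norml => /andP[].
have hS : has_inf S by [].
have /choice[V HV] : forall k : nat, exists V, maj V /\ c V < inf S + k.+1%:R^-1.
  move=> k; have k0 : 0 < k.+1%:R^-1 :> R by rewrite invr_gt0 ltr0n.
  by have [_ [W mW <-] cW] := inf_adherent k0 hS; exists W.
pose U w := einfs (fun k => V k w) 0%N.
have mU : measurable_fun [set: T] U.
  by apply: measurable_fun_einfs => k; have [[]] := HV k.
have UV k w : (U w <= V k w)%E by apply: ereal_inf_lbound; exists k.
have ZU w : (Z w <= U w)%E.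
  by apply: le_ereal_inf_tmp => _ [k _ <-]; have [[_]] := HV k.
have cU : c U <= inf S.
  apply/ler_addgt0Pr => e e0.
  pose k := Num.truncn e^-1.
  have ke : k.+1%:R^-1 <= e.
    by rewrite invf_ple ?posrE// ltW// truncnS_gt.
  have [[mVk _] cVk] := HV k.
  apply: (@le_trans _ _ (c (V k))); last by rewrite (le_trans (ltW cVk))// lerD2l.
  apply: bmeas_E_le; [exact: bcontract|exact: bcontract|].
  by move=> w; rewrite le_contract.
exists U; split => // W mW [N [mN PN0 NZ]].
(* Raised to [+oo] on the null set, an almost sure majorant becomes a genuine one. Its minimum with
   [U] then competes in the infimum and cannot have smaller mean, hence equals [U] almost surely. *)
pose W' w := if w \in N then +oo%E else W w.
pose M w := mine (U w) (W' w).
have mW' : measurable_fun [set: T] W'.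
  apply: measurable_fun_if => //; last by apply: measurable_funTS.
  apply: (measurable_fun_bool true); rewrite setTI (_ : _ @^-1` _ = N)//.
  by apply/seteqP; split => w /=; rewrite ?inE => h; [apply/set_mem|exact/mem_set].
have mM : measurable_fun [set: T] M by exact: measurable_mine.
have majM : maj M.
  split => // w; rewrite le_min ZU /= /W'; case: ifPn => [_|wN]; first exact: leey.
  apply: contrapT => h; move: wN; rewrite mem_set//; exact: NZ.
have cM : inf S <= c M by apply: inf_lbound => //; exists M.
have bd : bounded_measurable (fun w => contract (U w) + (-1) * contract (M w)).
  by apply: bmeasD; [exact: bcontract|apply: bmeasM; [exact: bmeas_cst|exact: bcontract]].
have d0 w : 0 <= contract (U w) + -1 * contract (M w).
  by rewrite mulN1r subr_ge0 le_contract ge_min lexx.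
have Ed : E (fun w => contract (U w) + -1 * contract (M w)) = 0.
  apply/eqP; rewrite eq_le; apply/andP; split; last by apply: Rintegral_ge0 => w _.
  rewrite bmeas_ED; [|exact: bcontract|apply: bmeasM; [exact: bmeas_cst|exact: bcontract]].
  rewrite bmeas_EZ; last exact: bcontract.
  by rewrite mulN1r subr_le0 (le_trans cU cM).
have : ae_eq P setT (EFin \o (fun w => contract (U w) + -1 * contract (M w))) (cst 0%E).
  apply/ae_eq_integral_abs => //; first by apply/measurable_EFinP; case: bd.
  under eq_integral do rewrite /= ger0_norm//.
  rewrite integral_EFin; last exact: bmeas_integrable.
  by rewrite Ed.
have Nnull : P.-negligible N by exists N; split.
move=> [N' [mN' PN' HN']].
have : P.-negligible (N `|` N').
  by apply: negligibleU => //; exists N'; split.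
apply: negligibleS => w /= wUW; apply: contrapT => /not_orP [wN wN'].
apply: wUW.
have : contract (U w) + -1 * contract (M w) = 0.
  apply: contrapT => h; apply: wN'; apply: HN' => /= hh; apply: h.
  by have /= := hh I => -[].
rewrite mulN1r => /eqP; rewrite subr_eq0 => /eqP /contract_inj ->.
by rewrite /M /W' memNset// ge_min lexx orbT.
Qed.

End minimal_majorant.

(** * Almost sure convergence *)

(** Telescoping: [1 / (k + 1) ^ 2 <= 2 / ((k + 1) * (k + 2))]. *)
Lemma sum_inv_sqr_le (R : realType) (n : nat) :
  \sum_(k < n) (k.+1%:R ^+ 2)^-1 <= 2 * (1 - n.+1%:R^-1) :> R.
Proof.
elim: n => [|n IH]; first by rewrite big_ord0 invr1 subrr mulr0.
rewrite big_ord_recr /= (le_trans (lerD IH (lexx _)))//.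
have -> : 2 * (1 - n.+2%:R^-1) = 2 * (1 - n.+1%:R^-1) + 2 / (n.+1%:R * n.+2%:R) :> R.
  have -> : n.+2%:R = n.+1%:R + 1 :> R by rewrite -natr1.
  have : 0 < n.+1%:R :> R by rewrite ltr0n.
  by move: n.+1%:R => N N0; field; rewrite !gt_eqF// ?addr_gt0.
rewrite lerD2l -[leLHS]mul1r ler_pdivrMr ?exprn_gt0// mulrAC ler_pdivlMr ?mulr_gt0//.
by rewrite mul1r -natrX -!natrM ler_nat; nia.
Qed.

Lemma fourth_root (n : nat) : (0 < n)%N -> exists q, (q.+1 ^ 4 <= n < q.+2 ^ 4)%N.
Proof.
elim: n => // -[_ _|n IH _]; first by exists 0%N.
have [q /andP[q1 q2]] := IH erefl.
case: (leqP (q.+2 ^ 4) n.+2) => h; last by exists q; rewrite (leq_trans q1)//= ltnS.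
exists q.+1; rewrite h /=; apply: leq_ltn_trans q2 _; rewrite ltn_exp2r//.
Qed.

(** For [p = (k + 1) ^ 4], [r = (k + 2) ^ 4] and [t = 1 / (k + 1)]: the sums at [p] and [r] enclose
    the one at [n]. As [t <= 1], [(1 + t) ^ 4 <= 1 + 15 * t], which gives [r - p <= 15 * n * t] and
    [r <= 16 * n]. *)
Lemma interpolate_bound (R : realType) (p r n x1 x x2 m B c f f' t : R) :
  0 <= p -> 0 <= B -> 0 <= f -> 0 <= f' -> x1 <= x -> x <= x2 ->
  `|x1 - p * m| <= p * (B * f) -> `|x2 - r * m| <= r * (B * f') ->
  p <= n -> n <= r -> 0 <= m <= B * c -> 0 < t <= 1 -> r = p * (1 + t) ^+ 4 ->
  `|x - n * m| <= n * (B * (15 * c * t + 16 * f' + f)).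
Proof.
move=> p0 B0 f0 f'0 x1x xx2 h1 h2 pn nr /andP[m0 mB] /andP[t0 t1] rE.
have t4 : (1 + t) ^+ 4 <= 1 + 15 * t.
  have tt : t ^+ 2 <= t by rewrite expr2 ler_piMr// ltW.
  have ttt : t ^+ 3 <= t by rewrite exprS; apply: ler_piMr; [exact: ltW|apply: exprn_ile1 => //; exact: ltW].
  have tttt : t ^+ 4 <= t by rewrite exprS; apply: ler_piMr; [exact: ltW|apply: exprn_ile1 => //; exact: ltW].
  have -> : (1 + t) ^+ 4 = 1 + 4 * t + 6 * t ^+ 2 + 4 * t ^+ 3 + t ^+ 4 by ring.
  lra.
have rp : r - p <= 15 * (n * t).
  rewrite rE; apply: (@le_trans _ _ (p * (15 * t))).
    by rewrite -{2}[p]mulr1 -mulrBr ler_wpM2l// lerBlDl.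
  by rewrite mulrCA ler_wpM2l// ler_wpM2r// ltW.
have r16 : r <= 16 * n.
  rewrite rE mulrC ler_pM//; first by rewrite exprn_ge0// addr_ge0// ltW.
  by apply: le_trans t4 _; lra.
have n0 : 0 <= n by exact: le_trans pn.
have b1 : (r - p) * m <= 15 * (n * t) * (B * c).
  by apply: ler_pM => //; rewrite subr_ge0 (le_trans pn).
have b2 : r * (B * f') <= 16 * n * (B * f') by rewrite ler_wpM2r// mulr_ge0.
have b3 : p * (B * f) <= n * (B * f) by rewrite ler_wpM2r// mulr_ge0.
have b4 : 0 <= n * (B * f) by rewrite !mulr_ge0.
have b5 : 0 <= 16 * n * (B * f') by rewrite !mulr_ge0.
have b6 : (r - n) * m <= (r - p) * m by rewrite ler_wpM2r// lerD2l lerN2.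
have b7 : (n - p) * m <= (r - p) * m by rewrite ler_wpM2r// lerD2r.
have -> : n * (B * (15 * c * t + 16 * f' + f)) =
  15 * (n * t) * (B * c) + 16 * n * (B * f') + n * (B * f) by ring.
move: h1 h2 b6 b7 b1; rewrite !ler_norml !mulrBl => /andP[? ?] /andP[? ?] ? ? ?.
apply/andP; split; lra.
Qed.

Section almost_sure.
Context d (T : measurableType d) (R : realType) (P : probability T R).
Local Notation E f := (\int[P]_w f w).

(** The series of the [f k] has finite expectation, so it converges almost surely and its terms
    vanish. *)
Lemma summable_E_cvg0 (f : nat -> T -> R) (c : R) :
  (forall k, integ P (f k)) -> (forall k w, 0 <= f k w) ->
  (forall n, \sum_(k < n) E (f k) <= c) ->
  \forall w \ae P, f k w @[k --> \oo] --> (0 : R).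
Proof.
move=> If f0 Ec.
have mf k : measurable_fun [set: T] (fun w => (f k w)%:E) by case/integrableP: (If k).
have S : (\int[P]_w (\sum_(0 <= k <oo) (f k w)%:E) <= c%:E)%E.
  rewrite integral_nneseries//; last by move=> k w _; rewrite lee_fin.
  apply: lime_le.
    by apply: is_cvg_nneseries => k _ _; apply: integral_ge0 => w _; rewrite lee_fin.
  apply: nearW => n; rewrite big_mkord.
  rewrite (eq_bigr (fun k : 'I_n => (E (f k))%:E)); last by move=> k _; rewrite integral_EFin.
  rewrite sumEFin lee_fin; exact: Ec.
have IS : P.-integrable setT (fun w => \sum_(0 <= k <oo) (f k w)%:E)%E.
  apply/integrableP; split.
    by apply: ge0_emeasurable_sum => // k w _ _; rewrite lee_fin.
  under eq_integral => w _.
    rewrite gee0_abs; last by apply: nneseries_ge0 => k _ _; rewrite lee_fin.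
    over.
  by rewrite (le_lt_trans S)// ltry.
have := integrable_ae measurableT IS.
apply: filterS => w /(_ I) fin.
apply: cvg_series_cvg_0; apply: nondecreasing_is_cvgn.
  by apply/nondecreasing_seqP => n; rewrite /series /= big_nat_recr//= lerDl.
exists (fine (\sum_(0 <= k <oo) (f k w)%:E)%E) => _ [n _ <-].
rewrite -lee_fin fineK// /series /= -sumEFin.
by apply: nneseries_lim_ge => k _ _; rewrite lee_fin.
Qed.

Variable X : nat -> {RV P >-> R}.
Variable a : R.
Hypothesis aX : forall i w, a <= X i w.
Variable phi : R -> R.
Hypotheses (phi0 : forall x, 0 <= phi x) (phi1 : integ P (fun w => phi (X 0%N w))).
Local Notation dev := (emp_dev X).

(** Restricted to [L >= 0], which makes the partial sums over the sample monotone. *)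
Definition deviation_control n (D : T -> R) := forall w B (L W : R -> R),
  variation_bound a B L W -> (forall x, a <= x -> 0 <= L x) ->
  integ P (fun w => phi (X 0%N w) * L (X 0%N w)) ->
  `|dev n (fun x => phi x * L x) w| <= B * D w.

(** The bounds [D n] are shown to vanish almost surely only along fourth powers; [S n] combines
    those at the two fourth powers around [n]. *)
Lemma uniform_slln (D : nat -> T -> R) (C : R) :
  (forall n, (0 < n)%N -> [/\ integ P (D n), forall w, 0 <= D n w,
     E (D n) <= C / Num.sqrt n%:R & deviation_control n (D n)]) ->
  exists S : nat -> T -> R, [/\ forall n, measurable_fun [set: T] (S n),
    forall n w, 0 <= S n w, \forall w \ae P, S n w @[n --> \oo] --> (0 : R) &
    forall n, (0 < n)%N -> deviation_control n (S n)].
Proof.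
move=> HD.
have /choice[q Hq] : forall n, exists q, (0 < n)%N -> (q.+1 ^ 4 <= n < q.+2 ^ 4)%N.
  by move=> n; case: (posnP n) => [->|/fourth_root[q ?]]; [exists 0%N|exists q].
pose f k := D (k.+1 ^ 4)%N.
pose c := E (fun w => phi (X 0%N w)).
pose s k w := 15 * c * k.+1%:R^-1 + 16 * f k.+1 w + f k w.
have k0 k : (0 < k.+1 ^ 4)%N by rewrite expn_gt0.
have c0 : 0 <= c by apply: Rintegral_ge0 => w _.
have f0 k w : 0 <= f k w by have [_ D0 _ _] := HD _ (k0 k); exact: D0.
have If k : integ P (f k) by have [? _ _ _] := HD _ (k0 k).
exists (fun n => s (q n)); split.
- have mfk k : measurable_fun [set: T] (f k).
    by apply/measurable_EFinP; case/integrableP: (If k).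
  move=> n; apply: measurable_funD => //; apply: measurable_funD => //.
  exact: measurable_funM.
- by move=> n w; rewrite !addr_ge0// ?mulr_ge0.
- have C0 : 0 <= C.
    have [_ D0 + _] := HD 1%N erefl; rewrite sqrtr1 divr1; apply: le_trans.
    by apply: Rintegral_ge0 => w _.
  have : \forall w \ae P, f k w @[k --> \oo] --> (0 : R).
    apply: (@summable_E_cvg0 _ (C * 2)) => // n.
    apply: (@le_trans _ _ (\sum_(k < n) C * (k.+1%:R ^+ 2)^-1)).
      apply: ler_sum => k _; have [_ _ + _] := HD _ (k0 k).
      have -> : Num.sqrt (k.+1 ^ 4)%:R = k.+1%:R ^+ 2 :> R; last exact.
        by rewrite -[4%N]/(2 * 2)%N expnM natrX sqrtr_sqr ger0_norm ?ler0n// natrX.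
    rewrite -mulr_sumr ler_wpM2l// (le_trans (sum_inv_sqr_le _ _))//.
    by rewrite -[leRHS]mulr1 ler_wpM2l// lerBlDr lerDl invr_ge0.
  apply: filterS => w fw.
  have fw1 : f k.+1 w @[k --> \oo] --> (0 : R) by rewrite (cvg_shiftS (fun k => f k w)).
  have sw : s k w @[k --> \oo] --> (0 : R).
    rewrite (_ : 0 = 15 * c * 0 + 16 * 0 + 0); last by rewrite !mulr0 !addr0.
    apply: cvgD => //; apply: cvgD; apply: cvgMr => //; exact: cvg_harmonic.
  apply: (cvg_comp q (fun k => s k w)) sw.
  (* The index of the fourth power below [n] tends to infinity with [n]. *)
  move=> A [m _ Am]; exists ((m.+1) ^ 4)%N => // n /= mn; apply: Am => /=.
  have n0 : (0 < n)%N by rewrite (leq_trans _ mn)// expn_gt0.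
  have /andP[_ h] := Hq n n0.
  by have := leq_ltn_trans mn h; rewrite ltn_exp2r.
- move=> n n0 w B L W LW L0 IL; have /andP[qn nq] := Hq n n0.
  set k := q n in qn nq *.
  have B0 : 0 <= B by case: LW => LW1 _; apply: le_trans (normr_ge0 _) (LW1 _ (lexx a)).
  pose m := E (fun w => phi (X 0%N w) * L (X 0%N w)).
  pose Sg j := \sum_(i < j) phi (X i w) * L (X i w).
  have Sg_le i j : (i <= j)%N -> Sg i <= Sg j.
    move=> ij; rewrite /Sg (big_ord_widen j (fun i => phi (X i w) * L (X i w)))// big_mkcond.
    apply: ler_sum => l _; case: ifP => // _; apply: mulr_ge0 => //; exact: L0.
  have mB : 0 <= m <= B * c.
    apply/andP; split; first by apply: Rintegral_ge0 => w' _; rewrite mulr_ge0// L0.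
    rewrite -(proj2 (integZ B phi1)); apply: integ_le => //; first exact: (proj1 (integZ B phi1)).
    move=> w'; rewrite mulrC ler_wpM2r//; case: LW => LW1 _.
    by rewrite (le_trans (ler_norm _))// LW1.
  have devE j : (0 < j)%N -> `|Sg j - j%:R * m| <= j%:R * (B * D j w).
    move=> j0; have [_ _ _ /(_ w B L W LW L0 IL)] := HD j j0.
    rewrite /emp_dev /emp_mean -/(Sg j) -/m => h.
    have jR : 0 < j%:R :> R by rewrite ltr0n.
    rewrite -(ler_pM2l jR) in h; apply: le_trans h.
    by rewrite -{2}(ger0_norm (ltW jR)) -normrM mulrBr mulVKf ?gt_eqF.
  have := devE _ (k0 k); have := devE _ (k0 k.+1).
  have := Sg_le _ _ qn; have := Sg_le _ _ (ltnW nq).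
  have nR : 0 < n%:R :> R by rewrite ltr0n.
  rewrite /emp_dev /emp_mean -/(Sg n) -/m -/(f k w) -/(f k.+1 w).
  move=> xr px hr hp.
  have -> : n%:R^-1 * Sg n - m = n%:R^-1 * (Sg n - n%:R * m) by rewrite mulrBr mulKf// gt_eqF.
  rewrite normrM ger0_norm ?invr_ge0 ?ler0n// ler_pdivrMl//.
  have kR : 0 < (k.+1%:R^-1 : R) <= 1 by rewrite invr_gt0 ltr0n /= invf_le1 ?ltr0n// ler1n.
  apply: (interpolate_bound _ B0 (f0 k w) (f0 k.+1 w) px xr hp hr _ _ mB kR) => //.
  + by rewrite ler_nat.
  + by rewrite ler_nat ltnW.
  + have k1 : k.+1%:R != 0 :> R by rewrite pnatr_eq0.
    by rewrite !natrX -[k.+2%:R]natr1; field.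
Qed.

End almost_sure.

(** * The shape class *)

(** Young's inequality for [r ^ c] and [1] with conjugate exponents [1 / c] and [1 / (1 - c)]. *)
Lemma powR_Bernoulli (R : realType) (r c : R) : 0 <= r -> 0 < c < 1 ->
  r `^ c <= 1 + c * (r - 1).
Proof.
move=> r0 /andP[c0 c1]; have c1' : 0 < 1 - c by rewrite subr_gt0.
have := @conjugate_powR R (r `^ c) 1 c^-1 (1 - c)^-1 (powR_ge0 _ _) ler01.
rewrite !invrK mulr1 -powRrM mulfV ?gt_eqF// powRr1// powR1.
rewrite !invr_gt0 => /(_ c0 c1') h.
apply: le_trans (h _) _; first by ring.
by rewrite le_eqVlt; apply/orP; left; apply/eqP; ring.
Qed.

(** For [c < 1] this is Bernoulli's inequality, with constant [1 / c]; for [c >= 1], [r ^ c <= r]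
    and the constant [1] is enough. *)
Lemma one_sub_le_powR (R : realType) (r c : R) : 0 <= r <= 1 -> 0 < c ->
  1 - r <= Num.max 1 c^-1 * (1 - r `^ c).
Proof.
move=> /andP[r0 r1] c0.
have pow1 e : 0 <= e -> r `^ e <= 1.
  by move=> e0; have := ge0_ler_powR e0 r0 ler01 r1; rewrite powR1.
have rc1 := pow1 _ (ltW c0).
case: (ltP c 1) => c1.
  apply: (@le_trans _ _ (c^-1 * (1 - r `^ c))).
    rewrite ler_pdivlMl//; have := @powR_Bernoulli R r c r0; rewrite c0 c1 => /(_ isT).
    lra.
  by rewrite ler_wpM2r ?subr_ge0// le_max lexx orbT.
apply: (@le_trans _ _ (1 * (1 - r `^ c))); last first.
  by rewrite ler_wpM2r ?subr_ge0// le_max lexx.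
rewrite mul1r lerD2l lerN2.
case: (eqVneq r 0) => [->|rn0]; first by rewrite powR0// gt_eqF.
rewrite (_ : c = 1 + (c - 1)); last by ring.
rewrite powRD; last by rewrite rn0 implybT.
by rewrite powRr1// ler_piMr// pow1// subr_ge0.
Qed.

Section shape.
Variables (R : realType) (a M gamma : R) (g0 : R -> R).
Hypotheses (M0 : 0 < M) (gamma01 : 0 < gamma < 1).
Hypotheses (g00 : forall x, a <= x -> 0 < g0 x) (g0_noninc : nonincreasing_on a g0).

Let p : R := 1 / (1 - gamma).
Let k : R := gamma / (1 - gamma).
Let gam0 : 0 < gamma. Proof. by case/andP: gamma01. Qed.
Let gam1 : 0 < 1 - gamma. Proof. by case/andP: gamma01; rewrite subr_gt0. Qed.
Let k0 : 0 < k. Proof. by rewrite divr_gt0. Qed.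
Let p0 : 0 < p. Proof. by rewrite divr_gt0. Qed.
Let pk : p = 1 + k. Proof. by rewrite /p /k; field; rewrite gt_eqF. Qed.
Let c := Num.max 1 k^-1.
Let c1 : 1 <= c. Proof. by rewrite le_max lexx. Qed.
(** The sum of the two monotone functions that control the numerator and the denominator of
    [f / g0]. In [B], [f a] is replaced by its envelope, so the bound is common to the class. *)
Let W (f : R -> R) x := M / gamma * f x `^ gamma + M `^ p * c * g0 x `^ k.
Let B := M / gamma * ((M * g0 a) `^ p) `^ gamma + M `^ p * c * g0 a `^ k.

Lemma envelope_noninc x y : a <= x -> x <= y -> (M * g0 y) `^ p <= (M * g0 x) `^ p.
Proof.
move=> ax xy; have ay := le_trans ax xy.
have Mg z : a <= z -> 0 <= M * g0 z by move=> az; rewrite mulr_ge0 ?ltW ?g00.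
apply: (ge0_ler_powR (ltW p0) (Mg _ ay) (Mg _ ax)).
by rewrite ler_pM2l// g0_noninc.
Qed.

(** The envelope says exactly that [u ^ (1 - gamma) <= M * s], and concavity of the power [gamma]
    gives [gamma * (u - v) <= u ^ (1 - gamma) * (u ^ gamma - v ^ gamma)]: the division by [s] is
    absorbed. *)
Lemma powR_sub_le (u v s : R) : 0 <= v -> v <= u -> 0 < s -> u <= (M * s) `^ p ->
  (u - v) / s <= M / gamma * (u `^ gamma - v `^ gamma).
Proof.
move=> v0 vu s0 us; have u0 := le_trans v0 vu.
case: (eqVneq u 0) => [ueq|un0].
  have -> : v = 0 by apply/eqP; rewrite eq_le v0 andbT -ueq.
  by rewrite ueq subrr mul0r subrr mulr0.
have up : 0 < u by rewrite lt_neqAle eq_sym un0.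
have h1 : gamma * (u - v) <= u `^ (1 - gamma) * (u `^ gamma - v `^ gamma).
  have vE : v = u * (v / u) by rewrite mulrC divfK.
  have r0 : 0 <= v / u by rewrite divr_ge0.
  rewrite [in leRHS]vE powRM// -{1}[u `^ gamma]mulr1 -mulrBr mulrA.
  rewrite -powRD; last by rewrite un0 implybT.
  rewrite subrK powRr1// {1}vE -{1}[u]mulr1 -mulrBr mulrCA ler_wpM2l//.
  have := powR_Bernoulli r0 gamma01; lra.
have h2 : u `^ (1 - gamma) <= M * s.
  have Ms : 0 <= M * s by rewrite mulr_ge0// ltW.
  have := ge0_ler_powR (ltW gam1) u0 (powR_ge0 (M * s) p) us.
  by rewrite -powRrM /p div1r mulVf ?gt_eqF// powRr1.
have h3 : 0 <= u `^ gamma - v `^ gamma.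
  by rewrite subr_ge0 ge0_ler_powR// ltW.
rewrite ler_pdivrMr// -(ler_pM2l gam0) (le_trans h1)//.
apply: (@le_trans _ _ (M * s * (u `^ gamma - v `^ gamma))); first by rewrite ler_wpM2r.
by rewrite le_eqVlt; apply/orP; left; apply/eqP; field; rewrite gt_eqF.
Qed.

(** Replacing [v] by its envelope leaves [t ^ p * (1 / t - 1 / s) = t ^ k * (1 - t / s)], because
    [p = 1 + k]; then [1 - t / s] is compared with [1 - (t / s) ^ k]. *)
Lemma inv_sub_le (v s t : R) : 0 < t -> t <= s -> 0 <= v <= (M * t) `^ p ->
  v * (t^-1 - s^-1) <= M `^ p * c * (s `^ k - t `^ k).
Proof.
move=> t0 ts /andP[v0 vt]; have s0 := lt_le_trans t0 ts.
have st0 : 0 <= t^-1 - s^-1 by rewrite subr_ge0 lef_pV2.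
apply: (@le_trans _ _ ((M * t) `^ p * (t^-1 - s^-1))); first by rewrite ler_wpM2r.
have s0' := ltW s0; have t0' := ltW t0; have M0' := ltW M0.
rewrite powRM// -!mulrA ler_wpM2l ?powR_ge0//.
have tn0 : t != 0 by rewrite gt_eqF.
have sn0 : s != 0 by rewrite gt_eqF.
have -> : t `^ p * (t^-1 - s^-1) = t `^ k * (1 - t / s).
  rewrite pk powRD ?tn0 ?implybT// powRr1//; field; by rewrite tn0 sn0.
have r01 : 0 <= t / s <= 1 by rewrite divr_ge0//= ler_pdivrMr// mul1r.
apply: (@le_trans _ _ (s `^ k * (c * (1 - (t / s) `^ k)))).
  apply: ler_pM; rewrite ?powR_ge0//.
  - by rewrite subr_ge0; case/andP: r01.
  - exact: (ge0_ler_powR (ltW k0) t0' s0').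
  - exact: one_sub_le_powR.
have -> : t `^ k = s `^ k * (t / s) `^ k.
  by rewrite -powRM ?divr_ge0// mulrCA mulfV// mulr1.
by rewrite le_eqVlt; apply/orP; left; apply/eqP; ring.
Qed.

Lemma ratio_class_variation : exists B, forall L, ratio_class a M gamma g0 L ->
  [/\ exists W, variation_bound a B L W, forall x, a <= x -> 0 <= L x &
      measurable_fun `[a, +oo[ L].
Proof.
exists B => _ [f [fb fa] <-].
have f0 x : a <= x -> 0 <= f x by move=> /fb/andP[].
have fe x : a <= x -> f x <= (M * g0 x) `^ p by move=> /fb/andP[].
have g0k x y : a <= x -> x <= y -> g0 y `^ k <= g0 x `^ k.
  move=> ax xy; have ay := le_trans ax xy.
  by apply: (ge0_ler_powR (ltW k0) (ltW (g00 ay)) (ltW (g00 ax))); exact: g0_noninc.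
have g0' x : a <= x -> 0 <= g0 x by move=> /g00/ltW.
have M0' := ltW M0.
have Mp : 0 <= M `^ p by exact: powR_ge0.
have c0 : 0 <= c by exact: le_trans c1.
have Mg : 0 <= M / gamma by rewrite divr_ge0 ?ltW.
split.
- exists (W f); split; [|split].
  + move=> x ax; rewrite ger0_norm ?divr_ge0 ?f0 ?g0'//.
    apply: (@le_trans _ _ (M `^ p * c * g0 a `^ k)); last first.
      by rewrite lerDr mulr_ge0// powR_ge0.
    rewrite ler_pdivrMr ?g00// (le_trans (fe _ ax))//.
    rewrite powRM ?g0'// -!mulrA ler_wpM2l// pk powRD; last first.
      by rewrite (gt_eqF (g00 ax)) implybT.
    rewrite powRr1 ?g0'// mulrC mulrA ler_wpM2r ?g0'//.
    by rewrite -[leLHS]mul1r ler_pM ?powR_ge0// g0k.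
  + move=> x y ax xy; have ay := le_trans ax xy.
    (* The change of numerator is divided by the larger density, and the change of denominator is
       multiplied by the smaller numerator, as the two preceding bounds require. *)
    have -> : f x / g0 x - f y / g0 y = (f x - f y) / g0 x - f y * ((g0 y)^-1 - (g0 x)^-1) by ring.
    apply: le_trans (ler_normB _ _) _.
    have i1 : 0 <= (f x - f y) / g0 x.
      by rewrite divr_ge0 ?subr_ge0 ?fa ?g0'.
    have i2 : 0 <= f y * ((g0 y)^-1 - (g0 x)^-1).
      by rewrite mulr_ge0 ?f0// subr_ge0 lef_pV2 ?posrE ?g00// g0_noninc.
    rewrite !ger0_norm// /W.
    have := powR_sub_le (f0 _ ay) (fa _ _ ax xy) (g00 ax) (fe _ ax).
    have := @inv_sub_le (f y) (g0 x) (g0 y) (g00 ay) (g0_noninc ax xy) (fb _ ay).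
    rewrite !mulrBr; lra.
  + move=> x ax; apply/andP; split.
      by rewrite addr_ge0// mulr_ge0 ?powR_ge0// mulr_ge0.
    apply: lerD; apply: ler_wpM2l => //; last 2 first.
    * by rewrite mulr_ge0.
    * exact: g0k.
    apply: (ge0_ler_powR (ltW gam0) (f0 _ ax) (powR_ge0 _ _)).
    by rewrite (le_trans (fe _ ax))// envelope_noninc.
- by move=> x ax; rewrite divr_ge0 ?f0 ?g0'.
- rewrite (_ : (fun x => _) = (fun x => f x * - (- (g0 x)^-1))); last first.
    by apply/funext => x; rewrite opprK.
  apply: measurable_funM; first exact: nonincreasing_on_measurable.
  apply: measurable_funN; apply: (@nonincreasing_on_measurable _ a) => x y ax xy.
  by rewrite lerN2 lef_pV2 ?posrE ?g00 ?(le_trans ax)// g0_noninc.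
Qed.

End shape.

(** * Order statistics and the finite-dimensional reduction *)

Section order_statistics.
Variables (R : realType) (n : nat) (x : 'I_n -> R).

Lemma order_index_surj i : exists p, order_index x p = i.
Proof.
have : i \in sort_tuple (fun j k => x j <= x k) (ord_tuple n).
  by rewrite mem_sort val_ord_tuple mem_enum.
by case/tnthP => p ->; exists p.
Qed.

Lemma order_index_homo (p q : 'I_n) : (p <= q)%N -> x (order_index x p) <= x (order_index x q).
Proof.
move=> pq; rewrite /order_index !(tnth_nth p) /=.
have tot : total (fun j k => x j <= x k) by move=> j k; exact: le_total.
have tr : transitive (fun j k => x j <= x k) by move=> j k l; exact: le_trans.
have rf : reflexive (fun j k => x j <= x k) by move=> j; exact: lexx.
apply: (sorted_leq_nth tr rf p (sort_sorted tot _)) => //.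
- by rewrite inE size_sort size_tuple card_ord.
- by rewrite inE size_sort size_tuple card_ord.
Qed.

End order_statistics.

Section reducibility.
Variables (R : realType) (a M gamma : R) (g0 : R -> R).
Hypotheses (M0 : 0 < M) (gamma01 : 0 < gamma < 1).
Hypotheses (g00 : forall x, a <= x -> 0 < g0 x) (g0_noninc : nonincreasing_on a g0).
Variables (n : nat) (x : 'I_n -> R).
Hypothesis ax : forall i, a <= x i.

Lemma ratio_class_discrete_shape L : ratio_class a M gamma g0 L ->
  discrete_shape M gamma g0 x (L \o x).
Proof.
move=> [f [fb fa] <-]; split => [i j ji|i] /=.
  by rewrite !divfK ?gt_eqF ?g00//; apply: fa => //; apply: order_index_homo; rewrite ji.
by rewrite divfK ?gt_eqF ?g00// fb.
Qed.

Hypothesis xinj : injective x.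

(** Consecutive inequalities chain along ranks. If the ranks disagree with [x i <= x j], the two
    values coincide and injectivity gives [i = j]. *)
Lemma discrete_shape_noninc y : discrete_shape M gamma g0 x y ->
  forall i j, x i <= x j -> y j * g0 (x j) <= y i * g0 (x i).
Proof.
move=> [ymon _] i j xij.
have [p pi] := order_index_surj x i; have [q qj] := order_index_surj x j.
have mon r : forall s : 'I_n, (p + r)%N = s ->
    y (order_index x s) * g0 (x (order_index x s)) <= y i * g0 (x i).
  elim: r => [|r IH] s.
    by rewrite addn0 => /val_inj <-; rewrite pi.
  rewrite addnS => ps; have rn : (p + r < n)%N by rewrite -ltnS ps ltnW ?ltnS.
  by apply: le_trans (IH (Ordinal rn) erefl); apply: ymon.
case: (leqP p q) => [pq|qp]; first by rewrite -qj; apply: (mon (q - p)%N); rewrite subnKC.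
have -> : i = j; last by [].
apply: xinj; apply/eqP; rewrite eq_le xij -pi -qj /=.
exact/order_index_homo/ltnW.
Qed.

Lemma discrete_shape_extension y : discrete_shape M gamma g0 x y ->
  exists2 L, ratio_class a M gamma g0 L & forall i, L (x i) = y i.
Proof.
move=> ysh; have [_ yb] := ysh; pose v i := y i * g0 (x i).
(* Beyond all sample points the maximum is over the empty set and takes the default [0], the least
   admissible value. *)
pose f t := \big[Num.max/0]_(i | t <= x i) v i.
have v0 i : 0 <= v i by case/andP: (yb i).
have fv i : f (x i) = v i.
  apply/eqP; rewrite eq_le; apply/andP; split; last exact: le_bigmax_cond.
  by apply: bigmax_le => // j xij; exact: discrete_shape_noninc.
exists (fun t => f t / g0 t) => [|i]; last by rewrite fv /v mulfK// gt_eqF// g00.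
exists f => //; split.
- move=> t at_; apply/andP; split; first exact: bigmax_ge_id.
  apply: bigmax_le => [|i ti]; first exact: powR_ge0.
  (* The bound at [x i] is inherited by every [t <= x i] because the envelope is non-increasing. *)
  by case/andP: (yb i) => _ /le_trans; apply; exact: (envelope_noninc M0 gamma01 g00 g0_noninc at_ ti).
- move=> s t as_ st; apply: bigmax_le => [|i ti]; first exact: bigmax_ge_id.
  by apply: le_bigmax_cond; exact: le_trans ti.
Qed.

Lemma finite_dim_reducibleP : finite_dim_reducible a M gamma g0 x.
Proof.
split; [exact: ratio_class_discrete_shape|exact: discrete_shape_extension].
Qed.

Lemma val_Pn_eq (l m : nat) (phi : nat -> R -> R) (mu : nat -> R) :
  val_Pn a M gamma g0 l m phi mu x = val_Pn' M gamma g0 l m phi mu x.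
Proof.
rewrite /val_Pn /val_Pn'; congr ereal_sup; apply/seteqP; split => e /=.
- move=> [L [HL HC] <-]; exists (L \o x) => //.
  by split => //; exact: ratio_class_discrete_shape.
- move=> [y [Hy HC] <-]; have [L HL Ly] := discrete_shape_extension Hy.
  have -> : y = L \o x by apply/funext => i /=; rewrite Ly.
  exists L => //; split => //.
  by have <- : y = L \o x by apply/funext => i /=; rewrite Ly.
Qed.

End reducibility.

(** * Perturbation of the linear constraints *)

Section diagonally_dominant_system.
Variables (R : realType) (q : nat) (r D : R) (Delta : 'M[R]_q).
Hypotheses (r0 : 0 < r) (rD : 2 * q%:R * D <= r).
Hypothesis DeltaD : forall i j, `|Delta i j| <= D.

(** At a coordinate of largest modulus the perturbation absorbs at most half of the diagonal term.
    With zero right-hand side this also gives the injectivity behind [dominant_system]. *)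
Lemma dominant_system_bound (t b : 'rV[R]_q) (beta : R) : 0 <= beta ->
  (forall j, `|b 0 j| <= beta) ->
  (forall j, r * t 0 j + \sum_i t 0 i * Delta i j = b 0 j) ->
  forall j, `|t 0 j| <= 2 * beta / r.
Proof.
move=> beta0 bb tb j; pose mx := \big[Num.max/0]_i `|t 0 i|.
have tmx i : `|t 0 i| <= mx by exact: le_bigmax.
have mx0 : 0 <= mx by exact: bigmax_ge_id.
have step i : r * `|t 0 i| <= beta + r / 2 * mx.
  have -> : r * `|t 0 i| = `|b 0 i - \sum_k t 0 k * Delta k i|.
    by rewrite -tb addrK normrM gtr0_norm.
  apply: le_trans (ler_normB _ _) _; apply: lerD => //.
  apply: le_trans (ler_norm_sum _ _ _) _.
  apply: (@le_trans _ _ (\sum_(k < q) mx * D)).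
    by apply: ler_sum => k _; rewrite normrM ler_pM.
  rewrite sumr_const card_ord -[leLHS]mulr_natl mulrCA [leRHS]mulrC ler_wpM2l//.
  by rewrite ler_pdivlMr// mulrC mulrA.
have : r * mx <= beta + r / 2 * mx.
  rewrite -ler_pdivlMl//; apply: bigmax_le => [|i _].
    by rewrite mulr_ge0 ?invr_ge0 ?addr_ge0 ?mulr_ge0// ltW.
  by rewrite ler_pdivlMl.
move=> h; apply: le_trans (tmx j) _; rewrite ler_pdivlMr//; lra.
Qed.

Lemma dominant_system (b : 'rV[R]_q) (beta : R) : 0 <= beta ->
  (forall j, `|b 0 j| <= beta) ->
  exists t : 'rV[R]_q, (forall j, r * t 0 j + \sum_i t 0 i * Delta i j = b 0 j) /\
    forall j, `|t 0 j| <= 2 * beta / r.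
Proof.
move=> beta0 bb; pose A := r%:M + Delta.
have eqA (t : 'rV[R]_q) j : (t *m A) 0 j = r * t 0 j + \sum_i t 0 i * Delta i j.
  by rewrite mulmxDr mul_mx_scalar !mxE.
have Au : A \in unitmx.
  rewrite -row_free_unit; apply: inj_row_free => v vA; apply/rowP => j.
  have := @dominant_system_bound v 0 0 (lexx 0) _ _ j.
  rewrite mulr0 mul0r normr_le0 mxE => H; apply/eqP; apply: H => i; first by rewrite mxE normr0.
  by rewrite -eqA vA.
exists (b *m invmx A).
have H j : r * (b *m invmx A) 0 j + \sum_i (b *m invmx A) 0 i * Delta i j = b 0 j.
  by rewrite -eqA mulmxKV.
by split => //; exact: dominant_system_bound beta0 bb H.
Qed.

End diagonally_dominant_system.

Section perturbation.
Variables (R : realType) (C : set (R -> R)) (G : (R -> R) -> nat -> R) (l m : nat) (mu : nat -> R).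
Hypothesis m_le_l : (m <= l)%N.
Local Notation q := (l - m)%N.

(** Affinity is asked only for mixtures within [C], where moments are integrable; a finite index
    type allows all anchors to be mixed at once. *)
Definition convex_affine := forall (I : finType) (p : I -> R) (L : I -> R -> R),
  (forall i, 0 <= p i) -> \sum_i p i = 1 -> (forall i, C (L i)) ->
  C (fun x => \sum_i p i * L i x) /\
  forall j, (j <= l)%N -> G (fun x => \sum_i p i * L i x) j = \sum_i p i * G (L i) j.

Hypothesis CG : convex_affine.
Variables (s r B : R) (L0 : R -> R) (Lp Lm : 'I_q -> R -> R).
Hypotheses (s0 : 0 < s) (r0 : 0 < r).
Hypothesis GB : forall L, C L -> `|G L 0%N| <= B.
Hypotheses (CL0 : C L0) (CLp : forall i, C (Lp i)) (CLm : forall i, C (Lm i)).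

(* Up to [D], the anchors satisfy the inequalities with slack [s], and their
   equality moments are the centre and the vertices of a cross-polytope of
   radius [r] around [mu]. *)
Definition anchors D := [/\
  forall j, (1 <= j <= m)%N -> G L0 j <= mu j - s + D,
  forall i j, (1 <= j <= m)%N -> G (Lp i) j <= mu j - s + D /\ G (Lm i) j <= mu j - s + D,
  forall k : 'I_q, `|G L0 (m + k).+1 - mu (m + k).+1| <= D &
  forall i k : 'I_q, `|G (Lp i) (m + k).+1 - mu (m + k).+1 - r * (i == k)%:R| <= D /\
    `|G (Lm i) (m + k).+1 - mu (m + k).+1 + r * (i == k)%:R| <= D].

(** The base weight of each of the [2 q] vertices, small enough to leave [L0] a non-negative weight.
    In [slope], [1 / s] makes the slack outweigh [D], and [2 / (r * h)] keeps the corrections of the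
    weights below [h]. *)
Let h : R := (4 * q.+1%:R)^-1.
Definition slope : R := s^-1 + 2 / (r * h).

Let h0 : 0 < h. Proof. by rewrite invr_gt0 mulr_gt0// ltr0n. Qed.

Lemma slope_gt0 : 0 < slope.
Proof. by rewrite addr_gt0 ?invr_gt0// divr_gt0// mulr_gt0. Qed.

(** The new point is [(1 - lam) L] plus [lam] times a mixture of [L0] with weight [p0] and of
    [Lp i], [Lm i] with weights [h + t i], [h - t i]. The [t i] cancel the equality defects, and
    replacing a fraction [lam] costs at most [2 * B * lam] in the objective. *)
Lemma restore_feasibility D L : 0 <= D -> slope * D <= 1 -> 2 * q%:R * D <= r ->
  anchors D -> C L ->
  (forall j, (1 <= j <= m)%N -> G L j <= mu j + D) ->
  (forall k : 'I_q, `|G L (m + k).+1 - mu (m + k).+1| <= D) ->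
  exists L', [/\ C L', moment_constraints l m mu (G L') &
    G L 0%N - 2 * B * slope * D <= G L' 0%N].
Proof.
move=> D0 sD qD [a1 a2 a3 a4] CL Lin Leq.
have feas K : (forall k : 'I_q, G K (m + k).+1 = mu (m + k).+1) ->
    forall j, (m < j <= l)%N -> G K j = mu j.
  move=> HK j /andP[mj jl]; have jq : (j - m.+1 < q)%N by rewrite -subSn// subSS leq_sub2r.
  by have := HK (Ordinal jq); rewrite /= -addSn subnKC.
(* Without defect [L] is already feasible; otherwise [lam] is positive and may be divided by. *)
case: (eqVneq D 0) => [D00|Dn0].
  exists L; split => //; last by rewrite D00 mulr0 subr0.
  split; first by move=> j /Lin; rewrite D00 addr0.
  apply: feas => k; have := Leq k; rewrite D00 normr_le0 subr_eq0 => /eqP//.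
have Dp : 0 < D by rewrite lt_neqAle eq_sym Dn0.
pose lam := slope * D.
have lam0 : 0 < lam by rewrite mulr_gt0// slope_gt0.
pose v (k : 'I_q) := G L (m + k).+1 - mu (m + k).+1.
pose v0 (k : 'I_q) := G L0 (m + k).+1 - mu (m + k).+1.
pose al (i k : 'I_q) := G (Lp i) (m + k).+1 - mu (m + k).+1 - r * (i == k)%:R.
pose be (i k : 'I_q) := G (Lm i) (m + k).+1 - mu (m + k).+1 + r * (i == k)%:R.
pose p0 : R := 1 - 2 * q%:R * h.
have p0E : 2 * q%:R * h = q%:R / (2 * q.+1%:R).
  have q1 : q.+1%:R != 0 :> R by rewrite pnatr_eq0.
  by rewrite /h; move: q.+1%:R q1 => z z0; field.
have p00 : 0 <= p0.
  rewrite subr_ge0 p0E ler_pdivrMr ?mul1r ?mulr_gt0 ?ltr0n//.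
  by rewrite -natrM ler_nat mul2n -addnn ltnW// ltnS leq_addr.
pose Delta : 'M[R]_q := \matrix_(i, k) (al i k - be i k).
(* Minus the defect, divided by [lam], of the mixture with [t = 0]; the contributions of radius [r]
   cancel between opposite vertices. *)
pose b : 'rV[R]_q := \row_k - ((1 - lam) / lam * v k + p0 * v0 k + h * \sum_i (al i k + be i k)).
have DD i k : `|Delta i k| <= 2 * D.
  rewrite mxE; have [h1 h2] := a4 i k.
  by apply: le_trans (ler_normB _ _) _; rewrite mulr2n mulrDl mul1r lerD.
have bb k : `|b 0 k| <= 2 * D / lam.
  rewrite mxE normrN; apply: (@le_trans _ _ ((1 - lam) / lam * D + p0 * D + h * (q%:R * (2 * D)))).
    apply: le_trans (ler_normD _ _) _; apply: lerD; first apply: le_trans (ler_normD _ _) _; first apply: lerD.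
    - rewrite normrM ger0_norm ?ler_wpM2l// ?Leq//; rewrite divr_ge0 ?subr_ge0// ltW//.
    - by rewrite normrM (ger0_norm p00) ler_wpM2l// a3.
    - rewrite normrM (ger0_norm (ltW h0)) ler_wpM2l// ?(ltW h0)//.
      apply: le_trans (ler_norm_sum _ _ _) _.
      apply: (@le_trans _ _ (\sum_(i < q) 2 * D)); last first.
        by rewrite sumr_const card_ord -[leLHS]mulr_natl.
      apply: ler_sum => i _; have [h1 h2] := a4 i k.
      by apply: le_trans (ler_normD _ _) _; rewrite mulr2n mulrDl mul1r lerD.
  (* The weights [p0] and [2 * q * h] add up to [1]. *)
  have -> : (1 - lam) / lam * D + p0 * D + h * (q%:R * (2 * D)) = D / lam.
    by rewrite /p0; field; rewrite gt_eqF.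
  by rewrite ler_pM2r ?invr_gt0// ler_peMl// ler1n.
have b20 : 0 <= 2 * D / lam by exact: (divr_ge0 (mulr_ge0 (ler0n R 2) D0) (ltW lam0)).
have r20 : 0 < 2 * r by rewrite mulr_gt0.
have qD2 : 2 * q%:R * (2 * D) <= 2 * r by rewrite mulrCA ler_pM2l.
have [t [tE tb]] := dominant_system r20 qD2 DD b20 bb.
have th k : `|t 0 k| <= h.
  apply: le_trans (tb k) _.
  have -> : 2 * (2 * D / lam) / (2 * r) = 2 / (r * slope).
    rewrite /lam; field; rewrite Dn0 !gt_eqF// slope_gt0//.
  rewrite ler_pdivrMr ?mulr_gt0 ?slope_gt0// /slope.
  rewrite mulrA mulrDr -[leLHS]add0r lerD//; last first.
    by rewrite le_eqVlt; apply/orP; left; apply/eqP; field; rewrite !gt_eqF.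
  by rewrite !mulr_ge0 ?invr_ge0// ltW.
pose w (i : ('I_q + 'I_q) + bool) := match i with
  | inl (inl i) => lam * (h + t 0 i) | inl (inr i) => lam * (h - t 0 i)
  | inr true => 1 - lam | inr false => lam * p0 end.
pose K (i : ('I_q + 'I_q) + bool) := match i with
  | inl (inl i) => Lp i | inl (inr i) => Lm i | inr true => L | inr false => L0 end.
have w0 i : 0 <= w i.
  case: i => [[i|i]|[|]] /=.
  - rewrite mulr_ge0 ?(ltW lam0)//; have := th i; rewrite ler_norml => /andP[]; lra.
  - rewrite mulr_ge0 ?(ltW lam0)//; have := th i; rewrite ler_norml => /andP[]; lra.
  - by rewrite subr_ge0.
  - by rewrite mulr_ge0// ltW.
have sumw (F : ('I_q + 'I_q) + bool -> R) : \sum_i w i * F i =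
    lam * (\sum_i (h + t 0 i) * F (inl (inl i)) + \sum_i (h - t 0 i) * F (inl (inr i)) +
      p0 * F (inr false)) + (1 - lam) * F (inr true).
  rewrite big_sumType /= big_sumType /= big_bool /=.
  have e1 : \sum_(i < q) lam * (h + t 0 i) * F (inl (inl i)) =
      lam * \sum_(i < q) (h + t 0 i) * F (inl (inl i)).
    by rewrite mulr_sumr; apply: eq_bigr => i _; rewrite mulrA.
  have e2 : \sum_(i < q) lam * (h - t 0 i) * F (inl (inr i)) =
      lam * \sum_(i < q) (h - t 0 i) * F (inl (inr i)).
    by rewrite mulr_sumr; apply: eq_bigr => i _; rewrite mulrA.
  by rewrite e1 e2; ring.
have sumc (c : R) : \sum_i (h + t 0 i) * c + \sum_i (h - t 0 i) * c + p0 * c = c.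
  rewrite -big_split /= (eq_bigr (fun=> 2 * h * c)); last by move=> i _; ring.
  rewrite sumr_const card_ord -[_ *+ _]mulr_natl /p0; ring.
have w1 : \sum_i w i = 1.
  by have := sumw (fun=> 1); under eq_bigr do rewrite mulr1; move=> ->; rewrite sumc; ring.
have CK i : C (K i) by case: i => [[i|i]|[|]] /=.
have [CL' GL'] := CG w0 w1 CK.
have wle (F : ('I_q + 'I_q) + bool -> R) c1 c2 :
    (forall i, F (inl (inl i)) <= c1) -> (forall i, F (inl (inr i)) <= c1) ->
    F (inr false) <= c1 -> F (inr true) <= c2 ->
    \sum_i w i * F i <= lam * c1 + (1 - lam) * c2.
  move=> F1 F2 F3 F4; have := sumw (fun i => if i is inr true then c2 else c1).
  rewrite sumc => <-; apply: ler_sum => i _; rewrite ler_wpM2l//.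
  by case: i => [[i|i]|[|]]; [exact: F1|exact: F2|exact: F4|exact: F3].
exists (fun x => \sum_i w i * K i x); split => //.
- split.
  + move=> j j1m; have jl : (j <= l)%N by case/andP: j1m => _ /leq_trans; apply.
    rewrite GL'//.
    apply: (@le_trans _ _ (lam * (mu j - s + D) + (1 - lam) * (mu j + D))).
      apply: wle => [i|i||] /=; [exact: (proj1 (a2 i j j1m))|exact: (proj2 (a2 i j j1m))|exact: a1|exact: Lin].
    have : D <= lam * s.
      rewrite /lam /slope mulrDl mulrDl mulrAC mulVf ?gt_eqF// mul1r lerDl.
      by rewrite !mulr_ge0 ?invr_ge0 ?mulr_ge0// ltW.
    have -> : lam * (mu j - s + D) + (1 - lam) * (mu j + D) = mu j + D - lam * s by ring.
    lra.
  + apply: feas => k; have kl : ((m + k).+1 <= l)%N.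
      by rewrite -ltn_subRL ltn_ord.
    rewrite GL'//; apply/eqP; rewrite -subr_eq0; apply/eqP.
    have -> : \sum_i w i * G (K i) (m + k).+1 - mu (m + k).+1 =
        \sum_i w i * (G (K i) (m + k).+1 - mu (m + k).+1).
      under [RHS]eq_bigr do rewrite mulrBr.
      by rewrite sumrB -mulr_suml w1 mul1r.
    rewrite sumw /= -big_split /=.
    have -> : \sum_i ((h + t 0 i) * (G (Lp i) (m + k).+1 - mu (m + k).+1) +
        (h - t 0 i) * (G (Lm i) (m + k).+1 - mu (m + k).+1)) =
        \sum_i (h * (al i k + be i k) + t 0 i * Delta i k + 2 * r * (t 0 i * (i == k)%:R)).
      by apply: eq_bigr => i _; rewrite mxE /al /be; ring.
    rewrite !big_split /= -!mulr_sumr.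
    have -> : \sum_i t 0 i * (i == k)%:R = t 0 k.
      rewrite (bigD1 k)//= eqxx mulr1 big1 ?addr0// => i ik.
      by rewrite (negbTE ik) mulr0.
    rewrite -[_ + _ + 2 * r * _]addrA [\sum_i _ + _]addrC tE mxE -/(v k) -/(v0 k).
    by field; rewrite gt_eqF.
- rewrite GL'// -[leRHS]opprK lerNr -sumrN.
  under eq_bigr do rewrite -mulrN.
  apply: (@le_trans _ _ (lam * B + (1 - lam) * - G L 0%N)).
    have nB L1 : C L1 -> - G L1 0%N <= B by move=> /GB; rewrite ler_norml => /andP[]; lra.
    by apply: wle => [i|i||] /=; [exact/nB/CLp|exact/nB/CLm|exact: nB|].
  have : lam * G L 0%N <= lam * B.
    by rewrite ler_wpM2l// ?(ltW lam0)// (le_trans (ler_norm _) (GB CL)).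
  have -> : lam * B + (1 - lam) * - G L 0%N = lam * B + lam * G L 0%N - G L 0%N by ring.
  have -> : - (G L 0%N - 2 * B * slope * D) = 2 * (lam * B) - G L 0%N by rewrite /lam; ring.
  by lra.
Qed.
End perturbation.

(** * Deviations and values of the sampled problem *)

Lemma ratio_class_convex (R : realType) (a M gamma : R) (g0 : R -> R)
    (I : finType) (p : I -> R) (L : I -> R -> R) :
  (forall i, 0 <= p i) -> \sum_i p i = 1 -> (forall i, ratio_class a M gamma g0 (L i)) ->
  ratio_class a M gamma g0 (fun x => \sum_i p i * L i x).
Proof.
move=> p0 p1 HL.
have /choice[f Hf] : forall i, exists f, shape_class a M gamma g0 f /\ L i = (fun x => f x / g0 x).
  by move=> i; have [f Hf fE] := HL i; exists f.
exists (fun x => \sum_i p i * f i x); last first.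
  apply/funext => x; rewrite mulr_suml; apply: eq_bigr => i _.
  by have [_ ->] := Hf i; rewrite mulrA.
split.
- move=> x ax; apply/andP; split.
    by apply: sumr_ge0 => i _; have [[fb _] _] := Hf i; rewrite mulr_ge0//; case/andP: (fb x ax).
  rewrite -[leRHS]mul1r -[X in _ <= X * _]p1 mulr_suml; apply: ler_sum => i _.
  have [[fb _] _] := Hf i; have /andP[_ fe] := fb x ax.
  exact: ler_wpM2l.
- move=> x y ax xy; apply: ler_sum => i _; have [[_ fa] _] := Hf i.
  by rewrite ler_wpM2l// fa.
Qed.

Lemma convex_affine_sample (R : realType) (a M gamma : R) (g0 : R -> R) l
    (phi : nat -> R -> R) n (x : 'I_n -> R) :
  convex_affine (ratio_class a M gamma g0)
    (fun L j => sample_mean x (L \o x) (phi j)) l.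
Proof.
move=> I p L p0 p1 HL; split; first exact: ratio_class_convex.
move=> j _; rewrite /sample_mean; under [RHS]eq_bigr do rewrite mulrCA; rewrite -mulr_sumr; congr (_ * _).
under [RHS]eq_bigr do rewrite mulr_sumr; rewrite exchange_big /=; apply: eq_bigr => i _.
by rewrite mulr_sumr; apply: eq_bigr => k _; rewrite mulrCA.
Qed.

Section deviations.
Context d (T : measurableType d) (R : realType) (P : probability T R).
Variable X : nat -> {RV P >-> R}.
Variables (a M gamma delta : R) (g0 : R -> R) (l : nat) (phi : nat -> R -> R).
Hypotheses (M_gt0 : 0 < M) (gamma01 : 0 < gamma < 1).
Hypotheses (g0_density : prob_density_on a g0) (g0_noninc : nonincreasing_on a g0).
Hypothesis X_density : forall i, has_density_on a g0 (X i).
Hypothesis X_indep : mutually_independent X.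
Hypothesis phi_measurable : forall j, (j <= l)%N -> measurable_fun `[a, +oo[ (phi j).
Hypothesis delta_gt0 : 0 < delta.
Hypothesis phi_norm : forall j, (j <= l)%N -> (norm_g0 a g0 (2 + delta) (phi j) < +oo)%E.
Local Notation E f := (\int[P]_w f w).
Local Notation D := (`[a, +oo[%classic : set R).
Local Notation class := (ratio_class a M gamma g0).

Let aX i w : a <= X i w. Proof. exact: (proj1 (X_density i)). Qed.
Let aD x : D x = (a <= x) :> Prop. Proof. by rewrite /= in_itv /= andbT. Qed.
Let g00 x : a <= x -> 0 < g0 x. Proof. exact: (proj1 g0_density). Qed.
Let mX i : measurable_fun [set: T] (X i). Proof. by []. Qed.

Lemma identically_distributed i A : measurable A -> P (X i @^-1` A) = P (X 0%N @^-1` A).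
Proof. by move=> mA; rewrite (proj2 (X_density i))// (proj2 (X_density 0%N)). Qed.

Lemma measurable_comp_support (h : R -> R) : measurable_fun D h ->
  measurable_fun [set: T] (fun w => h (X 0%N w)).
Proof.
move=> mh; have mh' : measurable_fun [set: R] (h \_ D) by apply/(measurable_restrictT h).
rewrite (_ : (fun w => _) = (h \_ D) \o X 0%N); first exact: measurableT_comp mh' (mX 0).
by apply/funext => w /=; rewrite patchE mem_set// aD.
Qed.

Lemma integ_phi j : (j <= l)%N -> integ P (fun w => `|phi j (X 0%N w)|).
Proof.
move=> jl.
have p0 : 0 < 2 + delta by rewrite addr_gt0.
have Ip := integ_norm_g0 g0_density g0_noninc (X_density 0%N) p0 (phi_measurable jl) (phi_norm jl).
have [I1 _] := integD (integ_cst P 1) Ip.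
apply: integ_dominated I1 _.
  apply: (measurable_comp_support (h := fun x => `|phi j x|)).
  by apply: measurableT_comp => //; exact: phi_measurable.
move=> w; rewrite ger0_norm// -[leLHS]expr1 pow_le1_powR//.
by rewrite (@le_trans _ _ 2) ?ler_nat// lerDl ltW.
Qed.

Lemma integ_phi_class j L : (j <= l)%N -> class L ->
  integ P (fun w => phi j (X 0%N w) * L (X 0%N w)) /\
  expect_g0 a g0 (fun x => phi j x * L x) = E (fun w => phi j (X 0%N w) * L (X 0%N w)).
Proof.
move=> jl CL; have [B HB] := ratio_class_variation M_gt0 gamma01 g00 g0_noninc.
have [[W [LB _]] L0 mL] := HB _ CL.
have mphiL : measurable_fun D (fun x => phi j x * L x).
  by apply: measurable_funM => //; exact: phi_measurable.
split; last exact: (expect_g0E g0_density g0_noninc (X_density 0%N) mphiL).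
have [IB _] := integZ B (integ_phi jl).
apply: integ_dominated IB _; first exact: measurable_comp_support mphiL.
by move=> w; rewrite normrM mulrC ler_wpM2r// LB.
Qed.

Lemma convex_affine_expect :
  convex_affine class (fun L j => expect_g0 a g0 (fun x => phi j x * L x)) l.
Proof.
move=> I p L p0 p1 HL; have HC := ratio_class_convex p0 p1 HL; split => // j jl.
rewrite (proj2 (integ_phi_class jl HC)).
have If i : integ P (fun w => p i * (phi j (X 0%N w) * L i (X 0%N w))).
  by have [] := integZ (p i) (proj1 (integ_phi_class jl (HL i))).
transitivity (E (fun w => \sum_i p i * (phi j (X 0%N w) * L i (X 0%N w)))).
  by apply: eq_Rintegral => w _; rewrite mulr_sumr; apply: eq_bigr => i _; rewrite mulrCA.
rewrite (proj2 (integ_sum_seq _ If)); apply: eq_bigr => i _.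
by have [Ii ->] := integ_phi_class jl (HL i); rewrite (proj2 (integZ (p i) Ii)).
Qed.

Lemma expect_bounded : exists2 B, 0 <= B & forall j L, (j <= l)%N -> class L ->
  `|expect_g0 a g0 (fun x => phi j x * L x)| <= B.
Proof.
have [B HB] := ratio_class_variation M_gt0 gamma01 g00 g0_noninc.
pose m := \sum_(j < l.+1) E (fun w => `|phi j (X 0%N w)|).
exists (`|B| * m) => [|j L jl CL].
  by rewrite mulr_ge0// sumr_ge0// => j _; apply: Rintegral_ge0.
have [I1 ->] := integ_phi_class jl CL; have [[W [LB _]] L0 mL] := HB _ CL.
have B0 : 0 <= B by apply: le_trans (normr_ge0 _) (LB _ (lexx a)).
apply: le_trans (le_normr_Rintegral measurableT I1) _.
have [IB EB] := integZ B (integ_phi jl).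
apply: (@le_trans _ _ (E (fun w => B * `|phi j (X 0%N w)|))).
  apply: integ_le => //; last by move=> w; rewrite normrM mulrC ler_wpM2r// LB.
  exact: (integrable_norm I1).
rewrite EB ger0_norm// ler_wpM2l//.
have jl' : (j < l.+1)%N by [].
rewrite /m (bigD1 (Ordinal jl'))//= lerDl sumr_ge0// => k _; exact: Rintegral_ge0.
Qed.

Section one_sided.
Variable h : R -> R.
Hypotheses (mh : measurable_fun [set: R] h) (h0 : forall x, 0 <= h x).
Hypothesis hp : integ P (fun w => h (X 0%N w) `^ (2 + delta)).

Lemma deviation_nonneg : exists (Dn Sn : nat -> T -> R) (C : R), [/\
  forall n, (0 < n)%N -> [/\ integ P (Dn n), forall w, 0 <= Dn n w,
    E (Dn n) <= C / Num.sqrt n%:R & deviation_control X a h n (Dn n)],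
  forall n, measurable_fun [set: T] (Sn n), forall n w, 0 <= Sn n w,
  \forall w \ae P, Sn n w @[n --> \oo] --> (0 : R) &
  forall n, (0 < n)%N -> deviation_control X a h n (Sn n)].
Proof.
have h2 := integ_phi2 mh h0 delta_gt0 hp.
have [Q [Q0 grid]] := quantile_gridP g0_density g0_noninc (X_density 0%N) mh h2.
have [Dn [C HD]] := uniform_deviation_rate X_indep identically_distributed aX mh h0 delta_gt0 hp Q0 grid.
have h1 := integ_phi1 mh h0 delta_gt0 hp.
have HD' n : (0 < n)%N -> [/\ integ P (Dn n), forall w, 0 <= Dn n w,
    E (Dn n) <= C / Num.sqrt n%:R & deviation_control X a h n (Dn n)].
  move=> n0; have [? ? ? H] := HD n n0; split => // w B L W LW _ IL; exact: H LW IL.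
have [Sn [? ? ? ?]] := uniform_slln aX h0 h1 HD'.
by exists Dn, Sn, C.
Qed.

End one_sided.

(** A number bounding all deviations replaces their supremum, so that measurability is asked only of
    the bounds. *)
Definition class_deviation j n w (e : R) := forall L, class L ->
  `|sample_mean (fun i : 'I_n => X i w) (L \o (fun i : 'I_n => X i w)) (phi j) -
    expect_g0 a g0 (fun x => phi j x * L x)| <= e.

(** The one-sided bounds are applied to the positive and negative parts of [phi j], extended by [0]
    to the left of [a], and added. *)
Lemma deviation_phi j : (j <= l)%N -> exists (Dn Sn : nat -> T -> R) (C : R), [/\
  forall n, (0 < n)%N -> [/\ integ P (Dn n), forall w, 0 <= Dn n w,
    E (Dn n) <= C / Num.sqrt n%:R & forall w, class_deviation j n w (Dn n w)],
  forall n, measurable_fun [set: T] (Sn n), forall n w, 0 <= Sn n w,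
  \forall w \ae P, Sn n w @[n --> \oo] --> (0 : R) &
  forall n w, (0 < n)%N -> class_deviation j n w (Sn n w)].
Proof.
move=> jl; have [B HB] := ratio_class_variation M_gt0 gamma01 g00 g0_noninc.
pose hp := (fun x => Num.max (phi j x) 0) \_ D.
pose hm := (fun x => Num.max (- phi j x) 0) \_ D.
have mphi := phi_measurable jl.
have mhp : measurable_fun [set: R] hp.
  by apply/(measurable_restrictT (fun x => Num.max (phi j x) 0)) => //; exact: measurable_maxr.
have mhm : measurable_fun [set: R] hm.
  apply/(measurable_restrictT (fun x => Num.max (- phi j x) 0)) => //.
  by apply: measurable_maxr => //; exact: measurable_funN.
have hp0 x : 0 <= hp x.
  by rewrite /hp patchE; case: ifPn => // _; rewrite le_max lexx orbT.
have hm0 x : 0 <= hm x.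
  by rewrite /hm patchE; case: ifPn => // _; rewrite le_max lexx orbT.
have hpE x : a <= x -> hp x = Num.max (phi j x) 0 by move=> ax; rewrite /hp patchE mem_set// aD.
have hmE x : a <= x -> hm x = Num.max (- phi j x) 0 by move=> ax; rewrite /hm patchE mem_set// aD.
have phiE x : a <= x -> phi j x = hp x - hm x.
  by move=> ax; rewrite hpE// hmE//; case: (leP (phi j x) 0); case: (leP (- phi j x) 0); lra.
have pd0 : 0 < 2 + delta by rewrite addr_gt0.
have Ip := integ_norm_g0 g0_density g0_noninc (X_density 0%N) pd0 mphi (phi_norm jl).
have dom (u : R -> R) : measurable_fun [set: R] u -> (forall x, 0 <= u x) ->
    (forall x, a <= x -> u x <= `|phi j x|) -> integ P (fun w => u (X 0%N w) `^ (2 + delta)).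
  move=> mu u0 uphi; apply: integ_dominated Ip _.
    apply: (measurableT_comp (measurable_powR (2 + delta))).
    exact: (measurableT_comp mu (mX 0)).
  move=> w; rewrite ger0_norm ?powR_ge0//.
  by apply: ge0_ler_powR; rewrite ?nnegrE//; [exact: ltW|exact: uphi].
have Ihp : integ P (fun w => hp (X 0%N w) `^ (2 + delta)).
  by apply: dom => // x ax; rewrite hpE// ge_max ler_norm normr_ge0.
have Ihm : integ P (fun w => hm (X 0%N w) `^ (2 + delta)).
  by apply: dom => // x ax; rewrite hmE// ge_max normr_ge0 andbT -normrN ler_norm.
have [Dp [Sp [Cp [HDp mSp Sp0 Spc HSp]]]] := deviation_nonneg mhp hp0 Ihp.
have [Dm [Sm [Cm [HDm mSm Sm0 Smc HSm]]]] := deviation_nonneg mhm hm0 Ihm.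
(* Passing to the absolute value gives a non-negative constant without exhibiting a member of the
   class. *)
have B0 : exists2 B', 0 <= B' & forall L, class L -> exists W, variation_bound a B' L W.
  exists `|B|; first exact: normr_ge0.
  move=> L CL; have [[W [LB HW]] _ _] := HB _ CL; exists W.
  have -> : `|B| = B by apply: ger0_norm; apply: le_trans (normr_ge0 _) (LB _ (lexx a)).
  by split.
have [B' B'0 HB'] := B0.
have comb n w (ep em : R) : (0 < n)%N ->
    (forall B (L W : R -> R), variation_bound a B L W -> (forall x, a <= x -> 0 <= L x) ->
      integ P (fun w => hp (X 0%N w) * L (X 0%N w)) ->
      `|emp_dev X n (fun x => hp x * L x) w| <= B * ep) ->
    (forall B (L W : R -> R), variation_bound a B L W -> (forall x, a <= x -> 0 <= L x) ->
      integ P (fun w => hm (X 0%N w) * L (X 0%N w)) ->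
      `|emp_dev X n (fun x => hm x * L x) w| <= B * em) ->
    class_deviation j n w (B' * (ep + em)).
  move=> n0 Hep Hem L CL; have [W LW] := HB' _ CL; have [_ L0 mL] := HB _ CL.
  have IL (u : R -> R) : measurable_fun [set: R] u -> (forall x, 0 <= u x) ->
      (forall x, a <= x -> u x <= `|phi j x|) -> integ P (fun w => u (X 0%N w) * L (X 0%N w)).
    move=> mu u0 uphi; have [IB _] := integZ B' (integ_phi jl).
    apply: integ_dominated IB _.
      apply: (measurable_comp_support (h := fun x => u x * L x)).
      by apply: measurable_funM => //; exact: measurable_funTS.
    move=> w'; rewrite normrM (ger0_norm (u0 _)) mulrC ler_pM ?uphi//.
    by case: LW => LB _; exact: LB.
  have ILp : integ P (fun w => hp (X 0%N w) * L (X 0%N w)).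
    by apply: IL => // x ax; rewrite hpE// ge_max ler_norm normr_ge0.
  have ILm : integ P (fun w => hm (X 0%N w) * L (X 0%N w)).
    by apply: IL => // x ax; rewrite hmE// ge_max normr_ge0 andbT -normrN ler_norm.
  rewrite (proj2 (integ_phi_class jl CL)).
  have -> : sample_mean (fun i : 'I_n => X i w) (L \o (fun i : 'I_n => X i w)) (phi j) -
      E (fun w => phi j (X 0%N w) * L (X 0%N w)) =
      emp_dev X n (fun x => hp x * L x) w - emp_dev X n (fun x => hm x * L x) w.
    have -> : E (fun w => phi j (X 0%N w) * L (X 0%N w)) =
        E (fun w => hp (X 0%N w) * L (X 0%N w)) - E (fun w => hm (X 0%N w) * L (X 0%N w)).
      rewrite -RintegralB//; apply: eq_Rintegral => w' _.
      by rewrite (phiE _ (aX 0%N w')) mulrBl.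
    have -> : sample_mean (fun i : 'I_n => X i w) (L \o (fun i : 'I_n => X i w)) (phi j) =
        emp_mean X n (fun x => hp x * L x) w - emp_mean X n (fun x => hm x * L x) w.
      rewrite /emp_mean -mulrBr -sumrB; congr (_ * _); apply: eq_bigr => i _ /=.
      by rewrite (phiE _ (aX i w)) mulrBl.
    rewrite /emp_dev; ring.
  by rewrite mulrDr (le_trans (ler_normB _ _))// lerD ?(Hep _ _ _ LW)// ?(Hem _ _ _ LW).
exists (fun n w => B' * (Dp n w + Dm n w)), (fun n w => B' * (Sp n w + Sm n w)), (B' * (Cp + Cm)).
split.
- move=> n n0; have [Ip1 Dp0 Ep cp] := HDp n n0; have [Im1 Dm0 Em cm] := HDm n n0.
  have [Is Es] := integD Ip1 Im1; have [Iz Ez] := integZ B' Is; split => //.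
  + by move=> w; rewrite mulr_ge0// addr_ge0.
  + by rewrite Ez Es -mulrA ler_wpM2l// mulrDl lerD.
  + by move=> w; apply: comb => // B1 L W; [exact: cp|exact: cm].
- move=> n; apply: measurable_funM => //; exact: measurable_funD.
- by move=> n w; rewrite mulr_ge0// addr_ge0.
- apply: filterS2 Spc Smc => w cp cm.
  rewrite (_ : 0 = B' * (0 + 0)); last by rewrite addr0 mulr0.
  by apply: cvgMr => //; exact: (cvgD cp cm).
- by move=> n w n0; apply: comb => // B1 L W; [exact: HSp|exact: HSm].
Qed.

End deviations.

Lemma uniform_slack (R : realType) (m : nat) (e mu : nat -> R) :
  (forall j, (1 <= j <= m)%N -> e j < mu j) ->
  exists2 s, 0 < s & forall j, (1 <= j <= m)%N -> e j <= mu j - s.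
Proof.
elim: m => [_|m IH H].
  by exists 1 => // j /andP[j1]; rewrite leqNgt j1.
have [|s s0 Hs] := IH.
  by move=> j /andP[j1 jm]; apply: H; rewrite j1 ltnW.
have Hm := H m.+1; rewrite /= leqnn in Hm; have {}Hm := Hm erefl.
exists (Num.min s (mu m.+1 - e m.+1)); first by rewrite lt_min s0 subr_gt0.
move=> j /andP[j1]; rewrite leq_eqVlt => /predU1P[->|jm].
  by rewrite lerBrDr -lerBrDl ge_min lexx orbT.
by rewrite lerBrDr -lerBrDl ge_min lerBrDl -lerBrDr Hs// j1.
Qed.

(** * From moment deviations to optimal values *)

Section value_perturbation.
Context d (T : measurableType d) (R : realType) (P : probability T R).
Variable X : nat -> {RV P >-> R}.
Variables (a M gamma delta : R) (g0 : R -> R) (l m : nat) (phi : nat -> R -> R) (mu : nat -> R).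
Hypotheses (M_gt0 : 0 < M) (gamma01 : 0 < gamma < 1) (m_le_l : (m <= l)%N).
Hypotheses (g0_density : prob_density_on a g0) (g0_noninc : nonincreasing_on a g0).
Hypothesis X_density : forall i, has_density_on a g0 (X i).
Hypothesis phi_measurable : forall j, (j <= l)%N -> measurable_fun `[a, +oo[ (phi j).
Hypothesis delta_gt0 : 0 < delta.
Hypothesis phi_norm : forall j, (j <= l)%N -> (norm_g0 a g0 (2 + delta) (phi j) < +oo)%E.
Local Notation class := (ratio_class a M gamma g0).
Local Notation q := (l - m)%N.
Local Notation e L j := (expect_g0 a g0 (fun x => phi j x * L x)).

Variable L0 : R -> R.
Hypothesis CL0 : class L0.
Hypothesis L0_lt : forall j, (1 <= j <= m)%N -> e L0 j < mu j.
Hypothesis L0_eq : forall j, (m < j <= l)%N -> e L0 j = mu j.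
Hypothesis interior_mu : interior
         [set (\row_(k < q) e L (m + k).+1) | L in class] (\row_(k < q) mu (m + k).+1).

Let eqidx (k : 'I_q) : (m < (m + k).+1 <= l)%N.
Proof. by rewrite ltnS leq_addr /= -ltn_subRL ltn_ord. Qed.

Let B_ex := expect_bounded M_gt0 gamma01 g0_density g0_noninc X_density phi_measurable
  delta_gt0 phi_norm.

(** Interiority provides members with equality moments [mu] shifted by [eps / 2] along each axis,
    but says nothing of the inequalities; mixing them with [L0] restores slack at the price of a
    smaller radius. *)
Lemma anchors_exist : exists s r : R, exists Lp Lm : 'I_q -> R -> R,
  [/\ 0 < s, 0 < r, forall i, class (Lp i), forall i, class (Lm i) &
   anchors (fun L j => e L j) mu s r L0 Lp Lm 0].
Proof.
have [B B0 HB] := B_ex.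
have [s s0 Hs] := uniform_slack L0_lt.
move: interior_mu => /nbhs_ballP[eps /= eps0 ball_sub].
have /choice[Ap HAp] : forall i : 'I_q, exists L, class L /\
    forall k : 'I_q, e L (m + k).+1 = mu (m + k).+1 + eps / 2 * (i == k)%:R.
  move=> i; have [L CL EL] : [set (\row_(k < q) e L (m + k).+1) | L in class]
      (\row_(k < q) (mu (m + k).+1 + eps / 2 * (i == k)%:R)).
    apply: ball_sub; split => // u v; rewrite !mxE /ball /= opprD addNKr normrN.
    case: (i == v); rewrite ?mulr1 ?mulr0 ?normr0//.
    by rewrite gtr0_norm ?divr_gt0// ltr_pdivrMr// ltr_pMr// ltr1n.
  by exists L; split => // k; have := congr1 (fun v : 'rV_q => v 0 k) EL; rewrite !mxE.
have /choice[Am HAm] : forall i : 'I_q, exists L, class L /\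
    forall k : 'I_q, e L (m + k).+1 = mu (m + k).+1 - eps / 2 * (i == k)%:R.
  move=> i; have [L CL EL] : [set (\row_(k < q) e L (m + k).+1) | L in class]
      (\row_(k < q) (mu (m + k).+1 - eps / 2 * (i == k)%:R)).
    apply: ball_sub; split => // u v; rewrite !mxE /ball /= opprB addrC subrK.
    case: (i == v); rewrite ?mulr1 ?mulr0 ?normr0//.
    by rewrite gtr0_norm ?divr_gt0// ltr_pdivrMr// ltr_pMr// ltr1n.
  by exists L; split => // k; have := congr1 (fun v : 'rV_q => v 0 k) EL; rewrite !mxE.
(* Inequality moments move by at most [2 * al * B <= s / 2], so half of the slack remains; the [1]
   covers [B = 0]. *)
pose al := Num.min 1 (s / (4 * B + 1)).
have B41 : 0 < 4 * B + 1 by rewrite ltr_wpDl// mulr_ge0.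
have al0 : 0 < al by rewrite lt_min ltr01 divr_gt0.
have al1 : al <= 1 by rewrite ge_min lexx.
have als : al * (4 * B) <= s.
  have : al * (4 * B + 1) <= s by rewrite -ler_pdivlMr// ge_min lexx orbT.
  by rewrite mulrDr mulr1; lra.
have mix L : class L -> exists L', class L' /\
    forall j, (j <= l)%N -> e L' j = (1 - al) * e L0 j + al * e L j.
  move=> CL; pose p b : R := if b then al else 1 - al; pose K b := if b then L else L0.
  have p0 b : 0 <= p b by case: b; rewrite /p ?subr_ge0// ltW.
  have p1 : \sum_b p b = 1 by rewrite big_bool /= addrC subrK.
  have CK b : class (K b) by case: b.
  have [CL' HL'] := convex_affine_expect M_gt0 gamma01 g0_density g0_noninc X_density
    phi_measurable delta_gt0 phi_norm p0 p1 CK.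
  exists (fun x => \sum_b p b * K b x); split => // j jl.
  by rewrite HL'// big_bool /= addrC.
have /choice[Lp HLp] : forall i : 'I_q, exists L', class L' /\
    forall j, (j <= l)%N -> e L' j = (1 - al) * e L0 j + al * e (Ap i) j.
  by move=> i; apply: mix; have [] := HAp i.
have /choice[Lm HLm] : forall i : 'I_q, exists L', class L' /\
    forall j, (j <= l)%N -> e L' j = (1 - al) * e L0 j + al * e (Am i) j.
  by move=> i; apply: mix; have [] := HAm i.
have slack L' L j : (1 <= j <= m)%N -> class L ->
    (forall j, (j <= l)%N -> e L' j = (1 - al) * e L0 j + al * e L j) ->
    e L' j <= mu j - s / 2 + 0.
  move=> jm CL H; have jl : (j <= l)%N by case/andP: jm => _ /leq_trans; apply.
  rewrite H// addr0; have := Hs j jm.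
  have := HB j L jl CL; have := HB j L0 jl CL0; rewrite !ler_norml => /andP[b1 _] /andP[_ b2].
  have h1 : al * e L j <= al * B by rewrite ler_pM2l.
  have h2 : - (al * B) <= al * e L0 j by rewrite -mulrN ler_pM2l.
  rewrite mulrBl mul1r; move: als; rewrite mulrCA; lra.
exists (s / 2), (al * (eps / 2)), Lp, Lm; split.
- by rewrite divr_gt0.
- by rewrite mulr_gt0// divr_gt0.
- by move=> i; have [] := HLp i.
- by move=> i; have [] := HLm i.
- split.
  + by move=> j jm; rewrite addr0 (le_trans (Hs j jm))// lerD2l lerN2 ler_piMr ?invf_le1 ?ler1n// ltW.
  + move=> i j jm; split.
      by have [_ H] := HLp i; apply: slack H => //; have [] := HAp i.
    by have [_ H] := HLm i; apply: slack H => //; have [] := HAm i.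
  + by move=> k; rewrite L0_eq ?eqidx// subrr normr0.
  + move=> i k; have kl : ((m + k).+1 <= l)%N by have /andP[] := eqidx k.
    rewrite (proj2 (HLp i))// (proj2 (HLm i))// L0_eq ?eqidx//.
    rewrite (proj2 (HAp i)) (proj2 (HAm i)).
    by split; rewrite [X in `|X|](_ : _ = 0) ?normr0//; ring.
Qed.

Local Notation V := (val_P a M gamma g0 l m phi mu).
Local Notation sample n w := (fun i : 'I_n => X i w).
Local Notation Vn n w := (val_Pn a M gamma g0 l m phi mu (sample n w)).

Lemma val_P_fin_num : V \is a fin_num.
Proof.
have [B B0 HB] := B_ex.
rewrite fin_numE; apply/andP; split.
- apply/negP => /eqP VN.
  have : ((e L0 0%N)%:E <= V)%E.
    apply: ereal_sup_ubound; exists L0 => //; split => //; split => // j jm.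
    exact/ltW/L0_lt.
  by rewrite VN leeNy_eq.
- apply/negP => /eqP Vy.
  have : (V <= B%:E)%E.
    apply: ge_ereal_sup => _ [L [CL _] <-]; rewrite lee_fin.
    by have := HB 0%N L (leq0n l) CL; apply: le_trans; exact: ler_norm.
  by rewrite Vy leye_eq.
Qed.

(** The anchors, exact for expectations, are anchors up to [dev] for sample means, so feasibility
    can be restored on either side. In the constant, [1] is the change of objective between the two
    problems and [2 * (B + 1) * sl] the price of restoring feasibility. *)
Lemma val_perturbation : exists d0 Cp : R, [/\ 0 < d0, 0 <= Cp &
  forall n w dev, 0 <= dev -> dev <= d0 ->
    (forall j, (j <= l)%N -> class_deviation X a M gamma g0 phi j n w dev) ->
    (`|Vn n w - V| <= (Cp * dev)%:E)%E].
Proof.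
have [B B0 HB] := B_ex.
have [s [r [Lp [Lm [s0 r0 CLp CLm [a1 a2 a3 a4]]]]]] := anchors_exist.
pose sl := slope l m s r.
have sl0 : 0 < sl by exact: slope_gt0.
(* The three caps bound the sample objective by [B + 1], keep the mixing weight at most [1], and
   ensure diagonal dominance. *)
pose d0 := Num.min 1 (Num.min sl^-1 (r / (2 * q%:R + 1))).
have q1 : 0 < 2 * q%:R + 1 :> R by rewrite ltr_wpDl// mulr_ge0.
have d00 : 0 < d0 by rewrite !lt_min ltr01 invr_gt0 sl0 divr_gt0.
exists d0, (1 + 2 * (B + 1) * sl); split => //.
  by rewrite addr_ge0// mulr_ge0 ?(ltW sl0)// mulr_ge0// addr_ge0.
move=> n w dv dv0 dvd dev.
have d1 : dv <= 1 by rewrite (le_trans dvd)// ge_min lexx.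
have dsl : sl * dv <= 1.
  by rewrite mulrC -ler_pdivlMr// mul1r (le_trans dvd)// !ge_min lexx /= orbT.
have dq : 2 * q%:R * dv <= r.
  apply: (@le_trans _ _ ((2 * q%:R + 1) * dv)); first by rewrite ler_wpM2r// lerDl.
  by rewrite mulrC -ler_pdivlMr// (le_trans dvd)// !ge_min lexx !orbT.
pose eh (L : R -> R) j := sample_mean (sample n w) (L \o sample n w) (phi j).
have dE L j : class L -> (j <= l)%N -> `|eh L j - e L j| <= dv.
  by move=> CL jl; exact: dev.
have jl j : (1 <= j <= m)%N -> (j <= l)%N by case/andP => _ /leq_trans; apply.
have kl (k : 'I_q) : ((m + k).+1 <= l)%N by have /andP[] := eqidx k.
have up L j : class L -> (j <= l)%N -> eh L j <= e L j + dv.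
  by move=> CL jL; have := dE L j CL jL; rewrite ler_distl => /andP[].
have dn L j : class L -> (j <= l)%N -> e L j <= eh L j + dv.
  by move=> CL jL; have := dE L j CL jL; rewrite distrC ler_distl => /andP[].
have anc_e : anchors (fun L j => e L j) mu s r L0 Lp Lm dv.
  split.
  - by move=> j jm; have := a1 j jm; lra.
  - by move=> i j jm; have [h1 h2] := a2 i j jm; split; lra.
  - by move=> k; rewrite (le_trans (a3 k)).
  - by move=> i k; have [h1 h2] := a4 i k; split; rewrite ?(le_trans h1) ?(le_trans h2).
have anc_h : anchors eh mu s r L0 Lp Lm dv.
  split.
  - by move=> j jm; have := a1 j jm; have := up L0 j CL0 (jl j jm); lra.
  - move=> i j jm; have [h1 h2] := a2 i j jm.
    by have := up _ j (CLp i) (jl j jm); have := up _ j (CLm i) (jl j jm); split; lra.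
  - move=> k; have := a3 k; rewrite normr_le0 subr_eq0 => /eqP <-; exact: dE.
  - move=> i k; have [] := a4 i k; rewrite !normr_le0 => /eqP h1 /eqP h2; split.
      have := dE _ _ (CLp i) (kl k); congr (`|_| <= _); lra.
    have := dE _ _ (CLm i) (kl k); congr (`|_| <= _); lra.
have GB L : class L -> `|e L 0%N| <= B + 1.
  by move=> CL; rewrite (le_trans (HB 0%N L (leq0n l) CL))// lerDl.
have GBh L : class L -> `|eh L 0%N| <= B + 1.
  move=> CL; rewrite -(subrK (e L 0%N) (eh L 0%N)) addrC (le_trans (ler_normD _ _))//.
  by rewrite lerD ?HB// (le_trans (dE _ _ CL (leq0n l))).
have CGh : convex_affine class eh l by move=> I p K; exact: convex_affine_sample.
have CGe : convex_affine class (fun L j => e L j) l.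
  by move=> I p K; exact: (convex_affine_expect M_gt0 gamma01 g0_density g0_noninc X_density
    phi_measurable delta_gt0 phi_norm).
have V1 : (V <= Vn n w + ((1 + 2 * (B + 1) * sl) * dv)%:E)%E.
  apply: ge_ereal_sup => _ [L [CL [Lin Leq]] <-].
  have [|k|L' [CL' fL' oL']] := restore_feasibility m_le_l CGh s0 r0 GBh CL0 CLp CLm dv0 dsl dq anc_h CL.
  - by move=> j jm; rewrite (le_trans (up L j CL (jl j jm)))// lerD2r Lin.
  - by rewrite -(Leq _ (eqidx k)); exact: dE.
  have : ((eh L' 0%N)%:E <= Vn n w)%E by apply: ereal_sup_ubound; exists L'.
  move=> h; apply: (@le_trans _ _ ((eh L' 0%N)%:E + ((1 + 2 * (B + 1) * sl) * dv)%:E)%E).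
    rewrite -EFinD lee_fin; have := dn L 0%N CL (leq0n l); move: oL'; rewrite -/sl; lra.
  by rewrite leeD2r.
have V2 : (Vn n w <= V + ((1 + 2 * (B + 1) * sl) * dv)%:E)%E.
  apply: ge_ereal_sup => _ [L [CL [Lin Leq]] <-].
  have [|k|L' [CL' fL' oL']] := restore_feasibility m_le_l CGe s0 r0 GB CL0 CLp CLm dv0 dsl dq anc_e CL.
  - by move=> j jm; rewrite (le_trans (dn L j CL (jl j jm)))// lerD2r Lin.
  - by rewrite -(Leq _ (eqidx k)) distrC; exact: dE.
  have : ((e L' 0%N)%:E <= V)%E by apply: ereal_sup_ubound; exists L'.
  move=> h; apply: (@le_trans _ _ ((e L' 0%N)%:E + ((1 + 2 * (B + 1) * sl) * dv)%:E)%E).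
    rewrite -EFinD lee_fin; have := up L 0%N CL (leq0n l); move: oL'; rewrite -/sl /eh; lra.
  by rewrite leeD2r.
move: V1 V2; set c := (1 + _) * dv; move: val_P_fin_num; case: V => // v _.
(* As the true value is finite, an infinite sampled value would violate one of the two
   inequalities. *)
case: (Vn n w) => [u| |].
- by rewrite -!EFinD !lee_fin ler_norml => *; apply/andP; split; lra.
- by rewrite -EFinD leye_eq.
- by rewrite addNye leeNy_eq.
Qed.

End value_perturbation.

(** * Distinctness and convergence *)

Section distinct_sample.
Context d (T : measurableType d) (R : realType) (P : probability T R).
Variables (X : nat -> {RV P >-> R}) (a : R) (g0 : R -> R).
Hypotheses (g0_density : prob_density_on a g0) (g0_noninc : nonincreasing_on a g0).
Hypothesis X_density : forall i, has_density_on a g0 (X i).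
Hypothesis X_indep : mutually_independent X.
Local Notation E f := (\int[P]_w f w).

Let mX i : measurable_fun [set: T] (X i). Proof. by []. Qed.

Lemma E_comp_indep i j (u v : R -> R) (b c : R) : (i < j)%N ->
  measurable_fun [set: R] u -> measurable_fun [set: R] v ->
  (forall x, `|u x| <= b) -> (forall x, `|v x| <= c) ->
  E (fun w => u (X i w) * v (X j w)) = E (fun w => u (X i w)) * E (fun w => v (X j w)).
Proof.
move=> ij mu mv ub vb.
have [f1 _] := future_independentM X_indep (future_independent_cst X i (1 : R)) mu ub.
have [_] := future_independentM X_indep (future_independent_le ij f1) mv vb.
by under eq_Rintegral do rewrite mul1r; under [X in _ = X * _ -> _]eq_Rintegral do rewrite mul1r.
Qed.

(** Equal points share a cell of the quantile grid for [phi = 0]. By independence this has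
    probability at most [2 ^ K * (Q / 2 ^ K) ^ 2], which vanishes as [K] grows. *)
Lemma ae_distinct_pair i j : (i < j)%N -> \forall w \ae P, X i w != X j w.
Proof.
move=> ij; have aX k w : a <= X k w by exact: (proj1 (X_density k)).
pose A := [set w | X i w = X j w].
have mA : measurable A.
  rewrite (_ : A = (fun w => X i w - X j w) @^-1` [set 0]).
    by rewrite -[_ @^-1` _]setTI; apply: (measurable_funB (mX i) (mX j)).
  apply/seteqP; split => w /=; first by move=> ->; rewrite subrr.
  by move/eqP; rewrite subr_eq0 => /eqP.
have [Q [Q0 grid]] : exists Q, 0 <= Q /\ forall K, exists r, quantile_grid X a (cst 0) Q K r.
  apply: (quantile_gridP g0_density g0_noninc (X_density 0%N)) => //.
  by rewrite /cst /=; under eq_fun do rewrite expr0n; exact: integ_cst.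
have PA K : fine (P A) <= Q ^+ 2 / 2 ^+ K.
  have [r [r0 r_nd rQ]] := grid K.
  have N1 : (2 ^ K).-1.+1 = (2 ^ K)%N by rewrite prednK// expn_gt0.
  pose N := (2 ^ K).-1; pose c k x := tail N r k x - tail N r k.+1 x : R.
  have mc k : measurable_fun [set: R] (c k) by apply: measurable_funB; exact: measurable_tail.
  have c01 k x : 0 <= c k x <= 1.
    rewrite /c subr_ge0 tail_noninc//= lerBlDr (le_trans (tail_le1 _ _ _ _))//.
    by rewrite lerDl tail_ge0.
  have c1 k x : `|c k x| <= 1 by case/andP: (c01 k x) => h1 h2; rewrite ger0_norm.
  have Ec k l : (k <= N)%N -> 0 <= E (fun w => c k (X l w)) <= Q / 2 ^+ K.
    move=> kN; apply/andP; split.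
      by apply: Rintegral_ge0 => w _; case/andP: (c01 k (X l w)).
    rewrite (E_ident (identically_distributed X_density) l (mc k)).
    have := rQ k k.+1 (leqnSn k) (ltac:(by rewrite -N1)).
    rewrite subSnn mulr1 natrX; apply: le_trans; rewrite le_eqVlt; apply/orP; left; apply/eqP.
    by apply: eq_Rintegral => w _; rewrite /cst expr0n /= addr0 mul1r.
  have bck k l : bounded_measurable (fun w => c k (X l w)).
    by split; [exact: (measurableT_comp (mc k) (mX l))|exists 1 => w].
  have bcc k : bounded_measurable (fun w => c k (X i w) * c k (X j w)) by exact: bmeasM.
  rewrite -E_indic//.
  apply: (@le_trans _ _ (E (fun w => \sum_(k < N.+1) c k (X i w) * c k (X j w)))).
    apply: bmeas_E_le; first exact: bmeas_indic.
      exact: (bmeas_sum _ (f := fun k w => c k (X i w) * c k (X j w))).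
    move=> w; rewrite indicE; case: (boolP (w \in A)) => [|_] /=; last first.
      by apply: sumr_ge0 => k _; rewrite mulr_ge0//; case/andP: (c01 k (X i w)); case/andP: (c01 k (X j w)).
    rewrite inE => ->; have [k kN tk] := tail_index r0 r_nd (aX j w).
    have kN' : (k < N.+1)%N by [].
    rewrite (bigD1 (Ordinal kN'))//= /c !tk leqnn ltnn subr0 mulr1 lerDl.
    by apply: sumr_ge0 => k' _; rewrite -/(c k' (X j w)) -expr2 sqr_ge0.
  rewrite (@bmeas_E_sum _ _ _ P _ (fun k w => c k (X i w) * c k (X j w)))//.
  apply: (@le_trans _ _ (\sum_(k < N.+1) (Q / 2 ^+ K) ^+ 2)).
    apply: ler_sum => k _; rewrite (E_comp_indep ij (mc k) (mc k) (c1 k) (c1 k)) expr2.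
    have /andP[h1 h2] := Ec k i (leq_ord k); have /andP[h3 h4] := Ec k j (leq_ord k).
    exact: ler_pM.
  rewrite sumr_const card_ord N1 -[leLHS]mulr_natl natrX le_eqVlt; apply/orP; left; apply/eqP.
  by field; rewrite expf_neq0.
have PA0 : P A = 0%E.
  have : fine (P A) <= 0.
    apply/ler_addgt0Pr => e e0; rewrite add0r.
    pose K := Num.truncn (Q ^+ 2 / e); apply: le_trans (PA K) _.
    rewrite ler_pdivrMr ?exprn_gt0// -ler_pdivrMl// mulrC.
    apply: (@le_trans _ _ K.+1%:R); first by rewrite ltW// truncnS_gt.
    by rewrite -natrX ler_nat ltn_expl.
  move=> h; have PAf : P A \is a fin_num by exact: fin_num_measure.
  have h0 : fine (P A) = 0 by apply/eqP; rewrite eq_le h fine_ge0.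
  by rewrite -(fineK PAf) h0.
exists A; split => // w /= /negP; rewrite negbK => /eqP //.
Qed.

Lemma ae_injective_sample :
  \forall w \ae P, forall n, injective (fun i : 'I_n => X i w).
Proof.
have : \forall w \ae P, forall i j, (i < j)%N -> X i w != X j w.
  apply: ae_foralln => i; apply: ae_foralln => j.
  case: (ltnP i j) => ij; last by apply: aeW => w.
  by apply: filterS (ae_distinct_pair ij).
apply: filterS => w H n i j Xij; apply: val_inj; apply/eqP.
case: (ltngtP (i : nat) j) => // ij.
- by have := H _ _ ij; rewrite Xij eqxx.
- by have := H _ _ ij; rewrite Xij eqxx.
Qed.

End distinct_sample.

Lemma markov_integ d (T : measurableType d) (R : realType) (P : probability T R)
    (D : T -> R) (c : R) : integ P D -> (forall w, 0 <= D w) -> 0 < c ->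
  measurable [set w | c <= D w] /\ (P [set w | (c <= D w)%R] <= (\int[P]_w D w / c)%:E)%E.
Proof.
move=> ID D0 c0; set A := [set w | c <= D w].
have mD : measurable_fun [set: T] D by apply/measurable_EFinP; case/integrableP: ID.
have mA : measurable A by rewrite -[A]setTI; exact: measurable_fun_ler.
split => //; have bA := bmeas_indic R mA.
have : fine (P A) <= \int[P]_w D w / c.
  rewrite ler_pdivlMr// mulrC -E_indic// -bmeas_EZ//; apply: integ_le => //.
    by apply: bmeas_integrable; apply: bmeasM => //; exact: bmeas_cst.
  move=> w; rewrite indicE; case: (boolP (w \in A)); rewrite ?inE /= ?mulr1 ?mulr0//.
by rewrite -lee_fin fineK// fin_num_measure.
Qed.

Lemma limn_esup_le_near (R : realType) (u : nat -> \bar R) (e : \bar R) N :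
  (forall n, (N <= n)%N -> (u n <= e)%E) -> (limn_esup u <= e)%E.
Proof.
move=> H; apply: le_trans (_ : (ereal_sup (u @` [set n | (N <= n)%N]) <= e)%E).
  apply: ereal_inf_lbound; exists [set n | (N <= n)%N] => //; exists N => //.
by apply: ge_ereal_sup => _ [n Nn <-]; exact: H.
Qed.

Theorem corollary3 (R : realType)
    (a M gamma delta : R) (g0 : R -> R)
    (l m : nat) (phi : nat -> R -> R) (mu : nat -> R)
    (d : measure_display) (Omega : measurableType d) (P : probability Omega R)
    (X : nat -> {RV P >-> R})
    (M_gt0 : 0 < M) (gamma01 : 0 < gamma < 1) (m_le_l : (m <= l)%N)
    (g0_density : prob_density_on a g0)
    (g0_noninc : nonincreasing_on a g0)
    (X_density : forall i, has_density_on a g0 (X i))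
    (X_indep : mutually_independent X)
    (phi_measurable : forall j, (j <= l)%N -> measurable_fun `[a, +oo[ (phi j))
    (total_mass : exists j, (1 <= j <= l)%N /\ forall x, a <= x -> phi j x = 1)
    (delta_gt0 : 0 < delta)
    (phi_norm : forall j, (j <= l)%N ->
       (norm_g0 a g0 (2 + delta) (phi j) < +oo)%E)
    (slater : exists L0, [/\ ratio_class a M gamma g0 L0,
       (forall j, (1 <= j <= m)%N ->
          expect_g0 a g0 (fun x => phi j x * L0 x) < mu j) &
       (forall j, (m < j <= l)%N ->
          expect_g0 a g0 (fun x => phi j x * L0 x) = mu j)])
    (interior_mu :
       interior
         [set (\row_(k < l - m)
                 expect_g0 a g0 (fun x => phi (m + k).+1 x * L x))
         | L in ratio_class a M gamma g0]
         (\row_(k < l - m) mu (m + k).+1)) :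
  let V : \bar R := val_P a M gamma g0 l m phi mu in
  let sample (n : nat) (w : Omega) : 'I_n -> R := fun i => X i w in
  let Vn (n : nat) (w : Omega) : \bar R :=
    val_Pn a M gamma g0 l m phi mu (sample n w) in
  let Vn' (n : nat) (w : Omega) : \bar R :=
    val_Pn' M gamma g0 l m phi mu (sample n w) in
  [/\ (\forall w \ae P, forall n, injective (sample n w)),
      (forall (n : nat) (w : Omega), (0 < n)%N -> injective (sample n w) ->
         finite_dim_reducible a M gamma g0 (sample n w) /\ Vn n w = Vn' n w),
      cvg_as_outer P (fun n w => `|Vn n w - V|%E) (fun _ => 0%E) &
      bounded_in_outer_prob P
        (fun n w => ((Num.sqrt n%:R)%:E * (Vn n w - V))%E)].
Proof.
move=> V sample Vn Vn'.
have g00 x : a <= x -> 0 < g0 x by exact: (proj1 g0_density).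
have aX i w : a <= X i w by exact: (proj1 (X_density i)).
have [L0 [CL0 L0lt L0eq]] := slater.
have Vfin : V \is a fin_num.
  exact: (val_P_fin_num M_gt0 gamma01 g0_density g0_noninc X_density phi_measurable
    delta_gt0 phi_norm CL0 L0lt L0eq).
have [d0 [Cp [d00 Cp0 Hpert]]] := val_perturbation M_gt0 gamma01 m_le_l g0_density g0_noninc
  X_density phi_measurable delta_gt0 phi_norm CL0 L0lt L0eq interior_mu.
(* Two bounds are kept for each moment: [Dn] has a good expectation at every [n], [Sn] vanishes
   almost surely. Indices beyond [l] get the default [0]. *)
have /choice[F HF] : forall j, exists DSC : (nat -> Omega -> R) * (nat -> Omega -> R) * R,
  (j <= l)%N -> let: (Dn, Sn, C) := DSC in [/\
  forall n, (0 < n)%N -> [/\ integ P (Dn n), forall w, 0 <= Dn n w,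
    \int[P]_w Dn n w <= C / Num.sqrt n%:R &
    forall w, class_deviation X a M gamma g0 phi j n w (Dn n w)],
  forall n, measurable_fun [set: Omega] (Sn n), forall n w, 0 <= Sn n w,
  \forall w \ae P, Sn n w @[n --> \oo] --> (0 : R) &
  forall n w, (0 < n)%N -> class_deviation X a M gamma g0 phi j n w (Sn n w)].
  move=> j; case: (leqP j l) => [jl|lj]; last by exists (fun=> fun=> 0, fun=> fun=> 0, 0).
  have [Dn [Sn [C H]]] := deviation_phi M_gt0 gamma01 g0_density g0_noninc X_density X_indep
    phi_measurable delta_gt0 phi_norm jl.
  by exists (Dn, Sn, C).
pose Dn (j : nat) := (F j).1.1; pose Sn (j : nat) := (F j).1.2; pose C j := (F j).2.
have HD (j : nat) : (j <= l)%N -> [/\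
  forall n, (0 < n)%N -> [/\ integ P (Dn j n), forall w, 0 <= Dn j n w,
    \int[P]_w Dn j n w <= C j / Num.sqrt n%:R &
    forall w, class_deviation X a M gamma g0 phi j n w (Dn j n w)],
  forall n, measurable_fun [set: Omega] (Sn j n), forall n w, 0 <= Sn j n w,
  \forall w \ae P, Sn j n w @[n --> \oo] --> (0 : R) &
  forall n w, (0 < n)%N -> class_deviation X a M gamma g0 phi j n w (Sn j n w)].
  by move=> /HF; rewrite /Dn /Sn /C; case: (F j) => [[? ?] ?].
(* Sums over [j] serve as common bounds for all moments. *)
pose DT n w := \sum_(j < l.+1) Dn j n w; pose ST n w := \sum_(j < l.+1) Sn j n w.
pose CT := \sum_(j < l.+1) C j.
have devD n w (D : nat -> R) : (forall j, (j <= l)%N -> 0 <= D j) ->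
    (forall j, (j <= l)%N -> class_deviation X a M gamma g0 phi j n w (D j)) ->
    forall j, (j <= l)%N -> class_deviation X a M gamma g0 phi j n w (\sum_(j < l.+1) D j).
  move=> Dp HDj j jl L CL; apply: le_trans (HDj j jl L CL) _.
  have jl' : (j < l.+1)%N by [].
  rewrite (bigD1 (Ordinal jl'))//= lerDl; apply: sumr_ge0 => k _; apply: Dp; exact: leq_ord.
have DT0 n w : (0 < n)%N -> 0 <= DT n w.
  move=> n0; apply: sumr_ge0 => j _; have [H _ _ _ _] := HD j (leq_ord j).
  by have [_ h _ _] := H n n0; exact: h.
have ST0 n w : 0 <= ST n w.
  by apply: sumr_ge0 => j _; have [_ _ h _ _] := HD j (leq_ord j); exact: h.
have pertD n w : (0 < n)%N -> DT n w <= d0 -> (`|Vn n w - V| <= (Cp * DT n w)%:E)%E.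
  move=> n0 Dd; apply: Hpert => //; first exact: DT0.
  apply: (devD n w (fun j => Dn j n w)) => j jl; have [H _ _ _ _] := HD j jl;
    by have [_ h1 _ h2] := H n n0.
have pertS n w : (0 < n)%N -> ST n w <= d0 -> (`|Vn n w - V| <= (Cp * ST n w)%:E)%E.
  move=> n0 Sd; apply: Hpert => //; apply: (devD n w (fun j => Sn j n w)) => j jl.
    by have [_ _ h _ _] := HD j jl; exact: h.
  by have [_ _ _ _ h] := HD j jl; exact: h.
split.
- exact: (ae_injective_sample g0_density g0_noninc X_density X_indep).
- move=> n w n0 inj; split.
    by apply: finite_dim_reducibleP => // i; exact: aX.
  by apply: val_Pn_eq => // i; exact: aX.
- have /choice[U HU] : forall n, exists U, min_measurable_majorant P
      (fun w => `| `|Vn n w - V| - 0|%E) U.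
    by move=> n; exact: min_measurable_majorant_exists.
  exists U; split => //.
  have mST n : measurable_fun [set: Omega] (ST n).
    apply: measurable_sum => j; have [_ h _ _ _] := HD j (leq_ord j); exact: h.
  pose Gn n w := if (0 < n)%N && (ST n w <= d0) then (Cp * ST n w)%:E else +oo%E.
  have mG n : measurable_fun [set: Omega] (Gn n).
    apply: measurable_fun_ifT => //.
    + case: (0 < n)%N => //=; exact: measurable_fun_ler.
    + by apply/measurable_EFinP; exact: measurable_funM.
  have ZG n w : (`| `|Vn n w - V| - 0| <= Gn n w)%E.
    rewrite sube0 abse_id /Gn; case: ifPn => [/andP[n0 Sd]|_]; last exact: leey.
    exact: pertS.
  have UG : \forall w \ae P, forall n, (U n w <= Gn n w)%E.
    apply: ae_foralln => n; have [_ _ H] := HU n; apply: H => //.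
    by apply: aeW => w; exact: ZG.
  have Slim : \forall w \ae P, ST n w @[n --> \oo] --> (0 : R).
    have : \forall w \ae P, forall j, (j <= l)%N -> Sn j n w @[n --> \oo] --> (0 : R).
      apply: ae_foralln => j; case: (leqP j l) => jl; last by apply: aeW => w.
      by have [_ _ _ h _] := HD j jl; apply: filterS h.
    apply: filterS => w Hw.
    have : forall k, (k <= l.+1)%N -> \sum_(j < k) Sn j n w @[n --> \oo] --> (0 : R).
      elim=> [_|k IH kl].
        by under eq_fun do rewrite big_ord0; exact: cvg_cst.
      rewrite (_ : (fun n => _) = (fun n => \sum_(j < k) Sn j n w + Sn k n w)); last first.
        by apply/funext => n; rewrite big_ord_recr.
      by have := cvgD (IH (ltnW kl)) (Hw k kl); rewrite addr0; apply.
    by apply.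
  apply: filterS2 UG Slim => w UGw Sw.
  apply: (@squeeze_cvge _ _ _ _ (cst 0%E) (U^~ w) (fun n => (Cp * ST n w)%:E)); last 2 first.
  + exact: cvg_cst.
  + apply: cvg_EFin; first by apply: nearW.
    rewrite (_ : 0 = Cp * 0); last by rewrite mulr0.
    exact: cvgMr.
  have /cvgr_lt /(_ _ d00) [N _ HN] := Sw.
  exists N.+1 => // n /= Nn; apply/andP; split.
    have [_ HZ _] := HU n; apply: le_trans (HZ w); exact: abse_ge0.
  have Sd : ST n w <= d0 by exact/ltW/(HN n (ltnW Nn)).
  by apply: le_trans (UGw n) _; rewrite /Gn (leq_ltn_trans _ Nn)//= Sd.
- have DTi n : (0 < n)%N -> integ P (DT n) /\ \int[P]_w DT n w <= CT / Num.sqrt n%:R.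
    move=> n0.
    have If j : integ P (fun w => if (j <= l)%N then Dn j n w else 0).
      case: (leqP j l) => jl; last exact: integ_cst.
      by have [H _ _ _ _] := HD j jl; have [? _ _ _] := H n n0.
    have [I1 E1] := integ_sum l.+1 If.
    have DE : DT n = fun w => \sum_(j < l.+1) (if (j <= l)%N then Dn j n w else 0).
      by apply/funext => w; apply: eq_bigr => j _; rewrite leq_ord.
    rewrite DE; split => //; rewrite E1 /CT mulr_suml; apply: ler_sum => j _.
    by rewrite leq_ord; have [H _ _ _ _] := HD j (leq_ord j); have [_ _ ? _] := H n n0.
  have CT0 : 0 <= CT.
    have [_] := DTi 1%N erefl; rewrite sqrtr1 divr1; apply: le_trans.
    by apply: Rintegral_ge0 => w _; exact: DT0.
  (* Markov's inequality at this level leaves at most [eps / 2]; the [1] keeps [K] positive when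
     [Cp * CT = 0]. *)
  move=> eps eps0; pose K := 2 * (Cp * CT + 1) / eps.
  have CC : 0 <= Cp * CT by rewrite mulr_ge0.
  have K0 : 0 < K by rewrite divr_gt0// mulr_gt0// ltr_wpDl.
  exists K => //.
  (* From here on [CT / (d0 * sqrt n) <= eps / 2], which bounds the probability that the deviation
     leaves the range of the perturbation bound. *)
  pose N := (Num.truncn ((2 * CT / (d0 * eps)) ^+ 2)).+1.
  apply: (@limn_esup_le_near _ _ _ N) => n Nn.
  have n0 : (0 < n)%N by exact: leq_trans Nn.
  have sn0 : 0 < Num.sqrt n%:R :> R by rewrite sqrtr_gt0 ltr0n.
  have [Id Ed] := DTi n n0; have D0' w := DT0 n w n0.
  have [m1 P1] := markov_integ Id D0' d00.
  have [Iz Ez] := integZ (Num.sqrt n%:R * Cp) Id.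
  have D0'' w : 0 <= Num.sqrt n%:R * Cp * DT n w by rewrite !mulr_ge0// ltW.
  have [m2 P2] := markov_integ Iz D0'' K0.
  set A1 := [set w | d0 <= DT n w] in m1 P1; set A2 := [set w | K <= _] in m2 P2.
  apply: (@le_trans _ _ (P (A1 `|` A2))).
    apply: ereal_inf_lbound; exists (A1 `|` A2) => //; split; first exact: measurableU.
    move=> w /= Kw; case: (leP d0 (DT n w)) => h; [by left|right].
    rewrite /A2 /= -lee_fin; apply: le_trans Kw _.
    rewrite abseM gee0_abs ?lee_fin ?sqrtr_ge0// -mulrA EFinM.
    by apply: lee_wpmul2l; [rewrite lee_fin sqrtr_ge0|exact: pertD (ltW h)].
  apply: le_trans (measureU2 _ m1 m2) _; apply: le_trans (leeD P1 P2) _.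
  rewrite -EFinD lee_fin Ez.
  have b1 : \int[P]_w DT n w / d0 <= eps / 2.
    rewrite ler_pdivrMr//; apply: le_trans Ed _; rewrite ler_pdivrMr//.
    rewrite -ler_pdivrMl ?mulr_gt0// ?divr_gt0//.
    have -> : (eps / 2 * d0)^-1 * CT = 2 * CT / (d0 * eps) by field; rewrite !gt_eqF.
    rewrite -[leLHS]ger0_norm ?divr_ge0 ?mulr_ge0 ?(ltW d00) ?(ltW eps0)// -sqrtr_sqr ler_sqrt ?ltr0n//.
    by rewrite (@le_trans _ _ N%:R)// ?ler_nat// ltW// truncnS_gt.
  have b2 : Num.sqrt n%:R * Cp * \int[P]_w DT n w / K <= eps / 2.
    have h : Num.sqrt n%:R * Cp * \int[P]_w DT n w <= Cp * CT.
      by rewrite mulrAC mulrC ler_wpM2l// mulrC -ler_pdivlMr.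
    rewrite ler_pdivrMr//; apply: (le_trans h).
    have -> : eps / 2 * K = Cp * CT + 1 by rewrite /K; field; rewrite gt_eqF.
    by rewrite lerDl.
  by rewrite [leRHS]splitr lerD.
Qed.
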